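(* Let $n=2$ and let the medium $a_Y:\mathbb{R}^2\to\mathbb{R}^{2\times2}$ be evenly symmetric, i.e. $a_Y(y_1,y_2)=a_Y(-y_1,y_2)=a_Y(y_1,-y_2)$ for all $y\in\mathbb{R}^2$. This symmetry guarantees that the effective coefficients $A$, $C$ of the medium have the form $$A=\mathrm{diag}(a_1,a_2),\qquad C_{iiii}=:\alpha_i\ (i=1,2),\qquad C_{ijij}=C_{ijji}=C_{iijj}=:\beta\ (i,j\in\{1,2\},\ i\ne j),$$ all other entries of $C$ being zero; this defines $a_1,a_2,\alpha_1,\alpha_2,\beta$. Let $w^\varepsilon$ be the solution of the weakly dispersive wave equation $$\partial_t^2w^\varepsilon-AD^2w^\varepsilon-\varepsilon^2\partial_t^2ED^2w^\varepsilon+\varepsilon^2FD^4w^\varepsilon=0,\qquad w^\varepsilon(\cdot,0)=f,\quad\partial_tw^\varepsilon(\cdot,0)=0,$$ written as $w^\varepsilon(r,\varphi,t)$ in the elliptic coordinates $(x_1,x_2)=(r\sqrt{a_1}\cos\varphi,\,r\sqrt{a_2}\sin\varphi)$. Define $$W^\varepsilon(r,\varphi,t):=\begin{cases}w^\varepsilon\big(r+\tfrac{t}{\varepsilon^2},\varphi,\tfrac{t}{\varepsilon^2}\big)&\text{for } r>-t\varepsilon^{-2},\\ 0&\text{for } r\le -t\varepsilon^{-2}.\end{cases}$$ Assume that, as $\varepsilon\to0$, $W^\varepsilon$ has a limit in the sense of distributions, $W^\varepsilon\rightharpoonup W$ in $\mathcal{D}'(\mathbb{R}\times\mathbb{R}\times(0,T))$.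 Then the distribution $U:=\partial_rW$ satisfies, in the distributional sense, the linearized cylindrical Korteweg–de Vries equation $$\partial_tU+\frac1{2t}U-\frac12\kappa(\varphi)\,\partial_r^3U=0,$$ where the dispersion coefficient $\kappa$ is given by $$\kappa(\varphi):=6\beta\,\frac{\cos^2(\varphi)}{a_1}\frac{\sin^2(\varphi)}{a_2}+\alpha_1\frac{\cos^4(\varphi)}{a_1^2}+\alpha_2\frac{\sin^4(\varphi)}{a_2^2}.$$
   Context: Standing assumptions: $a_Y\in C^1(\mathbb{R}^2,\mathbb{R}^{2\times2})$ is $Y$-periodic for $Y=(-\pi,\pi)^2$, pointwise symmetric, and uniformly positive definite ($\xi\cdot a_Y(y)\xi\ge\gamma|\xi|^2$ for some $\gamma>0$ and all $y,\xi\in\mathbb{R}^2$). The initial datum $f:\mathbb{R}^2\to\mathbb{R}$ lies in $L^1(\mathbb{R}^2)\cap L^2(\mathbb{R}^2)$ and has compactly supported Fourier transform. $T>0$ is fixed. Effective coefficients: for $k\in(-1/2,1/2)^2$ let $\mu_0(k)$ be the smallest eigenvalue of $-(\nabla_y+\mathrm{i}k)\cdot(a_Y(y)(\nabla_y+\mathrm{i}k)\psi)=\mu\psi$ with $Y$-periodic $\psi$; it is even in $k$ and analytic near $0$. $A$ and $C$ are the coefficients of the Taylor expansion of $\mu_0$ at $0$: $A_{lm}=\frac12\partial_{k_l}\partial_{k_m}\mu_0(0)$ and $C_{lmnq}=\frac1{24}\partial_{k_l}\partial_{k_m}\partial_{k_n}\partial_{k_q}\mu_0(0)$; $A$ is symmetric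 and positive definite. $E\in\mathbb{R}^{2\times2}$ and $F\in\mathbb{R}^{2\times2\times2\times2}$ are symmetric, positive semi-definite tensors ($E_{ij}=E_{ji}$, $\sum E_{ij}\eta_i\eta_j\ge0$ for all $\eta\in\mathbb{R}^2$; $F_{ijkl}=F_{klij}$, $\sum F_{ijkl}\xi_{ij}\xi_{kl}\ge0$ for all $\xi\in\mathbb{R}^{2\times2}$) such that $-CD^4=ED^2AD^2-FD^4$ as differential operators, where $AD^2=\sum A_{ij}\partial_i\partial_j$, $ED^2=\sum E_{ij}\partial_i\partial_j$, $CD^4=\sum C_{ijkl}\partial_i\partial_j\partial_k\partial_l$, $FD^4=\sum F_{ijkl}\partial_i\partial_j\partial_k\partial_l$ (spatial derivatives). The solution $w^\varepsilon$ is the unique one which, for every $T_0>0$, lies in $L^\infty(0,T_0\varepsilon^{-2};H^2(\mathbb{R}^2))\cap W^{1,\infty}(0,T_0\varepsilon^{-2};H^1(\mathbb{R}^2))$.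
   Formalization: The form of A and C is proved for pointwise diagonal evenly symmetric a_Y (it fails for constant a_Y with nonzero off-diagonal entries); the cKdV claim is proved for every medium whose A and C have the stated form. *)

(* Defs.v *)
From HB Require Import structures.
From mathcomp Require Import all_boot all_order all_algebra.
From mathcomp Require Import complex.
From mathcomp Require Import all_classical all_reals all_analysis.
Set Implicit Arguments.
Unset Strict Implicit.
Unset Printing Implicit Defensive.
Import Order.TTheory GRing.Theory Num.Theory numFieldNormedType.Exports.
Local Open Scope classical_set_scope.
Local Open Scope ring_scope.

Notation leb1 R := (@lebesgue_measure R).
Notation leb2 R := (@lebesgue_measure R \x @lebesgue_measure R)%E.
Notation leb3 R :=
  ((@lebesgue_measure R \x @lebesgue_measure R) \x @lebesgue_measure R)%E.

(** The plane is [R * R]; space-time [(x, t)], and also the coordinates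
    [(r, phi, t)], live in [R * R * R]. *)

Definition coord (R : realType) (x : R * R) (i : 'I_2) : R :=
  if i == 0 then x.1 else x.2.

Definition e2 (R : realType) (i : 'I_2) : R * R :=
  ((i == 0)%:R, (i == 1)%:R).

Definition e3 (R : realType) (i : 'I_2) : R * R * R := (e2 R i, 0).

Definition et (R : realType) : R * R * R := (0, 1).

Section Smooth.
Context {R : realType} {V : normedModType R}.

Fixpoint Dseq (s : seq V) (f : V -> R) : V -> R :=
  if s is v :: s' then fun x => 'D_v (Dseq s' f) x else f.

Definition C_on (n : nat) (U : set V) (f : V -> R) : Prop :=
  forall s : seq V, (size s <= n)%N -> forall x, U x ->
    {for x, continuous (Dseq s f)} /\
    ((size s < n)%N -> forall v, derivable (Dseq s f) x v).

Definition smooth_on (U : set V) (f : V -> R) : Prop :=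
  forall n, C_on n U f.

Definition supp (Z : nmodType) (f : V -> Z) : set V :=
  closure [set x | f x != 0].

Definition test_fun (Omega : set V) (phi : V -> R) : Prop :=
  [/\ smooth_on setT phi, compact (supp phi) & supp phi `<=` Omega].

Definition op2 (M : 'M[R]_2) (e : 'I_2 -> V) (f : V -> R) (x : V) : R :=
  \sum_(i < 2) \sum_(j < 2) M i j * Dseq [:: e i; e j] f x.

Definition op4 (K : 'I_2 -> 'I_2 -> 'I_2 -> 'I_2 -> R) (e : 'I_2 -> V)
    (f : V -> R) (x : V) : R :=
  \sum_(i < 2) \sum_(j < 2) \sum_(k < 2) \sum_(l < 2)
    K i j k l * Dseq [:: e i; e j; e k; e l] f x.

End Smooth.

Section Sobolev.
Context {R : realType}.
Implicit Types (u v : R * R -> R) (w : R * R * R -> R).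

Definition L2_loc u : Prop :=
  measurable_fun setT u /\
  forall K : set (R * R), compact K ->
    (\int[leb2 R]_(x in K) ((u x) ^+ 2)%:E < +oo)%E.

Definition weak_partial (i : 'I_2) u v : Prop :=
  forall phi, test_fun setT phi ->
    \int[leb2 R]_x (u x * 'D_(e2 R i) phi x) =
    - \int[leb2 R]_x (v x * phi x).

(** [g [:: i1; ...; ip]] is the weak derivative of [u] in the directions
    [i1, ..., ip]; bounding each [L^2] norm is bounding an equivalent norm of
    [H^m]. *)
Definition Hm_bounded (m : nat) (M : R) u : Prop :=
  exists g : seq 'I_2 -> R * R -> R,
    [/\ g [::] = u,
        forall s, (size s <= m)%N ->
          g s \in Lfun (leb2 R) 2%:E /\
          ('N[leb2 R]_2%:E [EFin \o g s] <= M%:E)%E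
      & forall s, (size s < m)%N ->
          forall i, weak_partial i (g s) (g (i :: s))].

(** [L^oo(0, tau; H^m(R^2))]; as [L^2(R^2)] and [H^m(R^2)] are separable, joint
    measurability yields Bochner measurability. *)
Definition Linfty_Hm (tau : R) (m : nat) w : Prop :=
  measurable_fun [set p : R * R * R | 0 < p.2 < tau] w /\
  exists M : R, {ae leb1 R, forall t, 0 < t < tau ->
    Hm_bounded m M (fun x => w (x, t))}.

Definition W1infty_Hm (tau : R) (m : nat) w : Prop :=
  Linfty_Hm tau m w /\
  exists2 w' : R * R * R -> R, Linfty_Hm tau m w' &
    forall phi, test_fun [set p : R * R * R | 0 < p.2 < tau] phi ->
      \int[leb3 R]_(p in [set p | 0 < p.2 < tau]) (w p * 'D_(et R) phi p) =
      - \int[leb3 R]_(p in [set p | 0 < p.2 < tau]) (w' p * phi p).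

End Sobolev.

Section Bloch.
Context {R : realType}.

Definition Cintegral (h : R * R -> R[i]) : R[i] :=
  ((\int[leb2 R]_x complex.Re (h x)) +i* (\int[leb2 R]_x complex.Im (h x)))%C.

Definition fourier (f : R * R -> R) (k : R * R) : R[i] :=
  Cintegral (fun x =>
    let kx := k.1 * x.1 + k.2 * x.2 in
    (f x * cos kx +i* - (f x * sin kx))%C).

Definition Y_periodic (X : Type) (h : R * R -> X) : Prop :=
  forall y1 y2, h (y1 + 2 * pi, y2) = h (y1, y2) /\
                h (y1, y2 + 2 * pi) = h (y1, y2).

(** [mu] is an eigenvalue of
    [- (nabla + i k) . (a (nabla + i k) psi) = mu psi] with [psi] in
    [H^1_per(Y; C)] nonzero. For a merely [C^1] coefficient an eigenfunction need
    not be [C^2], so the equation is meant in the sense of distributions;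
    [g] is the weak gradient of [psi]. *)
Definition Bloch_eigenvalue (a : R * R -> 'M[R]_2) (k : R * R) (mu : R) : Prop :=
  exists (psi : R * R -> R[i]) (g : 'I_2 -> R * R -> R[i]),
  [/\ Y_periodic psi,
      ~ {ae leb2 R, forall y, psi y = 0},
      L2_loc (fun y => complex.Re (psi y)) /\
      L2_loc (fun y => complex.Im (psi y)),
      forall j,
        [/\ L2_loc (fun y => complex.Re (g j y)),
            L2_loc (fun y => complex.Im (g j y)),
            weak_partial j (fun y => complex.Re (psi y))
                           (fun y => complex.Re (g j y))
          & weak_partial j (fun y => complex.Im (psi y))
                           (fun y => complex.Im (g j y))]
    & forall phi : R * R -> R, test_fun setT phi ->
        Cintegral (fun y => \sum_(i < 2) \sum_(j < 2)
          (a y i j)%:C%C * (g j y + 'i%C * (coord k j)%:C%C * psi y) *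
          (('D_(e2 R i) phi y)%:C%C - 'i%C * (coord k i)%:C%C * (phi y)%:C%C))
        = mu%:C%C * Cintegral (fun y => psi y * (phi y)%:C%C)].

Definition smallest_Bloch_eigenvalue (a : R * R -> 'M[R]_2) (k : R * R)
    (mu : R) : Prop :=
  Bloch_eigenvalue a k mu /\ forall nu, Bloch_eigenvalue a k nu -> mu <= nu.

Definition effA (mu0 : R * R -> R) : 'M[R]_2 :=
  \matrix_(l, m) (2^-1 * Dseq [:: e2 R l; e2 R m] mu0 0).

Definition effC (mu0 : R * R -> R) (l m n q : 'I_2) : R :=
  24^-1 * Dseq [:: e2 R l; e2 R m; e2 R n; e2 R q] mu0 0.

Definition even_form (A : 'M[R]_2) (C : 'I_2 -> 'I_2 -> 'I_2 -> 'I_2 -> R)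
    (a alpha : 'I_2 -> R) (beta : R) : Prop :=
  [/\ A = diag_mx (\row_i a i),
      forall i, C i i i i = alpha i,
      forall i j, i != j ->
        [/\ C i j i j = beta, C i j j i = beta & C i i j j = beta]
    & forall l m n q,
        ~~ [|| (l == m) && (n == q), (l == n) && (m == q)
             | (l == q) && (m == n)] -> C l m n q = 0].

End Bloch.

Section Medium.
Context {R : realType}.

Definition medium (a : R * R -> 'M[R]_2) : Prop :=
  [/\ forall i j, C_on 1 setT (fun y => a y i j),
      Y_periodic a,
      forall y, (a y)^T = a y
    & exists2 gamma : R, 0 < gamma & forall y (xi : 'I_2 -> R),
        gamma * (\sum_i xi i ^+ 2) <= \sum_i \sum_j xi i * a y i j * xi j].

(** This is reflection invariance of [- nabla . (a nabla)] only when the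
    off-diagonal entries of [a] vanish: a reflection also changes their sign. *)
Definition evenly_symmetric (a : R * R -> 'M[R]_2) : Prop :=
  forall y1 y2, a (y1, y2) = a (- y1, y2) /\ a (y1, y2) = a (y1, - y2).

Definition posdef (A : 'M[R]_2) : Prop :=
  A^T = A /\ forall eta : 'I_2 -> R, (exists i, eta i != 0) ->
    0 < \sum_i \sum_j A i j * eta i * eta j.

Definition symm_psd2 (E : 'M[R]_2) : Prop :=
  E^T = E /\ forall eta : 'I_2 -> R, 0 <= \sum_i \sum_j E i j * eta i * eta j.

Definition symm_psd4 (F : 'I_2 -> 'I_2 -> 'I_2 -> 'I_2 -> R) : Prop :=
  (forall i j k l, F i j k l = F k l i j) /\
  forall xi : 'M[R]_2,
    0 <= \sum_i \sum_j \sum_k \sum_l F i j k l * xi i j * xi k l.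

Definition decomposes (A : 'M[R]_2) (C : 'I_2 -> 'I_2 -> 'I_2 -> 'I_2 -> R)
    (E : 'M[R]_2) (F : 'I_2 -> 'I_2 -> 'I_2 -> 'I_2 -> R) : Prop :=
  forall u : R * R -> R, smooth_on setT u -> forall x,
    - op4 C (e2 R) u x = op2 E (e2 R) (op2 A (e2 R) u) x - op4 F (e2 R) u x.

End Medium.

Section Wave.
Context {R : realType}.

(** The equation is tested with functions that need not vanish at [t = 0];
    integrating by parts twice in time, with [w = f] and [d_t w = 0] at [t = 0],
    produces the boundary term [f * (d_t phi - eps^2 E D^2 d_t phi)]. *)
Definition wave_solution (A E : 'M[R]_2)
    (F : 'I_2 -> 'I_2 -> 'I_2 -> 'I_2 -> R) (f : R * R -> R) (eps : R)
    (w : R * R * R -> R) : Prop :=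
  (forall T0 : R, 0 < T0 ->
     Linfty_Hm (T0 / eps ^+ 2) 2 w /\ W1infty_Hm (T0 / eps ^+ 2) 1 w) /\
  forall phi : R * R * R -> R, test_fun setT phi ->
    \int[leb3 R]_(p in [set p | 0 < p.2])
       (w p * (Dseq [:: et R; et R] phi p
               - op2 A (e3 R) phi p
               - eps ^+ 2 * op2 E (e3 R) (Dseq [:: et R; et R] phi) p
               + eps ^+ 2 * op4 F (e3 R) phi p))
    + \int[leb2 R]_x
       (f x * ('D_(et R) phi (x, 0)
               - eps ^+ 2 * op2 E (e3 R) ('D_(et R) phi) (x, 0))) = 0.

Definition elliptic (a : 'I_2 -> R) (r phi : R) : R * R :=
  (r * Num.sqrt (a 0) * cos phi, r * Num.sqrt (a 1) * sin phi).

Definition Weps (a : 'I_2 -> R) (eps : R) (w : R * R * R -> R)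
    (p : R * R * R) : R :=
  let r := p.1.1 in let phi := p.1.2 in let t := p.2 in
  if - (t / eps ^+ 2) < r
  then w (elliptic a (r + t / eps ^+ 2) phi, t / eps ^+ 2) else 0.

Definition kappa (a alpha : 'I_2 -> R) (beta phi : R) : R :=
  6 * beta * (cos phi ^+ 2 / a 0) * (sin phi ^+ 2 / a 1)
  + alpha 0 * (cos phi ^+ 4 / a 0 ^+ 2)
  + alpha 1 * (sin phi ^+ 4 / a 1 ^+ 2).

End Wave.

Section Distributions.
Context {R : realType}.
Implicit Types W : (R * R * R -> R) -> R.

(** A functional on test functions; its values on other functions are
    irrelevant. Continuity is the usual seminorm estimate on each compact. *)
Definition is_distribution (Omega : set (R * R * R)) W : Prop :=
  (forall (c : R) phi psi, test_fun Omega phi -> test_fun Omega psi ->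
     W (fun p => c * phi p + psi p) = c * W phi + W psi) /\
  forall K : set (R * R * R), compact K -> K `<=` Omega ->
    exists (N : nat) (c : R), forall phi (M : R), test_fun K phi ->
      (forall s, (size s <= N)%N -> {subset s <= [:: e3 R 0; e3 R 1; et R]} ->
         forall p, `|Dseq s phi p| <= M) ->
      `|W phi| <= c * M.

Definition dist_D (v : R * R * R) W : (R * R * R -> R) -> R :=
  fun psi => - W ('D_v psi).

Definition dist_mul (m : R * R * R -> R) W : (R * R * R -> R) -> R :=
  fun psi => W (fun p => m p * psi p).

(** [e3 R 0] is the direction of [r] in the coordinates [(r, phi, t)]. *)
Definition linearized_cKdV (T : R) (kap : R -> R)
    (U : (R * R * R -> R) -> R) : Prop :=
  forall psi, test_fun [set p : R * R * R | 0 < p.2 < T] psi ->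
    dist_D (et R) U psi
    + dist_mul (fun p => (2 * p.2)^-1) U psi
    - 2^-1 * dist_mul (fun p => kap p.1.2)
               (dist_D (e3 R 0) (dist_D (e3 R 0) (dist_D (e3 R 0) U))) psi = 0.

End Distributions.

(* Main.v *)
(** Write [e = eps^2] and, in a sector around an angle [c], let [rho] and [ang] be
the elliptic polar coordinates. The wave equation is tested with the wave fronts
[(e rho)^4 th (rho - t, ang, e t)], [th] a fixed test function. Along such a front
each derivative acts on the fast variable [rho - t] up to an error of order [e],
and since the exponent of [e rho] exceeds the order of the error terms, all of
them are polynomial in [e] with coefficients of the same form, with fixed
profiles. The terms of order [1] cancel because [AD^2] is the Laplacian of the
elliptic coordinates; the terms of order [e] are
[- 2 d_r d_t th - 9 / t d_r th + kappa d_r^4 th] times [t^5], where the identity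
[- CD^4 = ED^2 AD^2 - FD^4] evaluated on [(n . x)^4] identifies the symbol
[F n^4 - E n^2] with [kappa]. Changing variables to the moving frame turns the
integrals against [w eps] into integrals against [Weps], so that the assumed
distributional convergence applies to each of them and the terms of higher order
in [e] disappear in the limit. Taking [th = - psi / (2 t^5)] gives the equation
for [psi] supported in the sector, and a partition of unity in the angle gives it
in general, the limit operator involving no derivative in the angle.

For a diagonal evenly symmetric medium, reflecting a coordinate maps Bloch waves
with quasimomentum [k] to Bloch waves with the reflected quasimomentum, so that
[mu0] is even in each coordinate near [0]; this kills the derivatives of odd
order in a coordinate, and the remaining ones agree by the symmetry of second
derivatives. *)
Require Import Defs.
From HB Require Import structures.
From mathcomp Require Import all_boot all_order all_algebra.
From mathcomp Require Import complex.
From mathcomp Require Import all_classical all_reals all_analysis.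
From mathcomp Require Import ring lra.
Import Order.TTheory GRing.Theory Num.Theory numFieldNormedType.Exports.
Import measurable_realfun.
Set Implicit Arguments.
Unset Strict Implicit.
Unset Printing Implicit Defensive.
Local Open Scope classical_set_scope.
Local Open Scope ring_scope.

(** * Smooth functions *)

(** Nothing uniform in [eps] is used about [w eps] beyond the convergence of [Weps] against each
    fixed test function, so no error term can be estimated by a norm: each has to be an exact
    polynomial in [e], paired with profiles that do not depend on [e]. This shapes the class [rem]
    below. The damping [1 / (2 t)] does not depend on the exponent [m] chosen for [e * rho]: the
    radial part of the Laplacian contributes [2 m + 1], removing the weight [t^(m + 1)] from the
    profile contributes [m + 1], and [(2 m + 1) / 2 - (m + 1) = - 1 / 2]. The angle is a real
    variable and not a class modulo [2 pi], so every sector carries its own branch of the angle,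
    centred at an arbitrary real [c]. The condition [cos c != 0] comes from the change of variables,
    where the rotation by [c] is undone by elimination with a pivot proportional to [cos c]. *)

Section Calculus.
Context {R : realType} {V : normedModType R}.
Implicit Types (f g : V -> R) (U : set V) (v x : V).

Lemma Dseq_cat s1 s2 f : Dseq (s1 ++ s2) f = Dseq s1 (Dseq s2 f).
Proof. by elim: s1 => //= v s1 ->. Qed.

Lemma Dseq_rcons s v f : Dseq (rcons s v) f = Dseq s ('D_v f).
Proof. by rewrite -cats1 Dseq_cat. Qed.

(** Peeling off the innermost derivative, the last letter of the word, turns the quantification over
    words into a recursion on the order; the closure properties below are inductions along it. *)
Lemma C_onS n U f : C_on n.+1 U f <->
  [/\ forall x, U x -> {for x, continuous f},
      forall x v, U x -> derivable f x v & forall v, C_on n U ('D_v f)].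
Proof.
split=> [Cf|[cf df Cf] s].
  split=> [x Ux|x v Ux|v s sn x Ux].
  - by have [] := Cf [::] isT x Ux.
  - by have [_] := Cf [::] isT x Ux; exact.
  - by have := Cf (rcons s v); rewrite size_rcons Dseq_rcons; exact.
case/lastP: s => [_ x Ux|s v]; first by split; [exact: cf|move=> _ v; exact: df].
by rewrite size_rcons Dseq_rcons; exact: Cf.
Qed.

Lemma C_on0 U f : (forall x, U x -> {for x, continuous f}) -> C_on 0 U f.
Proof. by move=> cf [|//] _ x Ux; split => //; exact: cf. Qed.

Lemma C_onW n U f : C_on n.+1 U f -> C_on n U f.
Proof.
by move=> Cf s sn x Ux; have [c d] := Cf s (leqW sn) x Ux; split => // sn'; apply: d.
Qed.

Lemma C_on_cont n U f x : C_on n U f -> U x -> {for x, continuous f}.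
Proof. by move=> Cf Ux; have [] := Cf [::] isT x Ux. Qed.

Lemma C_onSubset n U U' f : U' `<=` U -> C_on n U f -> C_on n U' f.
Proof. by move=> UU Cf s sn x /UU Ux; exact: Cf. Qed.

Lemma open_near U x (P : V -> Prop) : open U -> U x ->
  (forall y, U y -> P y) -> \near x, P x.
Proof. by move=> oU Ux UP; near do apply: UP; exact: open_nbhs_nbhs. Unshelve. all: by end_near. Qed.

Lemma Dseq_eq U f g s : open U -> (forall x, U x -> f x = g x) ->
  forall x, U x -> Dseq s f x = Dseq s g x.
Proof.
move=> oU fg; elim: s => //= v s IH x Ux.
by apply: near_eq_derive; exact: (open_near oU Ux).
Qed.

Lemma C_on_eq n U f g : open U -> (forall x, U x -> f x = g x) ->
  C_on n U f -> C_on n U g.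
Proof.
move=> oU fg Cf s sn x Ux; have [c d] := Cf s sn x Ux.
have ns : \near x, Dseq s f x = Dseq s g x.
  by apply: (open_near oU Ux) => y; exact: Dseq_eq.
split=> [|sn' v]; last exact: near_eq_derivable (d sn' v).
rewrite /prop_for /continuous_at -(nbhs_singleton ns).
by apply: cvg_trans c; apply: near_eq_cvg.
Qed.

Lemma C_on_cst n U (a : R) : C_on n U (fun=> a).
Proof.
elim: n a => [|n IH] a; first by apply: C_on0 => x _; exact: cst_continuous.
apply/C_onS; split=> [x _|x v _|v]; [exact: cst_continuous|exact: derivable_cst|].
by rewrite (_ : 'D_v _ = fun=> 0)//; apply/funext => x; rewrite derive_cst.
Qed.

Lemma C_onD n U f g : open U -> C_on n U f -> C_on n U g ->
  C_on n U (fun x => f x + g x).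
Proof.
move=> oU; elim: n f g => [|n IH] f g.
  by move=> Cf Cg; apply: C_on0 => x Ux; apply: cvgD; [exact: C_on_cont Cf Ux|exact: C_on_cont Cg Ux].
move=> /C_onS[cf df Cf] /C_onS[cg dg Cg]; apply/C_onS; split=> [x Ux|x v Ux|v].
- by apply: cvgD; [exact: cf|exact: cg].
- by apply: (derivableD (df _ _ Ux) (dg _ _ Ux)).
apply: (C_on_eq oU _ (IH _ _ (Cf v) (Cg v))) => x Ux /=.
by rewrite -[RHS]/('D_v (f + g) x) deriveD//; [exact: df|exact: dg].
Qed.

Lemma C_onM n U f g : open U -> C_on n U f -> C_on n U g ->
  C_on n U (fun x => f x * g x).
Proof.
move=> oU; elim: n f g => [|n IH] f g.
  by move=> Cf Cg; apply: C_on0 => x Ux; apply: cvgM; [exact: C_on_cont Cf Ux|exact: C_on_cont Cg Ux].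
move=> CSf CSg; have [cf df Cf] := (C_onS _ _ _).1 CSf.
have [cg dg Cg] := (C_onS _ _ _).1 CSg; apply/C_onS; split=> [x Ux|x v Ux|v].
- by apply: cvgM; [exact: cf|exact: cg].
- by apply: (derivableM (df _ _ Ux) (dg _ _ Ux)).
have Cfg := C_onD oU (IH _ _ (C_onW CSf) (Cg v)) (IH _ _ (C_onW CSg) (Cf v)).
apply: (C_on_eq oU _ Cfg) => x Ux /=.
by rewrite -[RHS]/('D_v (f * g) x) deriveM//; [exact: df|exact: dg].
Qed.

Lemma smooth_onP U f : smooth_on U f <->
  [/\ forall x, U x -> {for x, continuous f},
      forall x v, U x -> derivable f x v & forall v, smooth_on U ('D_v f)].
Proof.
split=> [Sf|[cf df Sf] [|n]]; last 2 first.
- exact: C_on0.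
- by apply/C_onS; split => // v; exact: Sf.
split=> [x|x v Ux|v n]; first exact: (C_on_cont (Sf 0%N)).
- by have /C_onS[_ df _] := Sf 1%N; exact: df.
- by have /C_onS[] := Sf n.+1.
Qed.

Lemma smooth_on_Dseq U f s : smooth_on U f -> smooth_on U (Dseq s f).
Proof.
move=> Sf; elim: s => // v s IH.
have [_ _ Dv] := (smooth_onP _ _).1 IH; exact: Dv.
Qed.

Lemma smooth_onSubset U U' f : U' `<=` U -> smooth_on U f -> smooth_on U' f.
Proof. by move=> UU Sf n; exact: C_onSubset (Sf n). Qed.

Lemma smooth_on_eq U f g : open U -> (forall x, U x -> f x = g x) ->
  smooth_on U f -> smooth_on U g.
Proof. by move=> oU fg Sf n; exact: C_on_eq (Sf n). Qed.

Lemma smooth_on_cst U (a : R) : smooth_on U (fun=> a).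
Proof. by move=> n; exact: C_on_cst. Qed.

Lemma smooth_onD U f g : open U -> smooth_on U f -> smooth_on U g ->
  smooth_on U (fun x => f x + g x).
Proof. by move=> oU Sf Sg n; exact: C_onD. Qed.

Lemma smooth_onM U f g : open U -> smooth_on U f -> smooth_on U g ->
  smooth_on U (fun x => f x * g x).
Proof. by move=> oU Sf Sg n; exact: C_onM. Qed.

Lemma smooth_onZ U (a : R) f : open U -> smooth_on U f ->
  smooth_on U (fun x => a * f x).
Proof. by move=> oU; apply: smooth_onM => //; exact: smooth_on_cst. Qed.

Lemma smooth_onB U f g : open U -> smooth_on U f -> smooth_on U g ->
  smooth_on U (fun x => f x - g x).
Proof.
move=> oU Sf Sg; have := smooth_onD oU Sf (smooth_onZ (- 1) oU Sg).
by under eq_fun do rewrite mulN1r.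
Qed.

Lemma smooth_onX U f k : open U -> smooth_on U f ->
  smooth_on U (fun x => f x ^+ k).
Proof.
move=> oU Sf; elim: k => [|k IH].
  by under eq_fun do rewrite expr0; exact: smooth_on_cst.
by under eq_fun do rewrite exprS; exact: smooth_onM.
Qed.

Lemma smooth_onU U U' f : smooth_on U f -> smooth_on U' f ->
  smooth_on (U `|` U') f.
Proof. by move=> Sf Sg n s sn x [|]; [exact: Sf|exact: Sg]. Qed.

Lemma derivable_linear (L : V -> R) x v :
  (forall (a : R) x y, L (a *: x + y) = a * L x + L y) ->
  is_derive x v L (L v).
Proof.
move=> lL.
have E : (fun h : R => h^-1 *: (L (h *: v + x) - L x)) @ 0^' --> L v.
  apply: cvg_near_cst; near=> h.
  have h0 : h != 0 by near: h; exact: nbhs_dnbhs_neq.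
  by rewrite lL addrK /GRing.scale/= mulKf.
by split; [apply/cvg_ex; exists (L v)|exact/cvg_lim].
Unshelve. all: by end_near. Qed.

Lemma smooth_on_linear U (L : V -> R) : continuous L ->
  (forall (a : R) x y, L (a *: x + y) = a * L x + L y) -> smooth_on U L.
Proof.
move=> cL lL; apply/smooth_onP; split=> [x _|x v _|v]; first exact: cL.
- by have [] := derivable_linear x v lL.
- have -> : 'D_v L = fun=> L v.
    by apply/funext => x; have [] := derivable_linear x v lL.
  exact: smooth_on_cst.
Qed.

(** Smoothness in one variable is given by a whole tower of derivatives, so that a concrete function
    is certified by a formula for its [n]-th derivative. *)
Definition smooth1 (O : set R) (h : R -> R) :=
  exists H : nat -> R -> R, H 0%N = h /\
    forall n (x : R), O x -> is_derive x 1 (H n) (H n.+1 x).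

Lemma is_derive_comp1 (h : R -> R) f x v a b :
  is_derive (f x) 1 h a -> is_derive x v f b ->
  is_derive x v (h \o f) (a * b).
Proof.
move=> dh [/derivable1P df Df].
pose F t := f (t *: v + x).
have E : forall g : V -> R, 'D_v g x = 'D_1 (fun t : R => g (t *: v + x)) 0.
  move=> g; rewrite /derive.
  rewrite (_ : (fun h : R => h^-1 *: (g (h *: v + x) - g x)) = fun h : R =>
    h^-1 *: (g ((h *: (1 : R) + 0) *: v + x) - g (0 *: v + x)))//.
  by apply/funext => t; rewrite scale0r add0r addr0 [_%:A]mulr1.
have dF : is_derive (0 : R) 1 F b by split => //; rewrite -E.
have dh' : is_derive (F 0) 1 h a by rewrite /F scale0r add0r.
have [d1 d2] := is_derive1_comp dh' dF.
by split; [apply/derivable1P|rewrite E].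
Qed.

(** The induction on the order runs for all levels [H k] of the tower at once, because
    differentiating [H k \o f] produces [H k.+1 \o f]. *)
Lemma smooth_on_comp1 U f O h : open U -> smooth1 O h ->
  (forall x, U x -> O (f x)) -> smooth_on U f -> smooth_on U (h \o f).
Proof.
move=> oU [H [<- dH]] UO Sf n; elim: n 0%N => [|n IH] k.
  apply: C_on0 => x Ux; apply: continuous_comp.
    exact: (C_on_cont (Sf 0%N)).
  by apply/differentiable_continuous/derivable1_diffP; have [] := dH k _ (UO _ Ux).
have [cf df Sf'] := (smooth_onP _ _).1 Sf.
have dHf x v : U x -> is_derive x v (H k \o f) (H k.+1 (f x) * 'D_v f x).
  move=> Ux; apply: is_derive_comp1; first exact: (dH k _ (UO _ Ux)).
  by apply: derivableP; exact: df.
apply/C_onS; split=> [x Ux|x v Ux|v].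
- exact: (C_on_cont (C_onSubset (fun _ => id) _) Ux).
- by have [] := dHf x v Ux.
apply: (C_on_eq oU _ (C_onM oU (IH k.+1) (Sf' v n))) => x Ux /=.
by have [_ ->] := dHf x v Ux.
Qed.


Lemma is_derive_line f x v t df : is_derive (t *: v + x) v f df ->
  is_derive t 1 (fun t : R => f (t *: v + x)) df.
Proof.
case=> /derivable1P d D; have E : (fun h : R => h^-1 *: (f (h *: v + (t *: v + x))
    - f (t *: v + x))) = (fun h : R => h^-1 *: (f ((h *: (1 : R) + t) *: v + x)
    - f (t *: v + x))).
  by apply/funext => h; rewrite [_%:A]mulr1 scalerDl addrA.
split; last by rewrite -D /derive E.
move: d; rewrite -derivable1P /derivable E; exact.
Qed.

Lemma MVT_line f x v :
  (forall t : R, 0 <= t <= 1 -> derivable f (t *: v + x) v) ->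
  exists2 t : R, 0 <= t <= 1 & f (v + x) - f x = 'D_v f (t *: v + x).
Proof.
move=> df; pose F (t : R) := f (t *: v + x).
have dF (t : R) : 0 <= t <= 1 -> is_derive t 1 F ('D_v f (t *: v + x)).
  by move=> t01; apply: is_derive_line; apply: derivableP; exact: df.
have [||t t01] := @MVT_segment _ F (fun t => 'D_v f (t *: v + x)) 0 1 ler01.
- by move=> t /[!in_itv]/= /andP[/ltW t0 /ltW t1]; apply: dF; rewrite t0.
- by apply: derivable_within_continuous => t /[!in_itv]/= /dF[].
rewrite subr0 mulr1 /F scale1r scale0r add0r => E.
by exists t => //; move: t01; rewrite in_itv.
Qed.

Lemma deriveZv f x v (a : R) : derivable f x v ->
  is_derive x (a *: v) f (a * 'D_v f x).
Proof.
move=> df; pose F (t : R) := f (t *: v + x).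
have dF : is_derive (0 : R) 1 F ('D_v f x).
  by apply: is_derive_line; rewrite scale0r add0r; exact: derivableP.
have da : is_derive (0 : R) 1 (fun t : R => t * a) a.
  by apply: is_derive_eq; rewrite scaler0 add0r [_%:A]mulr1.
rewrite mulrC.
have dF' : is_derive ((fun t : R => t * a) 0) 1 F ('D_v f x) by rewrite mul0r.
have [d D] := @is_derive1_comp _ F (fun t => t * a) 0 _ _ dF' da.
have E : F \o (fun t => t * a) = (fun h => f (h *: (a *: v) + x)).
  by apply/funext => h; rewrite /F /= scalerA.
rewrite {}E in d D; split; first exact/derivable1P.
rewrite -D /derive; congr (lim _).
rewrite (_ : (fun h : R => h^-1 *: (f (h *: (a *: v) + x) - f x)) = fun h : R =>
    h^-1 *: (f ((h *: (1 : R) + 0) *: (a *: v) + x) - f (0 *: (a *: v) + x)))//.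
by apply/funext => t; rewrite [0 *: (a *: v)]scale0r add0r addr0 [_%:A]mulr1.
Qed.

(** A difference quotient whose base point [q t] moves: the mean value theorem on the segment and
    the continuity of ['D_u f] replace Fréchet differentiability. The increment is written as a
    product [r t * a t] so that [a t] may vanish. *)
Lemma cvg_slope (T : Type) (F : set_system T) (FF : Filter F) f p u
    (q : T -> V) (a : T -> R) :
  (\near p, derivable f p u) -> {for p, continuous ('D_u f)} ->
  q @ F --> p -> a @ F --> 0 ->
  exists2 r : T -> R, r @ F --> 'D_u f p &
    forall t, f (a t *: u + q t) - f (q t) = r t * a t.
Proof.
move=> df cf qp a0.
(* Where the increment degenerates, the slope takes its limit as default value. *)
exists (fun t => if a t == 0 then 'D_u f p
                 else (f (a t *: u + q t) - f (q t)) / a t); last first.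
  move=> t; case: eqP => [->|/eqP at0]; last by rewrite divfK.
  by rewrite scale0r add0r subrr mulr0.
apply/cvgrPdist_le => e e0.
have [d /= d0 Hd] : exists2 d : R, 0 < d & forall y, `|p - y| < d ->
    derivable f y u /\ `|'D_u f p - 'D_u f y| <= e.
  apply/nbhs_normP; near=> y; split; first by near: y.
  by near: y; move/cvgrPdist_le : cf; exact.
near=> t; case: ifPn => at0; first by rewrite subrr normr0 ltW.
have H (s : R) : 0 <= s <= 1 -> `|p - (s *: (a t *: u) + q t)| < d.
  move=> /andP[s0 s1]; rewrite opprD addrCA (le_lt_trans (ler_normD _ _))//.
  rewrite (splitr d) ltrD//.
    rewrite normrN scalerA normrZ normrM ger0_norm//.
    rewrite (@le_lt_trans _ _ (`|a t| * (1 + `|u|)))//.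
      rewrite (@le_trans _ _ (`|a t| * `|u|))//; last by rewrite ler_wpM2l// lerDr.
      by rewrite ler_wpM2r// ler_piMl.
    rewrite -ltr_pdivlMr ?ltr_pwDl// -[a t]subr0 distrC.
    by near: t; move/cvgrPdist_lt : a0; apply; rewrite !divr_gt0// ltr_pwDl.
  by near: t; move/cvgrPdist_lt : qp; apply; rewrite divr_gt0.
have dq (s : R) : 0 <= s <= 1 -> derivable f (s *: (a t *: u) + q t) u.
  by move=> /H /Hd[].
have [s s01|s s01 ->] := @MVT_line f (q t) (a t *: u).
  by have [] := deriveZv (a t) (dq s s01).
have [_ ->] := deriveZv (a t) (dq s s01); rewrite mulrC mulKf//.
by have [] := Hd _ (H s s01).
Unshelve. all: by end_near. Qed.

Lemma cvg_slope1 f p u (q : R -> V) (a : R -> R) (da : R) :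
  (\near p, derivable f p u) -> {for p, continuous ('D_u f)} ->
  q @ 0^' --> p -> a @ 0^' --> 0 -> (fun h => h^-1 * a h) @ 0^' --> da ->
  (fun h => h^-1 * (f (a h *: u + q h) - f (q h))) @ 0^' --> 'D_u f p * da.
Proof.
move=> df cf qp a0 ada; have [r rp E] := cvg_slope _ df cf qp a0.
under eq_fun do rewrite E mulrCA.
exact: cvgM.
Qed.

(** The mean value theorem in the direction [u], applied to [y |-> f (h *: v + y) - f y], turns the
    second difference into [h] times a first difference of ['D_u f] in the direction [v], based at a
    point that tends to [x]; [cvg_slope1] gives its limit. *)
Lemma cvg_second_difference U f x u v : open U -> smooth_on U f -> U x ->
  (fun h : R => h^-1 * (h^-1 * ((f (h *: u + (h *: v + x)) - f (h *: v + x))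
     - (f (h *: u + x) - f x)))) @ 0^' --> 'D_v ('D_u f) x.
Proof.
move=> oU Sf Ux; have [_ df Sdf] := (smooth_onP _ _).1 Sf.
have [cdf ddf Sddf] := (smooth_onP _ _).1 (Sdf u).
have [cddf _ _] := (smooth_onP _ _).1 (Sddf v).
have [d d0 Hd] : exists2 d : R, 0 < d & forall y, `|x - y| < d -> U y.
  by apply/nbhs_normP; exact: open_nbhs_nbhs.
(* For such [h] the whole parallelogram spanned by [h *: u] and [h *: v] at [x] stays in a ball
   contained in [U]. *)
pose good (h : R) := `|h| * (`|u| + `|v| + 1) < d.
have inU (h s t : R) : good h -> 0 <= s <= 1 -> 0 <= t <= 1 ->
    U ((s * h) *: u + ((t * h) *: v + x)).
  move=> gh /andP[s0 s1] /andP[t0 t1]; apply: Hd.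
  rewrite [_ *: v + x]addrC addrCA opprD addNKr; apply: le_lt_trans gh.
  rewrite normrN; apply: (le_trans (ler_normD _ _)).
  rewrite !normrZ (ger0_norm s0) (ger0_norm t0) -addrA mulrDr lerD//.
    by rewrite ler_wpM2r// ler_piMl.
  rewrite mulrDr (@le_trans _ _ (`|h| * `|v|))//; last by rewrite lerDl mulr_ge0.
  by rewrite ler_wpM2r// ler_piMl.
have slope_pt (h : R) : exists t : R, 0 <= t <= 1 /\ (good h ->
    (f (h *: u + (h *: v + x)) - f (h *: v + x)) - (f (h *: u + x) - f x) =
    h * ('D_u f (h *: v + ((t * h) *: u + x)) - 'D_u f ((t * h) *: u + x))).
  (* The value [0] for other [h] makes the intermediate point a total function of [h], ready for
     [choice]. *)
  have [gh|] := pselect (good h); last by exists 0; rewrite lexx ler01.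
  pose phi y := f (h *: v + y) - f y.
  have dphi (t : R) : 0 <= t <= 1 -> is_derive (t *: (h *: u) + x) (h *: u) phi
     (h * ('D_u f (h *: v + ((t * h) *: u + x)) - 'D_u f ((t * h) *: u + x))).
    move=> t01; rewrite mulrBr scalerA.
    have U1 := inU h t 0 gh t01; have U2 := inU h t 1 gh t01.
    have {}U1 : U ((t * h) *: u + x).
      by move: U1; rewrite mul0r scale0r add0r lexx ler01; apply.
    have {}U2 : U (h *: v + ((t * h) *: u + x)).
      by move: U2; rewrite mul1r lexx ler01 addrCA; apply.
    have D1 := deriveZv h (df _ u U1).
    have [D2 D2'] := deriveZv h (df _ u U2).
    have D3 : is_derive ((t * h) *: u + x) (h *: u) (fun y => f (h *: v + y))
      (h * 'D_u f (h *: v + ((t * h) *: u + x))).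
      have E : (fun k : R => k^-1 *: (f (k *: (h *: u) + (h *: v + ((t * h) *: u + x)))
             - f (h *: v + ((t * h) *: u + x)))) = 
            (fun k : R => k^-1 *: (f (h *: v + (k *: (h *: u) + ((t * h) *: u + x)))
             - f (h *: v + ((t * h) *: u + x)))).
        by apply/funext => k; rewrite [in LHS]addrCA.
      by split; [move: D2; rewrite /derivable E|move: D2'; rewrite /derive E].
    exact: (is_deriveB D3 D1).
  have [t t01 E|t t01 E] := @MVT_line phi x (h *: u).
    by have [dd _] := dphi t t01; exact: dd.
  have [_ D] := dphi t t01; exists t; split => // _.
  by rewrite -D -E /phi [h *: v + (h *: u + x)]addrCA; ring.
have [tau Htau] := choice slope_pt.
have qx : (fun h => (tau h * h) *: u + x) @ 0^' --> x.
  rewrite -[X in _ --> X]add0r -(scale0r u); apply: cvgD; last exact: cvg_cst.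
  apply: cvgZr_tmp; apply/cvgrPdist_lt => e e0; near=> h.
  rewrite sub0r normrN normrM; have [/andP[t0 t1] _] := Htau h.
  rewrite (@le_lt_trans _ _ `|h|)//; first by rewrite ger0_norm// ler_piMl.
  by near: h; exact: dnbhs0_lt.
have := @cvg_slope1 ('D_u f) x v (fun h => (tau h * h) *: u + x) id 1.
rewrite mulr1 => /(_ _ _ qx) H.
apply: cvg_trans (H _ _ _ _).
- apply: near_eq_cvg; near=> h; have [_ ->] := Htau h.
    by rewrite mulKf//; near: h; exact: nbhs_dnbhs_neq.
  rewrite /good -ltr_pdivlMr ?ltr_wpDl ?addr_ge0//.
  by near: h; apply: dnbhs0_lt; rewrite divr_gt0// ltr_wpDl ?addr_ge0.
- by apply: (open_near oU Ux) => y Uy; exact: ddf.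
- exact: cddf.
- exact: cvg_within.
- apply: cvg_near_cst; near=> h; rewrite mulVf//.
  by near: h; exact: nbhs_dnbhs_neq.
Unshelve. all: by end_near. Qed.

(** The second difference is symmetric in [u] and [v], so both mixed derivatives are limits of the
    same function of [h]. *)
Lemma Schwarz U f x u v : open U -> smooth_on U f -> U x ->
  'D_v ('D_u f) x = 'D_u ('D_v f) x.
Proof.
move=> oU Sf Ux; have H1 := @cvg_second_difference U f x u v oU Sf Ux.
have := @cvg_second_difference U f x v u oU Sf Ux.
rewrite (_ : (fun h => _) = (fun h : R => h^-1 * (h^-1 *
  ((f (h *: u + (h *: v + x)) - f (h *: v + x)) - (f (h *: u + x) - f x))))).
  by move=> H2; apply: (cvg_unique _ H1 H2).
by apply/funext => h; rewrite [h *: v + (h *: u + x)]addrCA; congr (_ * (_ * _)); ring.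
Qed.

End Calculus.

(** * Chain rule for a smooth function of three variables *)

Section Composition3.
Context {R : realType}.
Implicit Types th : R * R * R -> R.

Lemma e3_0 : e3 R 0 = (1, 0, 0). Proof. by []. Qed.
Lemma e3_1 : e3 R 1 = (0, 1, 0). Proof. by []. Qed.

Context {V : normedModType R}.

(** The increment of [th] is telescoped through [q1] and [q2], changing one coordinate at a time;
    each piece is a slope with a moving base point, hence an instance of [cvg_slope1]. *)
Lemma is_derive_comp3 th (g1 g2 g3 : V -> R) (x v : V) (d1 d2 d3 : R) :
  smooth_on setT th ->
  is_derive x v g1 d1 -> is_derive x v g2 d2 -> is_derive x v g3 d3 ->
  is_derive x v (fun y => th (g1 y, g2 y, g3 y))
    ('D_(e3 R 0) th (g1 x, g2 x, g3 x) * d1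
     + 'D_(e3 R 1) th (g1 x, g2 x, g3 x) * d2
     + 'D_(et R) th (g1 x, g2 x, g3 x) * d3).
Proof.
move=> /smooth_onP[_ dth Sth].
have cth (u p : R * R * R) : {for p, continuous ('D_u th)}.
  by have [c _ _] := (smooth_onP _ _).1 (Sth u); exact: c.
have dnear (u p : R * R * R) : \near p, derivable th p u.
  by near=> y; exact: dth.
pose D (g : V -> R) (h : R) := g (h *: v + x) - g x.
have quot (g : V -> R) d : is_derive x v g d -> (fun h => h^-1 * D g h) @ 0^' --> d.
  by case=> dg <-; exact: dg.
have cvD (g : V -> R) d : is_derive x v g d -> (fun h => D g h) @ 0^' --> 0.
  move=> /quot gd; rewrite -[X in _ --> X](mul0r d).
  have H : (fun h : R => h * (h^-1 * D g h)) @ 0^' --> 0 * d.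
    by apply: cvgM => //; exact: cvg_within.
  apply: cvg_trans H; apply: near_eq_cvg; near=> h; rewrite mulVKf//.
  by near: h; exact: nbhs_dnbhs_neq.
have cvg_ (g : V -> R) d : is_derive x v g d -> (fun h : R => g (h *: v + x)) @ 0^' --> g x.
  move=> /cvD H; rewrite -[X in _ --> X]addr0.
  rewrite (_ : (fun h => _) = (fun h => g x + D g h)).
    by apply: cvgD => //; exact: cvg_cst.
  by apply/funext => h; rewrite /D addrCA subrr addr0.
move=> H1 H2 H3.
pose p := (g1 x, g2 x, g3 x).
pose q1 (h : R) := (g1 x, g2 (h *: v + x), g3 (h *: v + x)).
pose q2 (h : R) := (g1 x, g2 x, g3 (h *: v + x)).
have q1p : q1 @ 0^' --> p.
  exact: (cvg_pair (cvg_pair (cvg_cst (g1 x)) (cvg_ _ _ H2)) (cvg_ _ _ H3)).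
have q2p : q2 @ 0^' --> p.
  exact: (cvg_pair (cvg_cst (g1 x, g2 x)) (cvg_ _ _ H3)).
have K1 := cvg_slope1 (dnear (e3 R 0) p) (cth (e3 R 0) p) q1p (cvD _ _ H1) (quot _ _ H1).
have K2 := cvg_slope1 (dnear (e3 R 1) p) (cth (e3 R 1) p) q2p (cvD _ _ H2) (quot _ _ H2).
have K3 := cvg_slope1 (dnear (et R) p) (cth (et R) p) (cvg_cst p) (cvD _ _ H3) (quot _ _ H3).
have := cvgD (cvgD K1 K2) (K3 _).
set l := (X in _ --> X) => /(_ _ _ _) K.
have E : (fun h : R => h^-1 *: (th (g1 (h *: v + x), g2 (h *: v + x), g3 (h *: v + x)) -
   th (g1 x, g2 x, g3 x))) @ 0^' --> l.
  apply: cvg_trans K; apply: near_eq_cvg; near=> h; rewrite !fctE.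
  have -> : D g1 h *: e3 R 0 + q1 h = (g1 (h *: v + x), g2 (h *: v + x), g3 (h *: v + x)).
    rewrite e3_0 /q1 /D; congr (_, _, _); rewrite /= /GRing.scale/= ?mulr1 ?mulr0 ?add0r//.
    by rewrite subrK.
  have -> : D g2 h *: e3 R 1 + q2 h = q1 h.
    rewrite e3_1 /q1 /q2 /D; congr (_, _, _); rewrite /= /GRing.scale/= ?mulr1 ?mulr0 ?add0r//.
    by rewrite subrK.
  have -> : D g3 h *: et R + p = q2 h.
    rewrite /et /p /q2 /D; congr (_, _, _); rewrite /= /GRing.scale/= ?mulr1 ?mulr0 ?add0r//.
    by rewrite subrK.
  by rewrite -!mulrDr /GRing.scale/=; congr (_ * _); rewrite /p; ring.
by split; [apply/cvg_ex; exists l|exact/cvg_lim].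
Unshelve. all: by end_near. Qed.

Lemma smooth_on_comp3 U th (g1 g2 g3 : V -> R) : open U -> smooth_on setT th ->
  smooth_on U g1 -> smooth_on U g2 -> smooth_on U g3 ->
  smooth_on U (fun y => th (g1 y, g2 y, g3 y)).
Proof.
move=> oU + S1 S2 S3 n; elim: n th => [|n IH] th Sth.
  apply: C_on0 => x Ux; apply: (@continuous_comp _ _ _ (fun y => (g1 y, g2 y, g3 y)) th).
    exact: (cvg_pair (cvg_pair (C_on_cont (S1 0%N) Ux) (C_on_cont (S2 0%N) Ux))
      (C_on_cont (S3 0%N) Ux)).
  exact: (C_on_cont (Sth 0%N)).
have [_ dg1 Sg1] := (smooth_onP _ _).1 S1; have [_ dg2 Sg2] := (smooth_onP _ _).1 S2.
have [_ dg3 Sg3] := (smooth_onP _ _).1 S3.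
have D x v (Ux : U x) := is_derive_comp3 Sth (derivableP (dg1 x v Ux))
   (derivableP (dg2 x v Ux)) (derivableP (dg3 x v Ux)).
have [_ _ SDth] := (smooth_onP _ _).1 Sth.
apply/C_onS; split=> [x Ux|x v Ux|v].
- apply: (@continuous_comp _ _ _ (fun y => (g1 y, g2 y, g3 y)) th).
    exact: (cvg_pair (cvg_pair (C_on_cont (S1 0%N) Ux) (C_on_cont (S2 0%N) Ux))
      (C_on_cont (S3 0%N) Ux)).
  exact: (C_on_cont (Sth 0%N)).
- by have [d _] := D x v Ux; exact: d.
- apply: (C_on_eq oU) (C_onD oU (C_onD oU (C_onM oU (IH _ (SDth (e3 R 0))) (Sg1 v n))
    (C_onM oU (IH _ (SDth (e3 R 1))) (Sg2 v n)))
    (C_onM oU (IH _ (SDth (et R))) (Sg3 v n))) => x Ux.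
  by have [_ ->] := D x v Ux.
Qed.

End Composition3.

(** * Change of variables *)

Section Measurability.
Context {R : realType}.

(** Countably many measurable sets that refine all neighbourhoods. The property passes to products
    and makes open sets countable unions of measurable ones, which gives the measurability of
    continuous functions on the plane and on space-time. Neighbourhoods are a parameter so that the
    product filter can be used directly. *)
Definition has_measurable_base d (T : measurableType d) (nb : T -> set_system T) :=
  exists B : nat -> set T, (forall n, measurable (B n)) /\
    forall x A, nb x A -> exists n, B n x /\ B n `<=` A.

Lemma measurable_base_R : has_measurable_base (@nbhs R R).
Proof.
exists (fun n => if @unpickle (rat * nat)%type n is Some p
   then ball (ratr p.1 : R) (p.2.+1%:R^-1) else set0); split.
  by move=> n; case: unpickle => [p|]; [exact: measurable_ball|exact: measurable0].
move=> x A /nbhs_ballP[e /= e0 He].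
have [n _ /(_ n (leqnn n)) ne] := near_infty_natSinv_lt (PosNum (divr_gt0 e0 (ltr0n _ 2))).
have xn : x - n.+1%:R^-1 < x + n.+1%:R^-1 by rewrite ltrD2l gtrN// invr_gt0.
have [q] := rat_in_itvoo xn.
rewrite in_itv/= => /andP[q1 q2]; exists (pickle (q, n)); rewrite pickleK/=.
have xq : `|ratr q - x| < n.+1%:R^-1 by rewrite ltr_distl q1 q2.
split=> // y; rewrite /ball/= => qy; apply: He; rewrite /ball/=.
rewrite /= in ne; rewrite (le_lt_trans (ler_distD (ratr q) x y))// (splitr e).
by rewrite ltrD// ?(lt_trans qy)// distrC (lt_trans xq).
Qed.

Lemma measurable_base_prod d1 d2 (T1 : measurableType d1) (T2 : measurableType d2)
    (nb1 : T1 -> set_system T1) (nb2 : T2 -> set_system T2) :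
  has_measurable_base nb1 -> has_measurable_base nb2 ->
  has_measurable_base (fun p : T1 * T2 => filter_prod (nb1 p.1) (nb2 p.2)).
Proof.
move=> [B1 [mB1 H1]] [B2 [mB2 H2]].
exists (fun n => if @unpickle (nat * nat)%type n is Some p
   then B1 p.1 `*` B2 p.2 else set0); split.
  by move=> n; case: unpickle => [p|]; [exact: measurableX|exact: measurable0].
move=> [x y] A [[P Q] /= [xP yQ] PQA].
have [n [Bx BP]] := H1 _ _ xP; have [m [By BQ]] := H2 _ _ yQ.
exists (pickle (n, m)); rewrite pickleK/=; split=> // -[u v] [/= Bu Bv].
by apply: PQA; split; [exact: BP|exact: BQ].
Qed.

Lemma measurable_continuous d (T : measurableType d) (nb : T -> set_system T)
    (f : T -> R) :
  has_measurable_base nb -> (forall x (e : R), 0 < e ->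
    nb x [set y | `|f x - f y| < e] ) ->
  measurable_fun setT f.
Proof.
move=> [B [mB HB]] cf; apply: (measurability _ (@RGenOInfty.measurableE R)).
move=> _ [_ [r ->] <-]; rewrite setTI.
have -> : f @^-1` `]r, +oo[%classic =
    \bigcup_(n in [set n | B n `<=` [set y | r < f y]]) B n.
  apply/seteqP; split=> [x /=|x [n BU Bx]]; last by rewrite /= in_itv/= andbT; exact: BU.
  rewrite in_itv/= andbT => rfx.
  have fx0 : 0 < f x - r by rewrite subr_gt0.
  have [n [Bx BU]] := HB x _ (cf x _ fx0); exists n => // y /BU /=.
  by rewrite ltr_norml => /andP[_]; rewrite ltrD2l ltrN2.
by apply: bigcup_measurable => n _; exact: mB.
Qed.

Lemma continuous_measurable_fun2 (f : R * R -> R) : continuous f ->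
  measurable_fun setT f.
Proof.
move=> cf; apply: (measurable_continuous
  (measurable_base_prod measurable_base_R measurable_base_R)).
by move=> x e e0; move/cvgrPdist_lt : (cf x); exact.
Qed.

Lemma continuous_measurable_fun3 (f : R * R * R -> R) : continuous f ->
  measurable_fun setT f.
Proof.
move=> cf; apply: (measurable_continuous (measurable_base_prod
  (measurable_base_prod measurable_base_R measurable_base_R) measurable_base_R)).
by move=> x e e0; move/cvgrPdist_lt : (cf x); exact.
Qed.

Lemma measurable_fun_if0 d (T : measurableType d) (b : T -> bool) (g : T -> \bar R) :
  measurable_fun setT b -> measurable_fun setT g ->
  measurable_fun setT (fun t => if b t then g t else 0%E).
Proof.
move=> mb mg; by apply: measurable_fun_if => //; exact: measurable_funTS.
Qed.

End Measurability.

Section PlaneMeasure.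
Context {R : realType}.
Local Open Scope ereal_scope.

(* [\x] has no canonical sigma-finite structure for factors that are not
   subprobabilities, so Tonelli's theorem needs this named copy. *)
Definition plane_measure : set (measurableTypeR R * measurableTypeR R) -> \bar R :=
  leb2 R.

HB.instance Definition _ := Measure.copy plane_measure (leb2 R).

Lemma plane_measure_sigma_finite : sigma_finite setT plane_measure.
Proof.
have /sigma_finiteP[F [TF ndF Foo]] := sigma_finiteT (leb1 R).
exists (fun n => F n `*` F n).
  rewrite -setXTT TF predeqE => -[x y]; split; last by move=> [n _ []/= ? ?]; split; exists n.
  move=> [/= [n _ Fnx] [k _ Fky]]; exists (maxn n k) => //; split.
  - by move: x Fnx; exact/subsetPset/ndF/leq_maxl.
  - by move: y Fky; exact/subsetPset/ndF/leq_maxr.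
move=> k; have [? ?] := Foo k; split; first exact: measurableX.
by rewrite /plane_measure product_measure1E// lte_mul_pinfty// ge0_fin_numE.
Qed.

HB.instance Definition _ := Measure_isSigmaFinite.Build _ _ _ plane_measure
  plane_measure_sigma_finite.

End PlaneMeasure.

(** * Polar coordinates and the moving frame, from one-dimensional substitutions *)

Section ChangeOfVariables.
Context {R : realType}.
Local Open Scope ereal_scope.
Notation leb := (@lebesgue_measure R).

(** Every one-dimensional substitution below is reduced by this to computing the mass of a half-open
    interval: the transported measure is then Lebesgue measure. *)
Lemma ge0_integral_unique (m : {measure set (measurableTypeR R) -> \bar R}) (h : R -> \bar R) :
  (forall a b : R, (a < b)%R -> m `]a, b]%classic = (b - a)%:E) ->
  \int[m]_x h x = \int[leb]_x h x.
Proof.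
move=> mE; apply: (eq_measure_integral leb) => A mA _; apply/esym.
apply: lebesgue_measure_unique => // X /ocitvP[->|[x x12 ->]].
  by rewrite !measure0.
by rewrite mE// lebesgue_measure_itv/= lte_fin x12 EFinB.
Qed.

Lemma ge0_integral_affine (h : R -> \bar R) (al be : R) : al != 0%R ->
  measurable_fun setT h -> (forall x, 0 <= h x) ->
  \int[leb]_x h (al * x + be)%R = `|al|^-1%:E * \int[leb]_x h x.
Proof.
move=> al0 mh h0; pose phi (x : measurableTypeR R) : measurableTypeR R := (al * x + be)%R.
have mphi : measurable_fun setT phi.
  by apply: measurable_funD => //; exact: measurable_funM.
have al_ge0 : (0 <= `|al|)%R by [].
pose m : {measure set (measurableTypeR R) -> \bar R} :=
  mscale (NngNum al_ge0) (pushforward leb phi).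
have <- : \int[m mphi]_x h x = \int[leb]_x h x.
  apply: ge0_integral_unique => a b ab; rewrite /m /= /mscale /= /pushforward.
  pose a' := ((a - be) / al)%R; pose b' := ((b - be) / al)%R.
  have [alp|aln|/eqP] := ltgtP 0%R al; last by rewrite eq_sym (negbTE al0).
  - have -> : phi @^-1` `]a, b]%classic = `]a', b']%classic.
      apply/seteqP; split=> x /=; rewrite !in_itv/= ltr_pdivrMr// ler_pdivlMr//;
       by rewrite /phi mulrC ltrBlDr lerBrDr.
    rewrite lebesgue_measure_itv/= lte_fin ltr_pM2r ?invr_gt0// ltrD2r ab.
    by rewrite gtr0_norm// -EFinD -EFinM -mulrBl mulrC divfK ?gt_eqF// opprB addrA subrK.
  - have -> : phi @^-1` `]a, b]%classic = `[b', a'[%classic.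
      apply/seteqP; split=> x /=; rewrite !in_itv/= ltr_ndivlMr// ler_ndivrMr//;
       by rewrite /phi mulrC ltrBlDr lerBrDr andbC.
    rewrite lebesgue_measure_itv/= lte_fin ltr_nM2r ?invr_lt0// ltrD2r ab.
    by rewrite ltr0_norm// -EFinD -EFinM -mulrBl mulrC mulrN divfK ?lt_eqF//; congr EFin; ring.
rewrite ge0_integral_mscale//= ge0_integral_pushforward//.
by rewrite muleA -EFinM mulVf ?normr_eq0// mul1e preimage_setT.
Qed.

Lemma ge0_integral_dilation (h : R -> \bar R) (al : R) : al != 0%R ->
  measurable_fun setT h -> (forall x, 0 <= h x) ->
  \int[leb]_x h (al * x)%R = `|al|^-1%:E * \int[leb]_x h x.
Proof.
move=> al0 mh h0; rewrite -(ge0_integral_affine 0 al0 mh h0).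
by apply: eq_integral => x _; rewrite addr0.
Qed.

Lemma ge0_integral_mrestr d (T : measurableType d) (m : {measure set T -> \bar R})
    (D : set T) (mD : measurable D) (f : T -> \bar R) :
  measurable_fun setT f -> (forall x, 0 <= f x) ->
  \int[mrestr m mD]_x f x = \int[m]_(x in D) f x.
Proof.
move=> mf f0; rewrite -(setUv D) ge0_integral_setU//=.
- rewrite [X in _ + X]null_set_integral//.
  + rewrite adde0; apply: eq_measure_integral => A mA AD.
    by rewrite /= /mrestr setIidl.
  + exact: measurableC.
  + exact: measurable_funTS.
  + by rewrite /= /mrestr setICl measure0.
- exact: measurableC.
- by rewrite setUv.
- by apply/disj_setPCl.
Qed.

Let in_halfpi (phi : R) := (`|phi| < pi / 2)%R.

Lemma measurable_in_halfpi : measurable_fun setT in_halfpi.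
Proof. by apply: measurable_fun_ltr => //; exact: normr_measurable. Qed.

Lemma cos_neq0_halfpi phi : in_halfpi phi -> (0 < cos phi)%R.
Proof. by rewrite /in_halfpi ltr_norml => ?; exact: cos_gt0_pihalf. Qed.

(** Cutting [tan] off outside its principal branch makes it measurable on the whole line. *)
Let tan0 (phi : R) := if in_halfpi phi then tan phi else 0%R.

Lemma measurable_tan0 : measurable_fun setT tan0.
Proof.
apply: measurable_fun_if => //; first exact: measurable_in_halfpi.
rewrite setTI; apply: open_continuous_measurable_fun.
  rewrite (_ : _ @^-1` _ = ball 0%R (pi / 2 : R)%R); first exact: ball_open.
  by apply/seteqP; split=> x; rewrite /ball/= sub0r normrN.
move=> x /[!inE] /cos_neq0_halfpi c; apply: continuous_tan.
by rewrite gt_eqF.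
Qed.

Lemma ltr_atan : {mono (@atan R) : x y / (x < y)%R}.
Proof. by apply: leW_mono; apply: le_mono; exact: lt_atan. Qed.

Lemma ler_atan : {mono (@atan R) : x y / (x <= y)%R}.
Proof. by apply: le_mono; exact: lt_atan. Qed.

Lemma in_halfpi_tan (a b x : R) :
  in_halfpi x && (tan x \in `]a, b]) = (x \in `]atan a, atan b]).
Proof.
apply/andP/idP => [[xpi]|].
  have xK : atan (tan x) = x.
    by apply: tanK; rewrite in_itv/=; move: xpi; rewrite /in_halfpi ltr_norml.
  by rewrite !in_itv/= -{3 4}xK ltr_atan ler_atan.
rewrite in_itv/= => /andP[ax xb]; have xpi : in_halfpi x.
  rewrite /in_halfpi ltr_norml (lt_trans (atan_gtNpi2 a))//=.
  by rewrite (le_lt_trans xb)// atan_ltpi2.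
have xK : atan (tan x) = x.
  by apply: tanK; rewrite in_itv/=; move: xpi; rewrite /in_halfpi ltr_norml.
by split=> //; rewrite in_itv/= -ltr_atan -(ler_atan (tan x)) xK ax.
Qed.

(** The density [1 + tan^2] is realised geometrically: [m] is the image under [tan] of planar
    Lebesgue measure restricted to the region [S] between the axis and the graph of [1 + tan^2]. The
    fundamental theorem of calculus gives []a, b]] the mass [tan (atan b) - tan (atan a) = b - a],
    and Tonelli's theorem on [S] recovers the weight. *)
Lemma ge0_integral_tan (h : R -> \bar R) :
  measurable_fun setT h -> (forall x, 0 <= h x) ->
  \int[leb]_x h x = \int[leb]_phi
    (if in_halfpi phi then (1 + tan phi ^+ 2)%R%:E * h (tan phi) else 0).
Proof.
move=> mh h0.
pose phi (p : measurableTypeR R * measurableTypeR R) : measurableTypeR R := tan0 p.1.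
have mphi : measurable_fun setT phi.
  by apply: (measurableT_comp measurable_tan0); exact: measurable_fst.
pose bS (p : measurableTypeR R * measurableTypeR R) :=
  [&& in_halfpi p.1, (0 <= p.2)%R & (p.2 <= 1 + tan0 p.1 ^+ 2)%R].
have mbS : measurable_fun setT bS.
  apply: measurable_and; first exact: (measurableT_comp measurable_in_halfpi).
  apply: measurable_and; apply: measurable_fun_ler => //.
  by apply: measurable_funD => //; exact: measurable_funX.
pose S := bS @^-1` [set true].
have mS : measurable S by rewrite /S -[X in measurable X]setTI; exact: mbS.
pose m : {measure set (measurableTypeR R) -> \bar R} :=
  pushforward (mrestr (leb \x leb) mS) phi.
rewrite -(@ge0_integral_unique (m mphi)); last first.
  move=> a b ab; rewrite /m /= /pushforward /mrestr /product_measure1 /=.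
  have xS x : leb (xsection (phi @^-1` `]a, b]%classic `&` S) x) =
      (if x \in `]atan a, atan b] then 1 + tan x ^+ 2 else 0)%:E.
    rewrite -in_halfpi_tan.
    have -> : xsection (phi @^-1` `]a, b]%classic `&` S) x =
        if in_halfpi x && (tan x \in `]a, b])
        then `[0, 1 + tan x ^+ 2]%classic%R else set0.
      apply/seteqP; split=> y.
        rewrite /xsection/= inE /phi/S/bS/tan0/= => -[+ /and3P[xpi y0 y1]].
        by rewrite xpi/= => -> /=; rewrite in_itv/= y0; move: y1; rewrite xpi.
      case: ifPn => // /andP[xpi tx]; rewrite /= in_itv/= => /andP[y0 y1].
      by rewrite /xsection/= inE /phi/S/bS/tan0/= xpi/= tx y0 y1.
    case: ifPn => _; last by rewrite measure0.
    by rewrite lebesgue_measure_itv/= lte_fin ltr_wpDr ?sqr_ge0// oppr0 adde0.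
  transitivity (\int[leb]_(x in `]atan a, atan b]) (1 + tan x ^+ 2)%:E).
    rewrite [RHS]integral_mkcond; apply: eq_integral => x _.
    by rewrite xS patchE mem_setE; case: ifPn.
  rewrite integral_itv_obnd_cbnd; last first.
    apply/measurable_EFinP; apply: measurable_funD => //; apply: measurable_funX.
    apply: (@eq_measurable_fun _ _ _ _ _ tan0); last exact: measurable_funTS measurable_tan0.
    by move=> x; rewrite mem_setE -in_halfpi_tan /tan0 => /andP[->].
  have ab' : (atan a < atan b)%R by rewrite ltr_atan.
  have co x : x \in `[atan a, atan b] -> (cos x != 0)%R.
    rewrite in_itv/= => /andP[ax xb]; rewrite gt_eqF//; apply: cos_gt0_pihalf.
    by rewrite (lt_le_trans (atan_gtNpi2 a))//= (le_lt_trans xb)// atan_ltpi2.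
  rewrite (@continuous_FTC2 _ _ tan) ?atanK//.
  - apply: continuous_in_subspaceT => x; rewrite inE => /co cx.
    by apply: cvgD; [exact: cvg_cst|apply: cvgM; exact: continuous_tan].
  - split=> [x xab||].
    + by apply: derivable_tan; apply: co; exact: subset_itv_oo_cc.
    + by apply: cvg_at_right_filter; apply: continuous_tan; apply: co; rewrite in_itv/= lexx ltW.
    + by apply: cvg_at_left_filter; apply: continuous_tan; apply: co; rewrite in_itv/= lexx ltW.
  - move=> x xab; have cx := co x (subset_itv_oo_cc xab).
    by rewrite derive1E; have [_ ->] := is_derive_tan cx; rewrite cos2_tan2.
rewrite ge0_integral_pushforward//= preimage_setT ge0_integral_mrestr//; last first.
  exact: measurableT_comp.
rewrite integral_mkcond fubini_tonelli1//=; last 2 first.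
- apply/(measurable_restrictT _ mS); apply: measurable_funTS.
  exact: measurableT_comp.
- by move=> x; exact: erestrict_ge0.
apply: eq_integral => x _; rewrite /fubini_F.
case: ifPn => xpi; last first.
  rewrite integral0_eq// => y _; rewrite patchE ifF//.
  by apply/negbTE; rewrite notin_setE /S/bS/= (negbTE xpi).
transitivity (\int[leb]_(y in `[0, 1 + tan x ^+ 2]%classic%R) h (tan x)).
  rewrite [RHS]integral_mkcond; apply: eq_integral => y _; rewrite !patchE /phi /tan0/= xpi; congr (if _ then _ else _).
  apply/idP/idP; rewrite !inE /S/bS/tan0/= xpi/= in_itv/=; first by [].
  by [].
rewrite integral_cst//= lebesgue_measure_itv/= lte_fin.
by rewrite ltr_wpDr ?sqr_ge0// oppr0 adde0 muleC.
Qed.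

Lemma measurable_integral_fst (k : R * R -> \bar R) :
  measurable_fun setT k -> (forall p, 0 <= k p) ->
  measurable_fun setT (fun y => \int[leb]_x k (x, y)).
Proof.
move=> mk k0.
exact: (@measurable_fun_fubini_tonelli_G _ _ (measurableTypeR R) (measurableTypeR R) R leb k mk k0).
Qed.

Lemma measurable_integral_snd (k : R * R -> \bar R) :
  measurable_fun setT k -> (forall p, 0 <= k p) ->
  measurable_fun setT (fun x => \int[leb]_y k (x, y)).
Proof.
move=> mk k0.
exact: (@measurable_fun_fubini_tonelli_F _ _ (measurableTypeR R) (measurableTypeR R) R leb k mk k0).
Qed.

(** Gaussian elimination: an affine substitution in the first variable at fixed second one, then one
    in the second variable. The pivot [al] is divided by, and [det / al] is the second scaling
    factor. *)
Lemma ge0_integral_linear2 (g : R * R -> \bar R) (al be ga de : R) :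
  al != 0%R -> (al * de - be * ga)%R != 0%R ->
  measurable_fun setT g -> (forall x, 0 <= g x) ->
  \int[leb2 R]_y g (al * y.1 + be * y.2, ga * y.1 + de * y.2)%R =
  `|al * de - be * ga|^-1%:E * \int[leb2 R]_x g x.
Proof.
move=> al0 det0 mg g0; set det := (al * de - be * ga)%R.
have mlin (a b : R) : measurable_fun setT (fun p : R * R => (a * p.1 + b * p.2)%R).
  by apply: measurable_funD; apply: measurable_funM.
have alg (x y : R) :
    (ga * x + de * y = ga / al * (al * x + be * y) + det / al * y)%R.
  by rewrite /det; field.
rewrite fubini_tonelli2//; last first.
  by apply: (measurableT_comp mg); apply: measurable_fun_pair; exact: mlin.
pose k (p : R * R) := g (p.1, (ga / al * p.1 + det / al * p.2)%R).
have mk : measurable_fun setT k.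
  apply: (measurableT_comp mg); apply: measurable_fun_pair; last exact: mlin.
  exact: measurable_fst.
transitivity (\int[leb]_y (`|al|^-1%:E * \int[leb]_x k (x, y))).
  apply: eq_integral => y _; rewrite /fubini_G.
  have mky : measurable_fun setT (fun x => k (x, y)) by exact: measurable_fun_pair1.
  rewrite -(@ge0_integral_affine (fun x => k (x, y)) al (be * y))//; last by move=> x; exact: g0.
  apply: eq_integral => x _ /=; congr (g (_, _)).
  exact: alg.
rewrite ge0_integralZl//; last 2 first.
- exact: (measurable_integral_fst mk (fun=> g0 _)).
- by move=> y _; apply: integral_ge0 => x _; exact: g0.
rewrite -fubini_tonelli//; last by move=> p; exact: g0.
transitivity (`|al|^-1%:E * \int[leb]_x (`|det / al|^-1%:E * \int[leb]_y g (x, y))).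
  congr (_ * _); apply: eq_integral => x _.
  have mgx : measurable_fun setT (fun y => g (x, y)) by exact: measurable_fun_pair2.
  rewrite -(@ge0_integral_affine (fun y => g (x, y)) (det / al) (ga / al * x))//.
    by apply: eq_integral => y _; rewrite /k/= addrC.
  by rewrite mulf_neq0// invr_neq0.
rewrite ge0_integralZl//; last 2 first.
- exact: (measurable_integral_snd mg g0).
- by move=> y _; apply: integral_ge0 => x _; exact: g0.
rewrite -fubini_tonelli1// muleA -EFinM -invfM -normrM.
by rewrite mulrC divfK.
Qed.

Lemma ge0_integral_shift2 (g : R * R -> \bar R) (a b : R) :
  measurable_fun setT g -> (forall x, 0 <= g x) ->
  \int[leb2 R]_y g (y.1 + a, y.2 + b)%R = \int[leb2 R]_x g x.
Proof.
move=> mg g0.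
have affine1 (h : R -> \bar R) c : measurable_fun setT h -> (forall x, 0 <= h x) ->
    \int[leb]_x h (x + c)%R = \int[leb]_x h x.
  move=> mh h0; have := @ge0_integral_affine h 1 c (oner_neq0 _) mh h0.
  by rewrite normr1 invr1 mul1e => <-; apply: eq_integral => x _; rewrite mul1r.
have mgs : measurable_fun setT (fun y : R * R => g (y.1 + a, y.2 + b)%R).
  apply: (measurableT_comp mg); apply: measurable_fun_pair;
  by apply: measurable_funD.
rewrite fubini_tonelli2//= /fubini_G.
transitivity (\int[leb]_y \int[leb]_x g (x, y + b)%R).
  apply: eq_integral => y _; rewrite /= (affine1 (fun x => g (x, y + b)%R))//.
  exact: measurable_fun_pair1.
rewrite (affine1 (fun y => \int[leb]_x g (x, y))) ?fubini_tonelli2//.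
- exact: (measurable_integral_fst mg g0).
- by move=> y; apply: integral_ge0 => x _; exact: g0.
Qed.

(** Three substitutions on lines: [y = x t] at fixed [x], then [t = tan phi], then [x = r cos phi]
    at fixed [phi]. Their factors multiply to [x * (1 + tan^2 phi) * cos phi = r]. *)
Lemma ge0_integral_polar_halfplane (g : R * R -> \bar R) :
  measurable_fun setT g -> (forall x, 0 <= g x) ->
  \int[leb2 R]_x (if (0 < x.1)%R then g x else 0) =
  \int[leb2 R]_p (if (0 < p.1)%R && in_halfpi p.2
    then p.1%:E * g (p.1 * cos p.2, p.1 * sin p.2)%R else 0).
Proof.
move=> mg g0.
have mpos : measurable_fun setT (fun x : R * R => (0 < x.1)%R).
  by apply: measurable_fun_ltr => //; exact: measurable_fst.
pose k (p : R * R) := if (0 < p.1)%R then p.1%:E * g (p.1, p.1 * p.2)%R else 0.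
have mk : measurable_fun setT k.
  apply: measurable_fun_if0 => //; apply: emeasurable_funM.
    by apply/measurable_EFinP; exact: measurable_fst.
  apply: (measurableT_comp mg); apply: measurable_fun_pair; first exact: measurable_fst.
  by apply: measurable_funM.
have k0 p : 0 <= k p.
  by rewrite /k; case: ifPn => // p0; rewrite mule_ge0// lee_fin ltW.
rewrite fubini_tonelli1//=; last 2 first.
- exact: measurable_fun_if0.
- by move=> x; case: ifP.
transitivity (\int[leb]_x \int[leb]_t k (x, t)).
  apply: eq_integral => x _; rewrite /fubini_F/= /k/=.
  have [x0|//] := boolP (0 < (x : R))%R.
  have mgx : measurable_fun setT (fun t : R => g (x, (x : R) * t)%R).
    by apply: (measurableT_comp mg); apply: measurable_fun_pair.
  rewrite ge0_integralZl// ?lee_fin ?ltW//.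
  have mgx' : measurable_fun setT (fun y => g (x, y)) by exact: measurable_fun_pair2.
  rewrite (@ge0_integral_dilation (fun y => g (x, y)) x (lt0r_neq0 x0) mgx')//.
  by rewrite muleA -EFinM gtr0_norm// mulfV ?gt_eqF// mul1e.
rewrite fubini_tonelli//.
rewrite (ge0_integral_tan (h := fun t => \int[leb]_x k (x, t))); last 2 first.
- exact: (measurable_integral_fst mk k0).
- by move=> y; apply: integral_ge0 => x _; exact: k0.
rewrite fubini_tonelli2//=; last 2 first.
- apply: measurable_fun_if0.
    apply: measurable_and => //; apply: (measurableT_comp measurable_in_halfpi).
    exact: measurable_snd.
  apply: emeasurable_funM; first by apply/measurable_EFinP; exact: measurable_fst.
  apply: (measurableT_comp mg); apply: measurable_fun_pair; apply: measurable_funM => //.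
    by apply: measurableT_comp => //; apply: continuous_measurable_fun; exact: continuous_cos.
  by apply: measurableT_comp => //; apply: continuous_measurable_fun; exact: continuous_sin.
- by move=> p; case: ifPn => // /andP[p0 _]; rewrite mule_ge0// lee_fin ltW.
apply: eq_integral => phi _; rewrite /fubini_G/=.
case: ifPn => xpi; last by rewrite integral0_eq// => x _; rewrite andbF.
have c0 := cos_neq0_halfpi xpi.
have mkp : measurable_fun setT (fun x => k (x, tan phi)) by exact: measurable_fun_pair1.
have := @ge0_integral_dilation (fun x => k (x, tan phi)) (cos phi) (lt0r_neq0 c0) mkp
  (fun x => k0 _).
move/(congr1 (fun z => (cos phi)%:E * z)).
rewrite muleA -EFinM gtr0_norm// mulfV ?gt_eqF// mul1e => <-.
have kE (x : R) : k (cos phi * x, tan phi)%R = (cos phi)%:E *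
    (if (0 < x)%R && true then x%:E * g (x * cos phi, x * sin phi)%R else 0).
  rewrite /k /= pmulr_rgt0// andbT; case: ifPn => _; last by rewrite mule0.
  rewrite EFinM -!muleA; congr (_ * (_ * g (_, _))); first by rewrite mulrC.
  by rewrite /tan; field; rewrite gt_eqF.
under eq_integral do rewrite kE.
rewrite ge0_integralZl//; last 3 first.
- apply: measurable_fun_if0; first by apply: measurable_and => //; exact: measurable_fun_ltr.
  apply: emeasurable_funM; first exact/measurable_EFinP.
  by apply: (measurableT_comp mg); apply: measurable_fun_pair; exact: measurable_funM.
- by move=> x _; case: ifPn => // /andP[x0 _]; rewrite mule_ge0// lee_fin ltW.
- by rewrite lee_fin ltW.
rewrite !muleA -!EFinM -cos2_tan2 ?gt_eqF//.
by rewrite -mulrA -expr2 mulVf ?mul1e// expf_neq0// gt_eqF.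
Qed.

(** The linear map in [gL] rotates by [c] and stretches by [b1] and [b2]; its determinant is
    [b1 * b2] and its pivot [b1 * cos c]. The support condition says that the pulled back function
    lives in the right half-plane, where polar coordinates are available, and a final shift of the
    angle by [c] undoes the rotation. *)
Lemma ge0_integral_polar (b1 b2 c : R) (g : R * R -> \bar R) :
  (0 < b1)%R -> (0 < b2)%R -> cos c != 0%R ->
  measurable_fun setT g -> (forall x, 0 <= g x) ->
  (forall x, (x.1 / b1 * cos c + x.2 / b2 * sin c <= 0)%R -> g x = 0) ->
  \int[leb2 R]_x g x = \int[leb2 R]_p (if (0 < p.1)%R && in_halfpi (p.2 - c)
    then (b1 * b2 * p.1)%:E * g (b1 * p.1 * cos p.2, b2 * p.1 * sin p.2)%R else 0).
Proof.
move=> b10 b20 c0 mg g0 gsupp.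
have b12 : (0 < b1 * b2)%R by exact: mulr_gt0.
have det : (b1 * cos c * (b2 * cos c) - (- (b1 * sin c)) * (b2 * sin c) = b1 * b2)%R.
  by rewrite -[RHS]mulr1 -(cos2Dsin2 c); ring.
pose gL (y : R * R) := g (b1 * cos c * y.1 + - (b1 * sin c) * y.2,
                          b2 * sin c * y.1 + b2 * cos c * y.2)%R.
have mgL : measurable_fun setT gL.
  by apply: (measurableT_comp mg); apply: measurable_fun_pair;
    apply: measurable_funD; apply: measurable_funM.
have H : \int[leb2 R]_y gL y = (b1 * b2)^-1%:E * \int[leb2 R]_x g x.
  rewrite ge0_integral_linear2 ?det ?gtr0_norm//.
    by rewrite mulf_neq0// gt_eqF.
  by rewrite gt_eqF.
have gLE (y : R * R) : gL y = if (0 < y.1)%R then gL y else 0.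
  case: ltP => // y0; apply: gsupp => /=; apply: le_trans y0.
  rewrite le_eqVlt; apply/orP; left; apply/eqP.
  rewrite -[RHS]mulr1 -(cos2Dsin2 c); field.
  by rewrite !gt_eqF.
have mK : measurable_fun setT (fun p : R * R => if (0 < p.1)%R && in_halfpi (p.2 - c)
    then p.1%:E * g (b1 * p.1 * cos p.2, b2 * p.1 * sin p.2)%R else 0).
  apply: measurable_fun_if0.
    apply: measurable_and.
      by apply: measurable_fun_ltr => //; exact: measurable_fst.
    apply: (measurableT_comp measurable_in_halfpi); apply: measurable_funB => //.
  apply: emeasurable_funM; first by apply/measurable_EFinP; exact: measurable_fst.
  have mcos : measurable_fun setT (fun p : R * R => cos p.2).
    by apply: measurableT_comp => //; apply: continuous_measurable_fun; exact: continuous_cos.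
  have msin : measurable_fun setT (fun p : R * R => sin p.2).
    by apply: measurableT_comp => //; apply: continuous_measurable_fun; exact: continuous_sin.
  by apply: (measurableT_comp mg); apply: measurable_fun_pair;
    apply: measurable_funM => //; apply: measurable_funM.
have K0 (p : R * R) : 0 <= (if (0 < p.1)%R && in_halfpi (p.2 - c)
    then p.1%:E * g (b1 * p.1 * cos p.2, b2 * p.1 * sin p.2)%R else 0).
  by case: ifPn => // /andP[p0 _]; rewrite mule_ge0// lee_fin ltW.
transitivity ((b1 * b2)%:E * \int[leb2 R]_y gL y).
  by rewrite H muleA -EFinM mulfV ?gt_eqF// mul1e.
have -> : \int[leb2 R]_y gL y = \int[leb2 R]_y (if (0 < y.1)%R then gL y else 0).
  by apply: eq_integral => y _; exact: gLE.
rewrite ge0_integral_polar_halfplane//; last by move=> y; exact: g0.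
transitivity ((b1 * b2)%:E * \int[leb2 R]_p (if (0 < p.1)%R && in_halfpi (p.2 - c)
    then p.1%:E * g (b1 * p.1 * cos p.2, b2 * p.1 * sin p.2)%R else 0)).
  congr (_ * _); rewrite -(ge0_integral_shift2 0 c mK K0).
  apply: eq_integral => p _ /=; rewrite addr0 addrK; case: ifP => // _.
  rewrite /gL/= cosD sinD; congr (_ * g (_, _)); ring.
rewrite -ge0_integralZl//; last by rewrite lee_fin ltW.
by apply: eq_integral => p _; case: ifP => _; rewrite ?mule0// EFinM muleA.
Qed.

Lemma tonelli3 (G : R * R * R -> \bar R) :
  measurable_fun setT G -> (forall x, 0 <= G x) ->
  \int[leb3 R]_p G p = \int[leb]_s \int[leb2 R]_x G (x, s).
Proof.
move=> mG G0.
exact: (@fubini_tonelli2 _ _ (measurableTypeR R * measurableTypeR R)%type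
  (measurableTypeR R) R (@plane_measure R) leb G mG G0).
Qed.

(** The substitution occurring in [Weps], with [e = eps ^+ 2] and [b1], [b2] the square roots of the
    diagonal entries of [A]. *)
Definition moving_chart (b1 b2 e : R) (q : R * R * R) : R * R * R :=
  (b1 * (q.1.1 + q.2 / e) * cos q.1.2, b2 * (q.1.1 + q.2 / e) * sin q.1.2, q.2 / e)%R.

(** Polar coordinates at each fixed time [s], a shift of the radius by [s], and the dilation
    [s = t / e] of time, which accounts for the factor [1 / e]. *)
Lemma ge0_integral_moving_chart (b1 b2 c e : R) (G : R * R * R -> \bar R) :
  (0 < b1)%R -> (0 < b2)%R -> cos c != 0%R -> (0 < e)%R ->
  measurable_fun setT G -> (forall x, 0 <= G x) ->
  (forall p, (p.1.1 / b1 * cos c + p.1.2 / b2 * sin c <= 0)%R -> G p = 0) ->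
  \int[leb3 R]_p G p =
  \int[leb3 R]_q (if (0 < q.1.1 + q.2 / e)%R && in_halfpi (q.1.2 - c)
    then (b1 * b2 / e * (q.1.1 + q.2 / e))%:E * G (moving_chart b1 b2 e q) else 0).
Proof.
move=> b10 b20 c0 e0 mG G0 Gsupp.
have mcos : measurable_fun setT (fun p : R * R * R => cos p.1.2).
  apply: measurableT_comp; first by apply: continuous_measurable_fun; exact: continuous_cos.
  by apply: measurableT_comp.
have msin : measurable_fun setT (fun p : R * R * R => sin p.1.2).
  apply: measurableT_comp; first by apply: continuous_measurable_fun; exact: continuous_sin.
  by apply: measurableT_comp.
have m11 : measurable_fun setT (fun p : R * R * R => p.1.1) by apply: measurableT_comp.
have m12 : measurable_fun setT (fun p : R * R * R => p.1.2) by apply: measurableT_comp.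
have m2 : measurable_fun setT (fun p : R * R * R => p.2) by exact: measurable_snd.
pose K (q : R * R * R) := if (0 < q.1.1 + q.2)%R && in_halfpi (q.1.2 - c)
    then (b1 * b2 * (q.1.1 + q.2))%:E *
      G (b1 * (q.1.1 + q.2) * cos q.1.2, b2 * (q.1.1 + q.2) * sin q.1.2, q.2)%R else 0.
have mK : measurable_fun setT K.
  apply: measurable_fun_if0.
    apply: measurable_and.
      by apply: measurable_fun_ltr => //; exact: measurable_funD.
    by apply: (measurableT_comp measurable_in_halfpi); apply: measurable_funB.
  apply: emeasurable_funM.
    by apply/measurable_EFinP; apply: measurable_funM => //; exact: measurable_funD.
  apply: (measurableT_comp mG); apply: measurable_fun_pair => //.
  by apply: measurable_fun_pair; apply: measurable_funM => //;
    apply: measurable_funM => //; exact: measurable_funD.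
have K0 q : 0 <= K q.
  by rewrite /K; case: ifPn => // /andP[q0 _]; rewrite mule_ge0// lee_fin ltW// !mulr_gt0.
rewrite (tonelli3 mG G0).
transitivity (\int[leb]_s \int[leb2 R]_x K (x, s)).
  apply: eq_integral => s _.
  rewrite (@ge0_integral_polar b1 b2 c (fun x => G (x, s)))//; last 2 first.
  - exact: measurable_fun_pair1.
  - by move=> x x0; exact: Gsupp.
  pose J (p : R * R) := if (0 < p.1)%R && in_halfpi (p.2 - c)
    then (b1 * b2 * p.1)%:E * G (b1 * p.1 * cos p.2, b2 * p.1 * sin p.2, s)%R else 0.
  have JK (p : R * R) : J p = K (p.1 - s, p.2, s)%R.
    by rewrite /J /K/= subrK.
  have mJ : measurable_fun setT J.
    rewrite (funext JK).
    apply: (measurableT_comp mK); apply: measurable_fun_pair => //.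
    by apply: measurable_fun_pair => //; exact: measurable_funB.
  have J0 p : 0 <= J p by rewrite JK.
  rewrite -[LHS]/(\int[leb2 R]_p J p) -(ge0_integral_shift2 s 0 mJ J0).
  by apply: eq_integral => -[r phi] _; rewrite JK/= addrK addr0.
pose H (s : R) := \int[leb2 R]_x K (x, s).
have mH : measurable_fun setT H.
  exact: (@measurable_fun_fubini_tonelli_G _ _ (measurableTypeR R * measurableTypeR R)%type
    (measurableTypeR R) R (@plane_measure R) K mK K0).
have H0 s : 0 <= H s by apply: integral_ge0 => x _; exact: K0.
have ei0 : e^-1%R != 0%R by rewrite invr_neq0// gt_eqF.
have := ge0_integral_dilation ei0 mH H0; rewrite gtr0_norm ?invr_gt0// invrK.
move/(congr1 (fun z => e^-1%:E * z)).
rewrite muleA -EFinM mulVf ?gt_eqF// mul1e => <-.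
rewrite -ge0_integralZl//.
have KE (q : R * R * R) : (if (0 < q.1.1 + q.2 / e)%R && in_halfpi (q.1.2 - c)
    then (b1 * b2 / e * (q.1.1 + q.2 / e))%:E * G (moving_chart b1 b2 e q) else 0) =
    e^-1%:E * K (q.1, e^-1 * q.2)%R.
  rewrite /K/= ![(e^-1 * _)%R]mulrC; case: ifP => _; last by rewrite mule0.
  by rewrite muleA -EFinM; congr (_%:E * _); ring.
rewrite [RHS](_ : _ = \int[leb3 R]_q (e^-1%:E * K (q.1, e^-1 * q.2)%R)); last first.
  by apply: eq_integral => q _; exact: KE.
have mKe : measurable_fun setT (fun q : R * R * R => K (q.1, e^-1 * q.2)%R).
  by apply: (measurableT_comp mK); apply: measurable_fun_pair => //; exact: measurable_funM.
rewrite (@tonelli3 (fun q => e^-1%:E * K (q.1, e^-1 * q.2)%R)); last 2 first.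
- by apply: emeasurable_funM.
- by move=> q; rewrite mule_ge0// lee_fin invr_ge0 ltW.
apply: eq_integral => s _; rewrite /= ge0_integralZl//.
- exact: (measurable_fun_pair1 _ mKe).
- by rewrite lee_fin invr_ge0 ltW.
- by apply: (measurableT_comp mH); exact: measurable_funM.
- by rewrite lee_fin invr_ge0 ltW.
Qed.

(** The substitution is made in the positive and in the negative part; the Jacobian is nonnegative
    on the chart and commutes with taking these parts. *)
Lemma Rintegral_moving_chart (b1 b2 c e : R) (G : R * R * R -> R) :
  (0 < b1)%R -> (0 < b2)%R -> cos c != 0%R -> (0 < e)%R ->
  measurable_fun setT G ->
  (forall p, (p.1.1 / b1 * cos c + p.1.2 / b2 * sin c <= 0)%R -> G p = 0%R) ->
  (\int[leb3 R]_p G p =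
  \int[leb3 R]_q (if (0 < q.1.1 + q.2 / e) && in_halfpi (q.1.2 - c)
    then b1 * b2 / e * (q.1.1 + q.2 / e) * G (moving_chart b1 b2 e q) else 0))%R.
Proof.
move=> b10 b20 c0 e0 mG Gsupp; rewrite /Rintegral; congr fine.
have mG' : measurable_fun setT (fun p => (G p)%:E) by exact/measurable_EFinP.
rewrite integralE [RHS]integralE.
have J0 (q : R * R * R) : (0 < q.1.1 + q.2 / e -> 0 <= b1 * b2 / e * (q.1.1 + q.2 / e))%R.
  by move=> q0; rewrite mulr_ge0 ?divr_ge0 ?mulr_ge0// ltW.
congr (_ - _); (rewrite (@ge0_integral_moving_chart b1 b2 c e)//; last 2 first);
  rewrite -/(in_halfpi _).
- exact: measurable_funepos.
- by move=> p /Gsupp Gp; rewrite funeposE Gp maxxx.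
- apply: eq_integral => q _; rewrite !funeposE; case: ifPn => [/andP[q0 _]|_]; last by rewrite maxxx.
  by rewrite EFinM maxe_pMr ?lee_fin ?J0// mule0.
- exact: measurable_funeneg.
- by move=> p /Gsupp Gp; rewrite funenegE Gp oppe0 maxxx.
- apply: eq_integral => q _; rewrite !funenegE; case: ifPn => [/andP[q0 _]|_]; last by rewrite oppe0 maxxx.
  by rewrite maxe_pMr ?lee_fin ?J0// mule0 muleN -EFinM.
Qed.

End ChangeOfVariables.

(** * Smooth functions of one variable *)

Section OneVariable.
Context {R : realType}.

Lemma smooth1_of_smooth_on (O : set R) (h : R -> R) :
  smooth_on (V := R^o) O h -> smooth1 O h.
Proof.
move=> Sh; exists (fun n => Dseq (V := R^o) (nseq n (1 : R^o)) h); split=> // n x Ox.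
have [_ d _] := (smooth_onP _ _).1 (smooth_on_Dseq (nseq n (1 : R^o)) Sh).
exact: (derivableP (d x 1 Ox)).
Qed.

Lemma smooth_on_id (O : set R^o) : smooth_on O (id : R^o -> R).
Proof. by apply: smooth_on_linear => // x; exact: cvg_id. Qed.

Lemma smooth_on_of_smooth1 (O : set R^o) (h : R -> R) : open O ->
  smooth1 O h -> smooth_on O (h : R^o -> R).
Proof.
move=> oO Sh; rewrite -[h]/(h \o id); apply: (smooth_on_comp1 oO Sh) => //.
exact: smooth_on_id.
Qed.

Lemma smooth1_cos : smooth1 setT (@cos R).
Proof.
exists (fun n x => cos (x + n%:R * (pi / 2))); split.
  by apply/funext => x; rewrite mul0r addr0.
move=> n x _; have -> : cos (x + n.+1%:R * (pi / 2)) = - sin (x + n%:R * (pi / 2)) * 1.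
  by rewrite mulr1 -natr1 mulrDl mul1r addrA cosDpihalf.
have d1 : is_derive x 1 (fun x : R => x + n%:R * (pi / 2)) 1.
  by apply: is_derive_eq; rewrite addr0.
exact: (@is_derive1_comp _ cos (fun x : R => x + n%:R * (pi / 2)) x _ _ _ d1).
Qed.

Lemma smooth1_sin : smooth1 setT (@sin R).
Proof.
exists (fun n x => sin (x + n%:R * (pi / 2))); split.
  by apply/funext => x; rewrite mul0r addr0.
move=> n x _; have -> : sin (x + n.+1%:R * (pi / 2)) = cos (x + n%:R * (pi / 2)) * 1.
  by rewrite mulr1 -natr1 mulrDl mul1r addrA sinDpihalf.
have d1 : is_derive x 1 (fun x : R => x + n%:R * (pi / 2)) 1.
  by apply: is_derive_eq; rewrite addr0.
exact: (@is_derive1_comp _ sin (fun x : R => x + n%:R * (pi / 2)) x _ _ _ d1).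
Qed.

Lemma smooth1_inv : smooth1 [set x : R | x != 0] (@GRing.inv R).
Proof.
exists (fun n x => (-1) ^+ n * n`!%:R * x ^- n.+1); split.
  by apply/funext => x; rewrite expr0 mul1r fact0 mul1r expr1.
move=> n x /= x0.
have d1 : is_derive x 1 (fun x : R => x ^+ n.+1) (n.+1%:R * x ^+ n).
  by split; [exact: exprn_derivable|rewrite exp_derive [_ *: 1]mulr1].
have [d2 e2'] : is_derive x 1 (fun x : R => (x ^+ n.+1)^-1)
    (- (x ^+ n.+1) ^- 2 * (n.+1%:R * x ^+ n)).
  case: d1 => d e; have xn0 : x ^+ n.+1 != 0 by rewrite expf_neq0.
  by split; [exact: derivableV|rewrite deriveV// e].
have -> : (-1) ^+ n.+1 * n.+1`!%:R * x ^- n.+2 =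
  (-1) ^+ n * n`!%:R * (- (x ^+ n.+1) ^- 2 * (n.+1%:R * x ^+ n)) :> R.
  by rewrite factS natrM !exprS; field; rewrite expf_neq0.
split; first by apply: derivableZ.
by rewrite deriveZ// e2'.
Qed.

Lemma smooth1_sqrt : smooth1 [set x : R | 0 < x] (@Num.sqrt R).
Proof.
have Sinv : smooth_on (V := R^o) [set x : R^o | 0 < x] (@GRing.inv R).
  apply: smooth_onSubset (smooth_on_of_smooth1 _ smooth1_inv).
    by move=> x /=; exact: lt0r_neq0.
  exact: open_neq.
have oO : open [set x : R^o | 0 < x] by exact: open_gt.
(* The falling factorial of [1 / 2]: the [n]-th derivative of the square root is
   [c n * Num.sqrt x * x ^- n]. *)
pose c (n : nat) : R := \prod_(i < n) (2^-1 - i%:R).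
exists (fun n x => c n * (Num.sqrt x * x ^- n)); split.
  by apply/funext => x; rewrite /c big_ord0 mul1r expr0 invr1 mulr1.
move=> n x /= x0.
have [d1 e1] := is_derive1_sqrt x0.
have [d2 e2'] : is_derive x 1 (fun x : R => (x ^+ n)^-1)
    (- (x ^+ n) ^- 2 * (n%:R * x ^+ n.-1)).
  have xn0 : x ^+ n != 0 by rewrite expf_neq0// gt_eqF.
  split; first by apply: derivableV => //; exact: exprn_derivable.
  by rewrite deriveV//; [rewrite exp_derive [_ *: 1]mulr1|exact: exprn_derivable].
have s0 : Num.sqrt x != 0 by rewrite gt_eqF// sqrtr_gt0.
have sx : x = Num.sqrt x ^+ 2 by rewrite sqr_sqrtr// ltW.
have D : is_derive x 1 (Num.sqrt \* (fun y : R => y ^- n)) (Num.sqrt x *: _ + _) :=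
  is_deriveM (DeriveDef d1 e1) (DeriveDef d2 e2').
apply: (is_derive_eq (is_deriveZ (c n) D)).
rewrite /c big_ord_recr/= /GRing.scale/= -mulrA; congr (_ * _).
move: s0 sx; set s := Num.sqrt x => s0 sx.
case: n {d2 e2' D} => [|n] /=; first by rewrite !expr0 expr1 {1}sx; field.
have : x ^+ n != 0 by rewrite expf_neq0// gt_eqF.
rewrite !exprS; set X := x ^+ n => X0; rewrite sx -natr1; field.
by rewrite X0.
Qed.

(** The first derivative [1 / (1 + x^2)] is smooth by composition, so the tower is obtained from
    [smooth_on] and not from a closed formula. *)
Lemma smooth1_atan : smooth1 setT (@atan R).
Proof.
apply: smooth1_of_smooth_on; apply/smooth_onP.
have d (x : R) v : is_derive x v (@atan R : R^o -> R) (v * (1 + x ^+ 2)^-1).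
  have [da ea] := is_derive1_atan x.
  by have := @deriveZv R R^o atan x 1 v da; rewrite ea [v *: 1]mulr1.
split=> [x _|x v _|v]; first exact: continuous_atan.
  by have [] := d x v.
have -> : 'D_v (@atan R : R^o -> R) = fun x => v * (1 + x ^+ 2)^-1.
  by apply/funext => x; have [] := d x v.
apply: smooth_onZ; first exact: openT.
apply: (@smooth_on_comp1 _ R^o setT (fun x => 1 + x ^+ 2) [set x | x != 0] GRing.inv openT smooth1_inv).
  by move=> x _ /=; rewrite gt_eqF// ltr_pwDl// sqr_ge0.
apply: smooth_onD; [exact: openT|exact: smooth_on_cst|].
by apply: smooth_onX; [exact: openT|exact: smooth_on_id].
Qed.

Lemma poly_expRN_bound (P : {poly R}) : exists2 C : R, 0 <= C &
  forall y, 0 < y -> `|P.[y]| * expR (- y) <= C / y.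
Proof.
exists (\sum_(i < size P) `|P`_i| * i.+1`!%:R).
  by apply: sumr_ge0 => i _; rewrite mulr_ge0.
move=> y y0; rewrite horner_coef mulr_suml.
apply: (@le_trans _ _ ((\sum_(i < size P) `|P`_i| * y ^+ i) * expR (- y))).
  rewrite ler_wpM2r ?expR_ge0// (le_trans (ler_norm_sum _ _ _))// ler_sum// => i _.
  by rewrite normrM (ger0_norm (exprn_ge0 _ (ltW y0))).
rewrite mulr_suml ler_sum// => i _.
rewrite -!mulrA ler_wpM2l// expRN ler_pdivlMr// mulrAC ler_pdivrMr ?expR_gt0//.
rewrite -exprSr mulrC -ler_pdivrMr ?ltr0n ?fact_gt0//.
by apply: le_trans (expR_ge1Dxn i (ltW y0)); rewrite lerDr.
Qed.

(** The flat function [exp (- 1 / x)] with a polynomial prefactor in [1 / x]: differentiation maps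
    this family to itself, sending [P] to [X^2 (P - P')], which yields all derivatives at once. *)
Definition flat_fun (P : {poly R}) (x : R) : R :=
  if 0 < x then P.[x^-1] * expR (- x^-1) else 0.

Lemma is_derive_flat_fun (P : {poly R}) (x : R) :
  is_derive x 1 (flat_fun P) (flat_fun ('X^2 * (P - P^`())) x).
Proof.
have [x0|x0|<-] := ltgtP 0 x.
- have nx : \near x, P.[x^-1] * expR (- x^-1) = flat_fun P x.
    near=> y; rewrite /flat_fun ifT//; near: y; exact: lt_nbhsr.
  apply: (near_eq_is_derive nx).
  have di : is_derive x 1 (@GRing.inv R) (- x ^- 2).
    split; first by apply: derivableV => //; rewrite gt_eqF.
    by rewrite (@deriveV _ _ id)// ?gt_eqF// derive_id [_ *: 1]mulr1.
  have dP : is_derive x 1 (horner P \o GRing.inv) (P^`().[x^-1] * - x ^- 2).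
    have dh : is_derive (x^-1) 1 (horner P) P^`().[x^-1].
      by split; [exact: derivable_horner|rewrite -derive1E -derivE].
    exact: (is_derive1_comp dh di).
  have dE : is_derive x 1 (expR \o (fun x => - x^-1)) (expR (- x^-1) * x ^- 2).
    rewrite -[X in _ * X]opprK.
    exact: (@is_derive1_comp _ expR (fun x => - x^-1) x _ _
      (is_derive_expR (- x^-1)) (is_deriveN di)).
  apply: (is_derive_eq (is_deriveM dP dE)).
  rewrite /flat_fun x0 !hornerE /GRing.scale/= -exprVn; ring.
- have nx : \near x, (cst 0 : R -> R) x = flat_fun P x.
    near=> y; rewrite /flat_fun ltNge ltW//; near: y; exact: lt_nbhsl.
  apply: (near_eq_is_derive nx); rewrite /flat_fun ltNge ltW//.
  exact: is_derive_cst.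
rewrite /flat_fun ltxx.
(* At [0] the difference quotient with [h > 0] is [h^-1 * P.[h^-1] * expR (- h^-1)]; the extra ['X]
   accounts for the [h^-1], and the bound is [C * h]. *)
have [C C0 HC] := poly_expRN_bound ('X * P).
have E : (fun h : R => h^-1 *: (flat_fun P (h *: (1 : R) + 0) - flat_fun P 0)) @ 0^' --> 0.
  apply/cvgrPdist_le => e e0; near=> h.
  have h0 : h != 0 by near: h; exact: nbhs_dnbhs_neq.
  rewrite sub0r normrN [h *: 1]mulr1 addr0 /flat_fun ltxx subr0.
  case: ifPn => hp; last by rewrite scaler0 normr0 ltW.
  have := HC h^-1; rewrite invr_gt0 hp hornerM hornerX invrK => /(_ isT) H.
  rewrite normrZ normrM (ger0_norm (expR_ge0 _)) mulrA -normrM (le_trans H)//.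
  rewrite (@le_trans _ _ (h * (C + 1)))//.
    by rewrite mulrC ler_wpM2l ?ltW// ltrDl.
  rewrite -ler_pdivlMr ?ltr_wpDl// -(gtr0_norm hp) ltW//.
  by near: h; apply: dnbhs0_lt; rewrite divr_gt0// ltr_wpDl.
split; first by apply/cvg_ex; exists 0.
exact/cvg_lim.
Unshelve. all: by end_near. Qed.

Lemma smooth1_flat_fun : smooth1 setT (flat_fun 1).
Proof.
exists (fun n => flat_fun (iter n (fun P => 'X^2 * (P - P^`())) 1)); split=> // n x _.
exact: is_derive_flat_fun.
Qed.

Lemma flat_fun1_gt0 (x : R) : 0 < x -> 0 < flat_fun 1 x.
Proof. by rewrite /flat_fun => ->; rewrite hornerC mul1r expR_gt0. Qed.

Lemma flat_fun1_eq0 (x : R) : x <= 0 -> flat_fun 1 x = 0.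
Proof. by rewrite /flat_fun leNgt; case: ifP. Qed.

Lemma flat_fun1_ge0 (x : R) : 0 <= flat_fun 1 x.
Proof. by have [/flat_fun1_eq0->//|/flat_fun1_gt0/ltW] := leP x 0. Qed.

Definition smooth_step (x : R) : R :=
  flat_fun 1 x / (flat_fun 1 x + flat_fun 1 (1 - x)).

Lemma smooth_step_eq0 (x : R) : x <= 0 -> smooth_step x = 0.
Proof. by move=> x0; rewrite /smooth_step flat_fun1_eq0// mul0r. Qed.

Lemma smooth_step_eq1 (x : R) : 1 <= x -> smooth_step x = 1.
Proof.
move=> x1; rewrite /smooth_step [flat_fun 1 (1 - x)]flat_fun1_eq0 ?subr_le0// addr0.
by rewrite divff// gt_eqF// flat_fun1_gt0// (lt_le_trans _ x1).
Qed.

Lemma smooth_on_step (V : normedModType R) (u : V -> R) :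
  smooth_on setT u -> smooth_on setT (fun x => smooth_step (u x)).
Proof.
move=> Su; have oT : open [set: V] by exact: openT.
have S1 : smooth_on setT (fun x => flat_fun 1 (u x)) :=
  smooth_on_comp1 oT smooth1_flat_fun (fun _ _ => I) Su.
have S2 : smooth_on setT (fun x => flat_fun 1 (1 - u x)) :=
  smooth_on_comp1 oT smooth1_flat_fun (fun _ _ => I)
    (smooth_onB oT (smooth_on_cst 1) Su).
apply: (smooth_onM oT S1).
apply: (smooth_on_comp1 oT smooth1_inv _ (smooth_onD oT S1 S2)).
(* The denominator is positive because [u] and [1 - u] are never both nonpositive. *)
move=> x _ /=; rewrite gt_eqF//; have [u0|u0] := leP (u x) 0.
  by rewrite ltr_wpDl ?flat_fun1_ge0// flat_fun1_gt0//; lra.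
by rewrite ltr_pwDl ?flat_fun1_ge0// flat_fun1_gt0.
Qed.

End OneVariable.

(** * Slowly modulated wave fronts in a sector *)

Section Coordinates.
Context {R : realType}.

Lemma smooth_on_r (U : set (R * R * R)) : smooth_on U (fun p => p.1.1).
Proof.
apply: smooth_on_linear => [p|//].
by apply: (@continuous_comp _ _ _ fst fst); [exact: cvg_fst|exact: cvg_fst].
Qed.

Lemma smooth_on_phi (U : set (R * R * R)) : smooth_on U (fun p => p.1.2).
Proof.
apply: smooth_on_linear => [p|//].
by apply: (@continuous_comp _ _ _ fst snd); [exact: cvg_fst|exact: cvg_snd].
Qed.

Lemma smooth_on_t (U : set (R * R * R)) : smooth_on U (fun p => p.2).
Proof. by apply: smooth_on_linear => [p|//]; exact: cvg_snd. Qed.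

Lemma sum_ord2 (f : 'I_2 -> R) : \sum_(i < 2) f i = f 0 + f 1.
Proof. by rewrite big_ord_recl big_ord1; congr (_ + f _); exact: val_inj. Qed.

Lemma op2_diag (V : normedModType R) (a : 'I_2 -> R) (e : 'I_2 -> V) (f : V -> R) x :
  op2 (diag_mx (\row_i a i)) e f x =
  a 0 * Dseq [:: e 0; e 0] f x + a 1 * Dseq [:: e 1; e 1] f x.
Proof.
have H (d : 'I_2 -> 'I_2 -> R) : \sum_(i < 2) \sum_(j < 2)
    diag_mx (\row_i a i) i j * d i j = a 0 * d 0 0 + a 1 * d 1 1.
  by rewrite !sum_ord2 !mxE/= !mulr1n !mulr0n !mul0r addr0 add0r.
exact: (H (fun i j => Dseq [:: e i; e j] f x)).
Qed.

(** Product and chain rule for [(e rho)^k th (rho - t, ang, e t)], sorted by powers of [e]: here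
    [n], [m / r], [s] are the derivatives of [rho], [ang], [t], while [T], [D0], [D1], [D2] are the
    value and the partial derivatives of [th]. *)
Lemma lift_algebra (e r D0 D1 D2 T n m s : R) k : e != 0 -> r != 0 ->
  (e * r) ^+ k * (D0 * (n - s) + D1 * (m / r) + D2 * (e * s)) +
  T * (k%:R * (e * r) ^+ k.-1 * (e * n)) =
  (e * r) ^+ k * (n * D0 - s * D0) +
  e * ((e * r) ^+ k * (s * D2) +
       (e * r) ^+ k / (e * r) * (k%:R * (n * T) + m * D1)).
Proof.
move=> e0 r0; case: k => [|k] /=; first by field; rewrite r0.
by rewrite exprSr -natr1; move: ((e * r) ^+ k) (k%:R) => X K; field; rewrite r0.
Qed.

End Coordinates.

Section Sector.
Context {R : realType}.
Context (b1 b2 c : R) (b1_gt0 : 0 < b1) (b2_gt0 : 0 < b2).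
Implicit Types (p v : R * R * R) (th : R * R * R -> R).

(** In the coordinates rotated by the angle [c], the point [p] lies at
    [(sec_x p, sec_y p) = rho p * (cos (ang p - c), sin (ang p - c))]. *)
Definition sec_x p : R := p.1.1 / b1 * cos c + p.1.2 / b2 * sin c.
Definition sec_y p : R := p.1.2 / b2 * cos c - p.1.1 / b1 * sin c.
Definition rho p : R := Num.sqrt ((p.1.1 / b1) ^+ 2 + (p.1.2 / b2) ^+ 2).
Definition ang p : R := c + atan (sec_y p / sec_x p).

(** Along [v], the derivative of [rho] is [nvec v ang] and that of [ang] is [mvec v ang / rho]; see
    [is_derive_rho] and [is_derive_ang]. *)
Definition nvec v (phi : R) := cos phi / b1 * v.1.1 + sin phi / b2 * v.1.2.
Definition mvec v (phi : R) := cos phi / b2 * v.1.2 - sin phi / b1 * v.1.1.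

Lemma sec_norm p : sec_x p ^+ 2 + sec_y p ^+ 2 = (p.1.1 / b1) ^+ 2 + (p.1.2 / b2) ^+ 2.
Proof. by rewrite -[RHS]mulr1 -(cos2Dsin2 c) /sec_x /sec_y; ring. Qed.

Lemma rho_gt0 p : 0 < sec_x p -> 0 < rho p.
Proof.
by move=> x0; rewrite sqrtr_gt0 -sec_norm ltr_pwDl ?sqr_ge0// exprn_gt0.
Qed.

Lemma rhoK p : rho p ^+ 2 = (p.1.1 / b1) ^+ 2 + (p.1.2 / b2) ^+ 2.
Proof. by rewrite sqr_sqrtr// addr_ge0// sqr_ge0. Qed.

Lemma rho_cosB p : 0 < sec_x p -> rho p * cos (ang p - c) = sec_x p.
Proof.
move=> x0; rewrite /ang addrAC subrr add0r cos_atan.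
have -> : rho p = sec_x p * Num.sqrt (1 + (sec_y p / sec_x p) ^+ 2).
  rewrite -{1}(ger0_norm (ltW x0)) -sqrtr_sqr -sqrtrM ?sqr_ge0// mulrDr mulr1.
  by rewrite -exprMn mulrCA mulfV ?gt_eqF// mulr1 sec_norm.
by rewrite mulfK// gt_eqF// sqrtr_gt0 ltr_pwDl// sqr_ge0.
Qed.

Lemma rho_sinB p : 0 < sec_x p -> rho p * sin (ang p - c) = sec_y p.
Proof.
move=> x0; have := rho_cosB x0; rewrite /ang addrAC subrr add0r.
have : tan (atan (sec_y p / sec_x p)) = sec_y p / sec_x p by rewrite atanK.
rewrite /tan; set C := cos _; set S := sin _ => + rC.
have C0 : C != 0 by apply: contra_eq_neq rC => ->; rewrite mulr0 lt_eqF.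
move/(congr1 (fun z => z * C)); rewrite divfK// => ->.
by rewrite mulrCA rC divfK// gt_eqF.
Qed.

Lemma rho_cos p : 0 < sec_x p -> rho p * cos (ang p) = p.1.1 / b1.
Proof.
move=> x0; rewrite -(subrK c (ang p)) cosD mulrBr !mulrA rho_cosB// rho_sinB//.
by rewrite -[RHS]mulr1 -(cos2Dsin2 c) /sec_x /sec_y; ring.
Qed.

Lemma rho_sin p : 0 < sec_x p -> rho p * sin (ang p) = p.1.2 / b2.
Proof.
move=> x0; rewrite -(subrK c (ang p)) sinD mulrDr !mulrA rho_cosB// rho_sinB//.
by rewrite -[RHS]mulr1 -(cos2Dsin2 c) /sec_x /sec_y; ring.
Qed.

Let smooth_x1 U : open U -> smooth_on U (fun p => p.1.1 / b1).
Proof. by move=> oU; exact: (smooth_onM oU (@smooth_on_r R U) (smooth_on_cst b1^-1)). Qed.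

Let smooth_x2 U : open U -> smooth_on U (fun p => p.1.2 / b2).
Proof. by move=> oU; exact: (smooth_onM oU (@smooth_on_phi R U) (smooth_on_cst b2^-1)). Qed.

Lemma smooth_on_sec_x U : open U -> smooth_on U sec_x.
Proof.
move=> oU; exact: (smooth_onD oU (smooth_onM oU (smooth_x1 oU) (smooth_on_cst (cos c)))
  (smooth_onM oU (smooth_x2 oU) (smooth_on_cst (sin c)))).
Qed.

Lemma smooth_on_sec_y U : open U -> smooth_on U sec_y.
Proof.
move=> oU; exact: (smooth_onB oU (smooth_onM oU (smooth_x2 oU) (smooth_on_cst (cos c)))
  (smooth_onM oU (smooth_x1 oU) (smooth_on_cst (sin c)))).
Qed.

Lemma sec_x_continuous : continuous sec_x.
Proof.
by move=> p; have S := smooth_on_sec_x openT; exact: (C_on_cont (S 0%N) I).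
Qed.

Lemma open_sec_gt (d : R) : open [set p | d < sec_x p].
Proof. by apply: (@open_comp _ _ sec_x [set x | d < x]); [move=> p _; exact: sec_x_continuous|exact: open_gt]. Qed.

Lemma open_sec_lt (d : R) : open [set p | sec_x p < d].
Proof. by apply: (@open_comp _ _ sec_x [set x | x < d]); [move=> p _; exact: sec_x_continuous|exact: open_lt]. Qed.

Let H := [set p | 0 < sec_x p].
Let oH : open H. Proof. exact: open_sec_gt. Qed.

Lemma smooth_on_rho : smooth_on H rho.
Proof.
apply: (smooth_on_comp1 oH smooth1_sqrt (f := fun p => (p.1.1 / b1) ^+ 2 + (p.1.2 / b2) ^+ 2)).
  by move=> p /= /rho_gt0; rewrite sqrtr_gt0.
exact: (smooth_onD oH (smooth_onX 2 oH (smooth_x1 oH)) (smooth_onX 2 oH (smooth_x2 oH))).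
Qed.

Lemma smooth_on_ang : smooth_on H ang.
Proof.
apply: smooth_onD => //; first exact: smooth_on_cst.
apply: (smooth_on_comp1 oH smooth1_atan (f := fun p => sec_y p / sec_x p)) => //.
apply: smooth_onM => //; first exact: smooth_on_sec_y.
apply: (smooth_on_comp1 oH smooth1_inv) => //; last exact: smooth_on_sec_x.
by move=> p; exact: lt0r_neq0.
Qed.

Lemma sec_x_linear (k : R) p v : sec_x (k *: p + v) = k * sec_x p + sec_x v.
Proof. by rewrite /sec_x /= /GRing.scale/=; ring. Qed.

Lemma sec_y_linear (k : R) p v : sec_y (k *: p + v) = k * sec_y p + sec_y v.
Proof. by rewrite /sec_y /= /GRing.scale/=; ring. Qed.

Lemma is_derive_ang p v : 0 < sec_x p -> is_derive p v ang (mvec v (ang p) / rho p).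
Proof.
move=> x0; have x0' : sec_x p != 0 by rewrite gt_eqF.
have r0 := rho_gt0 x0; have r0' : rho p != 0 by rewrite gt_eqF.
have dx := derivable_linear p v sec_x_linear.
have dy := derivable_linear p v sec_y_linear.
have di : is_derive p v (fun p => (sec_x p)^-1) (- sec_x p ^- 2 * sec_x v).
  by case: dx => d e; split; [exact: derivableV|rewrite deriveV// e].
have dq : is_derive p v (fun p => sec_y p / sec_x p) _ := is_deriveM dy di.
have da := @is_derive_comp1 R _ (@atan R) _ p v _ _ (is_derive1_atan _) dq.
have dc : is_derive p v ang _ := is_deriveD (is_derive_cst c p v) da.
apply: (is_derive_eq dc); rewrite add0r /GRing.scale/=.
transitivity ((sec_x p * sec_y v - sec_y p * sec_x v) / rho p ^+ 2).
  rewrite rhoK -sec_norm; field.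
  by rewrite x0' gt_eqF// ltr_pwDl ?sqr_ge0// exprn_gt0.
have -> : mvec v (ang p) / rho p =
   (rho p * cos (ang p) / b2 * v.1.2 - rho p * sin (ang p) / b1 * v.1.1) / rho p ^+ 2.
  by rewrite /mvec; field; rewrite r0' !gt_eqF.
rewrite rho_cos// rho_sin//; congr (_ / _).
rewrite -[RHS]mulr1 -(cos2Dsin2 c) /sec_x /sec_y; field.
by rewrite !gt_eqF.
Qed.

Lemma is_derive_rho p v : 0 < sec_x p -> is_derive p v rho (nvec v (ang p)).
Proof.
move=> x0; have r0 := rho_gt0 x0; have r0' : rho p != 0 by rewrite gt_eqF.
have d1 : is_derive p v (fun p => p.1.1 / b1) (v.1.1 / b1).
  by apply: derivable_linear => k x y; rewrite /= /GRing.scale/=; ring.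
have d2 : is_derive p v (fun p => p.1.2 / b2) (v.1.2 / b2).
  by apply: derivable_linear => k x y; rewrite /= /GRing.scale/=; ring.
have q0 : 0 < (p.1.1 / b1) ^+ 2 + (p.1.2 / b2) ^+ 2 by rewrite -rhoK exprn_gt0.
have dq : is_derive p v (fun p => (p.1.1 / b1) ^+ 2 + (p.1.2 / b2) ^+ 2) _ :=
  is_deriveD (is_deriveX 2 d1) (is_deriveX 2 d2).
have ds : is_derive p v rho _ :=
  @is_derive_comp1 R _ (@Num.sqrt R) _ p v _ _ (is_derive1_sqrt q0) dq.
apply: (is_derive_eq ds); rewrite -[Num.sqrt _]/(rho p) /GRing.scale/= !expr1.
have -> : nvec v (ang p) =
   (rho p * cos (ang p) / b1 * v.1.1 + rho p * sin (ang p) / b2 * v.1.2) / rho p.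
  by rewrite /nvec; field; rewrite r0' !gt_eqF.
rewrite rho_cos// rho_sin//; field.
by rewrite r0' !gt_eqF.
Qed.

Context (r0 t0 t1 : R) (r0_ge0 : 0 <= r0) (t0_gt0 : 0 < t0).

(** The half-width [3 / 8 * pi] lies below [pi / 2], which keeps lifted profiles off the edge of the
    half-plane, and above [pi / 4], so that sectors spaced by [pi / 2] overlap. *)
Definition box (q : R * R * R) :=
  [&& `|q.1.1| <= r0, `|q.1.2 - c| <= 3 / 8 * pi, t0 <= q.2 & q.2 <= t1].

Definition adm th := smooth_on setT th /\ forall q, ~~ box q -> th q = 0.

Lemma open_not_box : open [set q | ~~ box q].
Proof.
have cts (f : R * R * R -> R) (d : R) : continuous f -> open [set q | d < f q].
  by move=> cf; apply: (@open_comp _ _ f [set x | d < x]); [move=> p _; exact: cf|exact: open_gt].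
have ctn (f : R * R * R -> R) : continuous f -> continuous (fun q => `|f q|).
  by move=> cf q; apply: continuous_comp; [exact: cf|exact: norm_continuous].
have sc (f : R * R * R -> R) : smooth_on setT f -> continuous f.
  by move=> sf q; exact: (C_on_cont (sf 0%N) I).
have -> : [set q | ~~ box q] = [set q | r0 < `|q.1.1|] `|` [set q | 3 / 8 * pi < `|q.1.2 - c|]
    `|` [set q | - t0 < - q.2] `|` [set q | t1 < q.2].
  apply/seteqP; split=> q /=; rewrite /box !negb_and -!ltNge ltrN2.
    by move=> /or4P[]; by [left; left; left|left; left; right|left; right|right].
  by move=> [[[]|]|] ->; rewrite ?orbT.
apply: openU; first apply: openU; first apply: openU.
- by apply: cts; apply: ctn; apply: sc; exact: smooth_on_r.
- apply: cts; apply: ctn; apply: sc; apply: smooth_onB; first exact: openT.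
    exact: smooth_on_phi.
  exact: smooth_on_cst.
- apply: cts; apply: sc.
  have := smooth_onZ (- 1) openT (@smooth_on_t R setT).
  by under eq_fun do rewrite mulN1r.
- by apply: cts; apply: sc; exact: smooth_on_t.
Qed.

Lemma adm_D v th : adm th -> adm ('D_v th).
Proof.
move=> [Sth th0]; split; first by have [_ _ S] := (smooth_onP _ _).1 Sth; exact: S.
move=> q qb; rewrite -(derive_cst (0 : R) q v); apply: near_eq_derive.
exact: (open_near open_not_box qb th0).
Qed.

Lemma adm_add th th' : adm th -> adm th' -> adm (fun q => th q + th' q).
Proof.
move=> [S z] [S' z']; split; first exact: (smooth_onD openT S S').
by move=> q qb; rewrite z// z'// addr0.
Qed.

Lemma adm_mul (h : R * R * R -> R) th : smooth_on setT h -> adm th -> adm (fun q => h q * th q).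
Proof.
move=> Sh [S z]; split; first exact: (smooth_onM openT Sh S).
by move=> q qb; rewrite z// mulr0.
Qed.

Lemma adm_scale (k : R) th : adm th -> adm (fun q => k * th q).
Proof. exact: (adm_mul (smooth_on_cst k)). Qed.

Lemma adm_der th q u : adm th -> derivable th q u.
Proof. by move=> [S _]; have [_ d _] := (smooth_onP _ _).1 S; exact: d. Qed.

(** The exponent of [e * rho] is [k - 1]: for [k = 0] it cancels the Jacobian of
    polar coordinates. *)
Definition lift (e : R) (k : nat) th p : R :=
  if 0 < sec_x p then
    (e * rho p) ^+ k / (e * rho p) * th (rho p - p.2, ang p, e * p.2)
  else 0.

Section FixedScale.
Context (e : R) (e_gt0 : 0 < e) (e_small : e * r0 < t0).

(** On the support of a lifted profile [rho >= t0 / e - r0] and the angle is within [3 / 8 * pi] of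
    [c], so [sec_x = rho * cos (ang - c)] is at least [delta]. *)
Let delta : R := (t0 / e - r0) * cos (3 / 8 * pi).

Lemma delta_gt0 : 0 < delta.
Proof.
rewrite mulr_gt0//; first by rewrite subr_gt0 ltr_pdivlMr// mulrC.
by apply: cos_gt0_pihalf; have := pi_gt0 R; lra.
Qed.

Lemma box_chart p : 0 < sec_x p -> box (rho p - p.2, ang p, e * p.2) ->
  [/\ delta <= sec_x p, t0 / e <= p.2 <= t1 / e & rho p <= t1 / e + r0].
Proof.
move=> x0 /and4P[/= + a8 s0 s1]; rewrite ler_norml => /andP[rs1 rs2].
have s0' : t0 / e <= p.2 by rewrite ler_pdivrMr// mulrC.
have s1' : p.2 <= t1 / e by rewrite ler_pdivlMr// mulrC.
split; [|by rewrite s0'|lra].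
rewrite -rho_cosB//; apply: ler_pM.
- by rewrite subr_ge0 ler_pdivlMr// mulrC ltW.
- by apply: cos_ge0_pihalf; have := pi_gt0 R; lra.
- by lra.
rewrite -(cos_norm (ang p - c)) leNgt; apply/negP.
have := pi_gt0 R => pi0; rewrite ltr_cos ?in_itv/=; [|lra|]; first by rewrite ltNge a8.
by rewrite normr_ge0 (le_trans a8)//; lra.
Qed.

Lemma lift_eq0 k th p : adm th -> sec_x p < delta -> lift e k th p = 0.
Proof.
move=> [_ th0] xd; rewrite /lift; case: ifPn => // x0.
rewrite th0 ?mulr0//; apply/negP => /(box_chart x0)[+ _ _].
by rewrite leNgt xd.
Qed.

Lemma lift_neq0 k th p : adm th -> lift e k th p != 0 ->
  [/\ 0 < sec_x p, t0 / e <= p.2 <= t1 / e & rho p <= t1 / e + r0].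
Proof.
move=> [_ th0]; rewrite /lift; case: ifPn => [x0|_ /eqP//].
have [/(box_chart x0)[_ ? ?]//|nb] := boolP (box (rho p - p.2, ang p, e * p.2)).
by rewrite th0// mulr0 eqxx.
Qed.

(** The open sets [0 < sec_x] and [sec_x < delta] cover space-time; on the first the formula is
    smooth, on the second the lift vanishes. *)
Lemma smooth_on_lift k th : adm th -> smooth_on setT (lift e k th).
Proof.
move=> ath; have [Sth _] := ath.
have cover : setT `<=` H `|` [set p | sec_x p < delta].
  move=> p _ /=; have [x0|x0] := ltP 0 (sec_x p); [by left|right].
  by rewrite (le_lt_trans x0)// delta_gt0.
apply: (smooth_onSubset cover); apply: smooth_onU; last first.
  have Z : smooth_on [set p | sec_x p < delta] (fun=> 0 : R) := smooth_on_cst 0.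
  have E p : [set p | sec_x p < delta] p -> 0 = lift e k th p.
    by move=> pd; rewrite lift_eq0.
  exact: (smooth_on_eq (@open_sec_lt delta) E Z).
have Ser : smooth_on H (fun p => e * rho p) := smooth_onZ e oH smooth_on_rho.
have Sinv : smooth_on H (fun p => (e * rho p)^-1).
  apply: (smooth_on_comp1 oH smooth1_inv _ Ser) => p /rho_gt0 r_gt0 /=.
  by rewrite mulf_neq0 ?gt_eqF.
have Sth' := smooth_on_comp3 oH Sth
  (smooth_onB oH smooth_on_rho (@smooth_on_t R H)) smooth_on_ang
  (smooth_onZ e oH (@smooth_on_t R H)).
have E p : H p -> (e * rho p) ^+ k / (e * rho p) * th (rho p - p.2, ang p, e * p.2) =
    lift e k th p by move=> x0; rewrite /lift x0.
exact: (smooth_on_eq oH E (smooth_onM oH (smooth_onM oH (smooth_onX k oH Ser) Sinv) Sth')).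
Qed.

Lemma is_derive_lift k th p v : adm th ->
  is_derive p v (lift e k.+1 th)
    (lift e k.+1 (fun q => nvec v q.1.2 * 'D_(e3 R 0) th q - v.2 * 'D_(e3 R 0) th q) p
     + e * (lift e k.+1 (fun q => v.2 * 'D_(et R) th q) p
     + lift e k (fun q => k%:R * (nvec v q.1.2 * th q) + mvec v q.1.2 * 'D_(e3 R 1) th q) p)).
Proof.
move=> ath; have [Sth _] := ath.
have [x0|x0] := ltP 0 (sec_x p); last first.
  have lp0 j eta : lift e j eta p = 0 by rewrite /lift ltNge x0.
  rewrite !lp0 addr0 mulr0 addr0.
  apply: (near_eq_is_derive _ (is_derive_cst 0 p v)).
  apply: (@open_near _ _ _ p _ (@open_sec_lt delta)).
    by rewrite /= (le_lt_trans x0)// delta_gt0.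
  by move=> q qd; rewrite lift_eq0.
have r_gt0 := rho_gt0 x0; have r_neq0 : rho p != 0 by rewrite gt_eqF.
have e_neq0 : e != 0 by rewrite gt_eqF.
pose G q := (e * rho q) ^+ k * th (rho q - q.2, ang q, e * q.2).
apply: (@near_eq_is_derive _ _ _ G).
  apply: (open_near oH x0) => q /= qx; rewrite /lift qx /G exprSr mulfK//.
  by rewrite mulf_neq0// gt_eqF// rho_gt0.
have dr := is_derive_rho v x0.
have dt : is_derive p v (fun q : R * R * R => q.2) v.2.
  by apply: derivable_linear.
have d1 : is_derive p v (fun q => rho q - q.2) _ := is_deriveB dr dt.
have d3 : is_derive p v (fun q => e * q.2) _ := is_deriveZ e dt.
have dth := is_derive_comp3 Sth d1 (is_derive_ang v x0) d3.
have der := is_deriveX k (is_deriveZ e dr); rewrite exprfctE in der.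
have dG : is_derive p v G _ := is_deriveM der dth.
apply: (is_derive_eq dG); rewrite /lift x0 /GRing.scale/=.
rewrite exprSr mulfK ?mulf_neq0//.
rewrite -[e *: rho p]/(e * rho p).
exact: lift_algebra.
Qed.

End FixedScale.

Definition small (e : R) := 0 < e /\ e * r0 < t0.

Lemma lift_ext e k th th' p : th =1 th' -> lift e k th p = lift e k th' p.
Proof. by move=> E; rewrite /lift E. Qed.

Lemma lift_add e k th th' p :
  lift e k (fun q => th q + th' q) p = lift e k th p + lift e k th' p.
Proof. by rewrite /lift; case: ifP; rewrite ?addr0// mulrDr. Qed.

Lemma lift_scale e k (x : R) th p : lift e k (fun q => x * th q) p = x * lift e k th p.
Proof. by rewrite /lift; case: ifP; rewrite ?mulr0// mulrCA. Qed.

(** With [q.1.1 = rho - t] and [q.2 = e t] one has [e * rho = q.2 + e * q.1.1]: a power of [e * rho]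
    is traded for a factor on the profile. *)
Lemma lift_shift e k th p : lift e k.+1 th p =
  lift e k (fun q => q.2 * th q) p + e * lift e k (fun q => q.1.1 * th q) p.
Proof.
rewrite /lift; case: ifP => _ /=; last by rewrite mulr0 addr0.
rewrite exprS; ring.
Qed.

Lemma smooth_nvec v : smooth_on setT (fun q : R * R * R => nvec v q.1.2).
Proof.
have Sphi := @smooth_on_phi R setT.
have Sc : smooth_on setT (fun q : R * R * R => cos q.1.2) :=
  smooth_on_comp1 openT smooth1_cos (fun _ _ => I) Sphi.
have Ss : smooth_on setT (fun q : R * R * R => sin q.1.2) :=
  smooth_on_comp1 openT smooth1_sin (fun _ _ => I) Sphi.
exact: (smooth_onD openT
  (smooth_onM openT (smooth_onM openT Sc (smooth_on_cst b1^-1)) (smooth_on_cst v.1.1))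
  (smooth_onM openT (smooth_onM openT Ss (smooth_on_cst b2^-1)) (smooth_on_cst v.1.2))).
Qed.

Lemma smooth_mvec v : smooth_on setT (fun q : R * R * R => mvec v q.1.2).
Proof.
have Sphi := @smooth_on_phi R setT.
have Sc : smooth_on setT (fun q : R * R * R => cos q.1.2) :=
  smooth_on_comp1 openT smooth1_cos (fun _ _ => I) Sphi.
have Ss : smooth_on setT (fun q : R * R * R => sin q.1.2) :=
  smooth_on_comp1 openT smooth1_sin (fun _ _ => I) Sphi.
exact: (smooth_onB openT
  (smooth_onM openT (smooth_onM openT Sc (smooth_on_cst b2^-1)) (smooth_on_cst v.1.2))
  (smooth_onM openT (smooth_onM openT Ss (smooth_on_cst b1^-1)) (smooth_on_cst v.1.1))).
Qed.

(** The three parts of a derivative of a lift: [lead] acts through the fast variable, [slow] through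
    the slow time, and [curv] collects the derivatives of the power of [e * rho] and of the angle,
    which cost one power of [e * rho]. The last two carry a factor [e]. *)
Definition lead v th : R * R * R -> R :=
  fun q => nvec v q.1.2 * 'D_(e3 R 0) th q - v.2 * 'D_(e3 R 0) th q.

Definition slow v th : R * R * R -> R := fun q => v.2 * 'D_(et R) th q.

Definition curv v k th : R * R * R -> R :=
  fun q => k%:R * (nvec v q.1.2 * th q) + mvec v q.1.2 * 'D_(e3 R 1) th q.

Lemma adm_lead v th : adm th -> adm (lead v th).
Proof.
move=> ath; have aD := adm_D (e3 R 0) ath.
have := adm_add (adm_mul (smooth_nvec v) aD) (adm_scale (- v.2) aD).
by rewrite (_ : (fun q => _ + - v.2 * _) = lead v th)//; apply/funext => q; rewrite mulNr.
Qed.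

Lemma adm_slow v th : adm th -> adm (slow v th).
Proof. by move=> ath; exact: (adm_scale v.2 (adm_D (et R) ath)). Qed.

Lemma adm_curv v k th : adm th -> adm (curv v k th).
Proof.
move=> ath; exact: (adm_add (adm_scale k%:R (adm_mul (smooth_nvec v) ath))
  (adm_mul (smooth_mvec v) (adm_D (e3 R 1) ath))).
Qed.

Lemma D_lift e k th v p : small e -> adm th -> 'D_v (lift e k.+1 th) p =
  lift e k.+1 (lead v th) p + e * (lift e k.+1 (slow v th) p + lift e k (curv v k th) p).
Proof.
move=> [e_gt0 e_small] ath.
by have [_ ->] := is_derive_lift e_gt0 e_small k p v ath.
Qed.

(** The error terms: their pairings with the solution converge ([rem_cvg]), and a
    derivative lowers [m] by one because the exponent of [e * rho] drops. *)
Inductive rem (m : nat) : (R -> R * R * R -> R) -> Prop :=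
| rem_lift k th : (m <= k)%N -> adm th -> rem m (fun e => lift e k th)
| rem_add g h : rem m g -> rem m h -> rem m (fun e p => g e p + h e p)
| rem_scale x g : rem m g -> rem m (fun e p => x * g e p)
| rem_mul g : rem m g -> rem m (fun e p => e * g e p)
| rem_eq g h : rem m g -> (forall e, small e -> g e =1 h e) -> rem m h.

Lemma remW m g : rem m.+1 g -> rem m g.
Proof.
elim=> [k th mk ath|g' h _ IHg _ IHh|x g' _ IH|g' _ IH|g' h _ IH E].
- by apply: rem_lift => //; exact: ltnW.
- exact: rem_add.
- exact: rem_scale.
- exact: rem_mul.
- exact: rem_eq E.
Qed.

Lemma rem_smooth m g e : small e -> rem m g -> smooth_on setT (g e).
Proof.
move=> se; elim=> [k th mk ath|g' h _ IHg _ IHh|x g' _ IH|g' _ IH|g' h _ IH E].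
- by case: se => e_gt0 e_small; exact: smooth_on_lift.
- exact: (smooth_onD openT IHg IHh).
- exact: (smooth_onZ x openT IH).
- exact: (smooth_onZ e openT IH).
- by apply: (smooth_on_eq openT _ IH) => p _; exact: E.
Qed.

Lemma smooth_derivable (g : R * R * R -> R) p v : smooth_on setT g -> derivable g p v.
Proof. by move=> S; have [_ d _] := (smooth_onP _ _).1 S; exact: d. Qed.

Lemma rem_D m g v : rem m.+1 g -> rem m (fun e => 'D_v (g e)).
Proof.
elim=> [[//|k] th mk ath|g' h rg IHg rh IHh|x g' rg IH|g' rg IH|g' h _ IH E].
- have R1 : rem m (fun e => lift e k.+1 (lead v th)).
    by apply: rem_lift; [exact: ltnW|exact: adm_lead].
  have R2 : rem m (fun e => lift e k.+1 (slow v th)).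
    by apply: rem_lift; [exact: ltnW|exact: adm_slow].
  have R3 : rem m (fun e => lift e k (curv v k th)).
    by apply: rem_lift => //; exact: adm_curv.
  by apply: (rem_eq (rem_add R1 (rem_mul (rem_add R2 R3)))) => e se p; rewrite D_lift.
- apply: (rem_eq (rem_add IHg IHh)) => e se p.
  have dg := @smooth_derivable _ p v (rem_smooth se rg).
  have dh := @smooth_derivable _ p v (rem_smooth se rh).
  by rewrite -[RHS]/('D_v (g' e + h e) p) deriveD.
- apply: (rem_eq (rem_scale x IH)) => e se p.
  have dg := @smooth_derivable _ p v (rem_smooth se rg).
  by rewrite -[RHS]/('D_v (x \*: g' e) p) deriveZ.
- apply: (rem_eq (rem_mul IH)) => e se p.
  have dg := @smooth_derivable _ p v (rem_smooth se rg).
  by rewrite -[RHS]/('D_v (e \*: g' e) p) deriveZ.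
- by apply: (rem_eq IH) => e se p; rewrite (funext (E e se)).
Qed.

(** A first order expansion in [e]. The leading term keeps index [5] under differentiation, since at
    order one only the fast variable is differentiated; [m] counts the derivatives that the
    remainder still admits. *)
Definition expands m (g : R -> R * R * R -> R) th :=
  adm th /\ exists2 h, rem m h & forall e, small e -> forall p,
    g e p = lift e 5 th p + e * h e p.

Lemma expands_lift m th : (m <= 5)%N -> adm th -> expands m (fun e => lift e 5 th) th.
Proof.
move=> m5 ath; split=> //; exists (fun e p => 0 * lift e 5 th p).
  by apply: rem_scale; exact: rem_lift.
by move=> e _ p; rewrite mul0r mulr0 addr0.
Qed.

Lemma expandsW m g th : expands m.+1 g th -> expands m g th.
Proof. by move=> [ath [h rh E]]; split=> //; exists h => //; exact: remW. Qed.

Lemma expands_add m g g' th th' : expands m g th -> expands m g' th' ->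
  expands m (fun e p => g e p + g' e p) (fun q => th q + th' q).
Proof.
move=> [ath [h rh E]] [ath' [h' rh' E']]; split; first exact: adm_add.
exists (fun e p => h e p + h' e p); first exact: rem_add.
by move=> e se p; rewrite E// E'// lift_add; ring.
Qed.

Lemma expands_scale m g th x : expands m g th ->
  expands m (fun e p => x * g e p) (fun q => x * th q).
Proof.
move=> [ath [h rh E]]; split; first exact: adm_scale.
exists (fun e p => x * h e p); first exact: rem_scale.
by move=> e se p; rewrite E// lift_scale; ring.
Qed.

Lemma expands_sum m (g : 'I_2 -> R -> R * R * R -> R) (th : 'I_2 -> R * R * R -> R) :
  (forall i, expands m (g i) (th i)) ->
  expands m (fun e p => \sum_(i < 2) g i e p) (fun q => \sum_(i < 2) th i q).
Proof.
move=> H0; have := expands_add (H0 0) (H0 1).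
have -> : (fun (e : R) p => g 0 e p + g 1 e p) = (fun e p => \sum_(i < 2) g i e p).
  by apply/funext => e; apply/funext => p; rewrite sum_ord2.
suff -> : (fun q => th 0 q + th 1 q) = (fun q => \sum_(i < 2) th i q) by [].
by apply/funext => p; rewrite sum_ord2.
Qed.

Lemma expands_D m g th v : (m <= 4)%N -> expands m.+1 g th ->
  expands m (fun e => 'D_v (g e)) (lead v th).
Proof.
move=> m4 [ath [h rh E]]; split; first exact: adm_lead.
(* The new error term of index [4] is the reason for the bound [m <= 4]. *)
exists (fun e p => (lift e 5 (slow v th) p + lift e 4 (curv v 4 th) p) + 'D_v (h e) p).
  apply: rem_add; last exact: rem_D.
  apply: rem_add; first by apply: rem_lift; [exact: leqW|exact: adm_slow].
  by apply: rem_lift => //; exact: adm_curv.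
move=> e se p; have [e_gt0 e_small] := se.
have -> : g e = lift e 5 th + (e \*: h e) by apply/funext => q; exact: E.
have dl := @smooth_derivable _ p v (smooth_on_lift e_gt0 e_small 5 ath).
have dh := @smooth_derivable _ p v (rem_smooth se rh).
rewrite (deriveD dl (derivableZ dh)) (deriveZ e dh) (D_lift 4 v p se ath).
by rewrite -addrA -mulrDr.
Qed.

Lemma expands_D2 m g th u v : (m <= 3)%N -> expands m.+2 g th ->
  expands m (fun e => Dseq [:: u; v] (g e)) (lead u (lead v th)).
Proof.
move=> m3 Eg; have m4 : (m <= 4)%N by exact: leqW.
exact: (expands_D u m4 (expands_D v (m3 : (m.+1 <= 4)%N) Eg)).
Qed.

Lemma expands_op2 m g th (M : 'M[R]_2) : (m <= 3)%N -> expands m.+2 g th ->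
  expands m (fun e => op2 M (e3 R) (g e)) (fun q => \sum_(i < 2) \sum_(j < 2)
    M i j * lead (e3 R i) (lead (e3 R j) th) q).
Proof.
move=> m3 Eg; apply: expands_sum => i; apply: expands_sum => j.
by apply: expands_scale; exact: expands_D2.
Qed.

Lemma expands_op4 g th (K : 'I_2 -> 'I_2 -> 'I_2 -> 'I_2 -> R) : expands 4 g th ->
  expands 0 (fun e => op4 K (e3 R) (g e)) (fun q => \sum_(i < 2) \sum_(j < 2)
    \sum_(k < 2) \sum_(l < 2) K i j k l *
      lead (e3 R i) (lead (e3 R j) (lead (e3 R k) (lead (e3 R l) th))) q).
Proof.
move=> Eg; apply: expands_sum => i; apply: expands_sum => j.
apply: expands_sum => k; apply: expands_sum => l; apply: expands_scale.
exact: (@expands_D2 0 _ _ (e3 R i) (e3 R j) isT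
  (@expands_D2 2 g th (e3 R k) (e3 R l) isT Eg)).
Qed.

Lemma derive_phi (h dh : R -> R) th v q : (forall x : R, is_derive x 1 h (dh x)) -> adm th ->
  'D_v (fun q : R * R * R => h q.1.2 * th q) q =
  h q.1.2 * 'D_v th q + dh q.1.2 * v.1.2 * th q.
Proof.
move=> hd ath.
have d1 : is_derive q v (fun q : R * R * R => q.1.2) v.1.2 by apply: derivable_linear.
have dhq := @is_derive_comp1 R _ h _ q v _ _ (hd _) d1.
have dth := derivableP (@adm_der th q v ath).
have dm : is_derive q v (fun q : R * R * R => h q.1.2 * th q) _ := is_deriveM dhq dth.
by have [_ ->] := dm; rewrite /GRing.scale/= [th q * _]mulrC.
Qed.

Lemma is_derive_nvec v (x : R) : is_derive x 1 (nvec v) (mvec v x).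
Proof.
have dc : is_derive x 1 (fun x => cos x / b1 * v.1.1) _ :=
  is_deriveM (is_deriveM (is_derive_cos x) (is_derive_cst b1^-1 x 1)) (is_derive_cst v.1.1 x 1).
have ds : is_derive x 1 (fun x => sin x / b2 * v.1.2) _ :=
  is_deriveM (is_deriveM (is_derive_sin x) (is_derive_cst b2^-1 x 1)) (is_derive_cst v.1.2 x 1).
have d : is_derive x 1 (nvec v) _ := is_deriveD dc ds.
apply: (is_derive_eq d); rewrite /GRing.scale/= /mvec; ring.
Qed.

Lemma is_derive_mvec v (x : R) : is_derive x 1 (mvec v) (- nvec v x).
Proof.
have dc : is_derive x 1 (fun x => cos x / b2 * v.1.2) _ :=
  is_deriveM (is_deriveM (is_derive_cos x) (is_derive_cst b2^-1 x 1)) (is_derive_cst v.1.2 x 1).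
have ds : is_derive x 1 (fun x => sin x / b1 * v.1.1) _ :=
  is_deriveM (is_deriveM (is_derive_sin x) (is_derive_cst b1^-1 x 1)) (is_derive_cst v.1.1 x 1).
have d : is_derive x 1 (mvec v) _ := is_deriveB dc ds.
apply: (is_derive_eq d); rewrite /GRing.scale/= /nvec; ring.
Qed.

Let n i := nvec (e3 R i).
Let Dr := (fun th => 'D_(e3 R 0) th) : (R * R * R -> R) -> R * R * R -> R.

Lemma leadE i th q : lead (e3 R i) th q = n i q.1.2 * Dr th q.
Proof. by rewrite /lead mul0r subr0. Qed.

Lemma derivable_nvec v (x : R) : derivable (nvec v) x 1.
Proof. by have [d _] := is_derive_nvec v x; exact: d. Qed.

(** Coefficients depending on the angle alone commute with [Dr], so iterated spatial leading parts
    multiply out into products of the [n i]. *)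
Lemma lead_pull i th : adm th -> forall h : R -> R, (forall x : R, derivable h x 1) ->
  lead (e3 R i) (fun q => h q.1.2 * th q) =
  fun q => n i q.1.2 * h q.1.2 * Dr th q.
Proof.
move=> ath h dh; apply/funext => q; rewrite leadE.
have hd (x : R) : is_derive x 1 h ('D_1 h x) by exact: derivableP.
by rewrite /Dr (derive_phi _ _ hd ath) mulr0 mul0r addr0 mulrA.
Qed.

Lemma lead2E i j th q : adm th ->
  lead (e3 R i) (lead (e3 R j) th) q = n i q.1.2 * n j q.1.2 * Dr (Dr th) q.
Proof.
move=> ath; have -> : lead (e3 R j) th = fun q => n j q.1.2 * Dr th q.
  by apply/funext => q'; exact: leadE.
by rewrite lead_pull//; exact: adm_D.
Qed.

Lemma lead4E i j k l th q : adm th ->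
  lead (e3 R i) (lead (e3 R j) (lead (e3 R k) (lead (e3 R l) th))) q =
  n i q.1.2 * n j q.1.2 * n k q.1.2 * n l q.1.2 * Dr (Dr (Dr (Dr th))) q.
Proof.
move=> ath; have -> : lead (e3 R k) (lead (e3 R l) th) =
    fun q => (n k q.1.2 * n l q.1.2) * Dr (Dr th) q.
  by apply/funext => q'; rewrite lead2E.
have a2 : adm (Dr (Dr th)) by do 2 apply: adm_D.
have dkl (x : R) : derivable (fun x : R => n k x * n l x) x 1.
  by apply: derivableM; exact: derivable_nvec.
rewrite (@lead_pull j _ a2 (fun x => n k x * n l x))//.
rewrite (@lead_pull i _ (adm_D _ a2) (fun x => n j x * (n k x * n l x))).
  by rewrite !mulrA.
by move=> x; apply: derivableM; [exact: derivable_nvec|exact: dkl].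
Qed.

Let Dt := (fun th => 'D_(et R) th) : (R * R * R -> R) -> R * R * R -> R.

Lemma nvec_et x : nvec (et R) x = 0.
Proof. by rewrite /nvec /= !mulr0 addr0. Qed.

Lemma mvec_et x : mvec (et R) x = 0.
Proof. by rewrite /mvec /= !mulr0 subr0. Qed.

Lemma Dt_lift e k th p : small e -> adm th -> 'D_(et R) (lift e k.+1 th) p =
  - lift e k.+1 (Dr th) p + e * lift e k.+1 (Dt th) p.
Proof.
move=> se ath; rewrite D_lift//.
rewrite (@lift_ext _ _ (lead (et R) th) (fun q => -1 * Dr th q)); last first.
  by move=> q; rewrite /lead nvec_et mul0r sub0r mulN1r mul1r.
rewrite lift_scale mulN1r (@lift_ext _ _ (slow (et R) th) (Dt th)); last first.
  by move=> q; rewrite /slow mul1r.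
rewrite (@lift_ext _ _ (curv (et R) k th) (fun q => 0 * th q)); last first.
  by move=> q; rewrite /curv nvec_et mvec_et !mul0r mulr0 addr0.
by rewrite lift_scale mul0r addr0.
Qed.

Lemma Dtt_lift e k th p : small e -> adm th -> Dseq [:: et R; et R] (lift e k.+1 th) p =
  lift e k.+1 (Dr (Dr th)) p - 2 * e * lift e k.+1 (Dr (Dt th)) p
  + e ^+ 2 * lift e k.+1 (Dt (Dt th)) p.
Proof.
move=> se ath /=.
have ar := adm_D (e3 R 0) ath; have at_ := adm_D (et R) ath.
have [e_gt0 e_small] := se.
rewrite (_ : (fun x => 'D_(et R) (lift e k.+1 th) x) =
   (- lift e k.+1 (Dr th)) + (e \*: lift e k.+1 (Dt th))); last first.
  by apply/funext => q; rewrite Dt_lift.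
have d1 := @smooth_derivable _ p (et R) (smooth_on_lift e_gt0 e_small k.+1 ar).
have d2 := @smooth_derivable _ p (et R) (smooth_on_lift e_gt0 e_small k.+1 at_).
rewrite (deriveD (derivableN d1) (derivableZ d2)) (deriveN d1) (deriveZ e d2) !Dt_lift//.
have [Sth _] := ath.
(* The two cross terms agree by symmetry of second derivatives and combine into the coefficient
   [- 2 e]. *)
have sw : lift e k.+1 (Dt ('D_(e3 R 0) th)) p = lift e k.+1 (Dr ('D_(et R) th)) p.
  by apply: lift_ext => q; exact: (Schwarz (e3 R 0) (et R) openT Sth (I : setT q)).
have alg (x y y' z : R) : y' = y ->
    - (- x + e * y') + e * (- y + e * z) = x - 2 * e * y + e ^+ 2 * z.
  by move=> ->; ring.
exact: alg sw.
Qed.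

Lemma lead_curv i k th q : adm th ->
  lead (e3 R i) (curv (e3 R i) k th) q = n i q.1.2 * (k%:R * (n i q.1.2 * Dr th q)
     + mvec (e3 R i) q.1.2 * Dr ('D_(e3 R 1) th) q).
Proof.
move=> ath; rewrite leadE; congr (_ * _).
have a1 := adm_mul (smooth_nvec (e3 R i)) ath.
have aphi := adm_D (e3 R 1) ath.
have a2 := adm_mul (smooth_mvec (e3 R i)) aphi.
have d1 := @adm_der _ q (e3 R 0) a1; have d2 := @adm_der _ q (e3 R 0) a2.
rewrite /Dr -[curv _ _ _]/((k%:R \*: (fun q => nvec (e3 R i) q.1.2 * th q)) +
   (fun q => mvec (e3 R i) q.1.2 * 'D_(e3 R 1) th q)).
rewrite (deriveD (derivableZ d1) d2) (deriveZ _ d1).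
rewrite (derive_phi (e3 R 0) q (is_derive_nvec (e3 R i)) ath).
rewrite (derive_phi (e3 R 0) q (is_derive_mvec (e3 R i)) aphi) !mulr0 !mul0r !addr0.
by [].
Qed.

(** Compared with [lead_curv], the angular derivative also meets the factor [n i], whose derivative
    is the corresponding [mvec]. This extra square of [mvec] is the [+ 1] in the radial coefficient
    of [op2_lift]. *)
Lemma curv_lead i k th q : adm th ->
  curv (e3 R i) k (lead (e3 R i) th) q = k%:R * (n i q.1.2 ^+ 2 * Dr th q)
  + mvec (e3 R i) q.1.2 * (n i q.1.2 * Dr ('D_(e3 R 1) th) q
       + mvec (e3 R i) q.1.2 * (e3 R 1).1.2 * Dr th q).
Proof.
move=> ath; have ar := adm_D (e3 R 0) ath; have [Sth _] := ath.
rewrite /curv leadE; congr (_ + _ * _); first by rewrite expr2 -mulrA.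
rewrite (_ : lead (e3 R i) th = fun q => nvec (e3 R i) q.1.2 * Dr th q); last first.
  by apply/funext => q'; exact: leadE.
have alg (x y y' z : R) : y = y' -> x * y + z = x * y' + z by move=> ->.
exact: (etrans (derive_phi (e3 R 1) q (is_derive_nvec (e3 R i)) ar)
  (alg _ _ _ _ (Schwarz (e3 R 0) (e3 R 1) openT Sth (I : setT q)))).
Qed.

Lemma lead_et th : adm th -> lead (et R) (lead (et R) th) = Dr (Dr th).
Proof.
move=> ath; have ar := adm_D (e3 R 0) ath.
have E eta : lead (et R) eta = -1 \*: Dr eta.
  by apply/funext => q; rewrite /lead nvec_et mul0r sub0r mul1r; exact/esym/mulN1r.
apply/funext => q; rewrite E [lead _ th]E.
have d := @adm_der _ q (e3 R 0) ar.
have alg (x y : R) : x = -1 * y -> -1 * x = y by move=> ->; ring.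
by apply: alg; exact: (deriveZ (-1) d).
Qed.

(** Kept exact to second order, unlike the expansions in [expands]: [AD^2] enters the wave equation
    without a factor [e], so its term of order [e] survives in the limit, whereas only the leading
    profiles of the [E] and [F] terms do. *)
Lemma Dxx_lift e k th i p : small e -> adm th ->
  Dseq [:: e3 R i; e3 R i] (lift e k.+2 th) p =
  lift e k.+2 (lead (e3 R i) (lead (e3 R i) th)) p
  + e * lift e k.+1 (fun q => curv (e3 R i) k.+1 (lead (e3 R i) th) q
       + lead (e3 R i) (curv (e3 R i) k.+1 th) q) p
  + e ^+ 2 * lift e k (curv (e3 R i) k (curv (e3 R i) k.+1 th)) p.
Proof.
move=> se ath /=; have [e_gt0 e_small] := se.
have D1 j eta q : adm eta -> 'D_(e3 R i) (lift e j.+1 eta) q =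
    lift e j.+1 (lead (e3 R i) eta) q + e * lift e j (curv (e3 R i) j eta) q.
  move=> aeta; rewrite D_lift//.
  rewrite (@lift_ext _ _ (slow (e3 R i) eta) (fun q => 0 * eta q)); last first.
    by move=> q'; rewrite /slow /= !mul0r.
  by rewrite lift_scale mul0r add0r.
have al := adm_lead (e3 R i) ath; have ac := adm_curv (e3 R i) k.+1 ath.
rewrite (_ : (fun x => 'D_(e3 R i) (lift e k.+2 th) x) =
   lift e k.+2 (lead (e3 R i) th) + (e \*: lift e k.+1 (curv (e3 R i) k.+1 th))); last first.
  by apply/funext => q; rewrite D1.
have d1 := @smooth_derivable _ p (e3 R i) (smooth_on_lift e_gt0 e_small k.+2 al).
have d2 := @smooth_derivable _ p (e3 R i) (smooth_on_lift e_gt0 e_small k.+1 ac).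
rewrite (deriveD d1 (derivableZ d2)) (deriveZ e d2) D1// D1// lift_add.
have alg (x y z w : R) : x + e * y + e * (z + e * w) = x + e * (y + z) + e ^+ 2 * w by ring.
exact: alg.
Qed.

Context (a : 'I_2 -> R) (b1a : b1 ^+ 2 = a 0) (b2a : b2 ^+ 2 = a 1).
Let m i := mvec (e3 R i).

(** This identity and the next two say that [n] and [m], the radial and angular directions, are
    orthonormal for the form [A]; elliptic coordinates are chosen for this. *)
Let sum_nn x : a 0 * (n 0 x * n 0 x) + a 1 * (n 1 x * n 1 x) = 1.
Proof.
rewrite -(cos2Dsin2 x) -b1a -b2a /n /nvec /=; field.
by rewrite !gt_eqF.
Qed.

Let sum_nm x : a 0 * (n 0 x * m 0 x) + a 1 * (n 1 x * m 1 x) = 0.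
Proof.
rewrite -b1a -b2a /n /m /nvec /mvec /=; field.
by rewrite !gt_eqF.
Qed.

Let sum_mm x : a 0 * (m 0 x * m 0 x) + a 1 * (m 1 x * m 1 x) = 1.
Proof.
rewrite -(cos2Dsin2 x) -b1a -b2a /m /mvec /=; field.
by rewrite !gt_eqF.
Qed.

(** In elliptic polar coordinates the operator is the Laplacian, whose radial part
    maps [rho^m g] to [rho^m g'' + (2 m + 1) rho^(m-1) g' + ...]; here [m = k + 1]. *)
Lemma op2_lift e k th p : small e -> adm th ->
  op2 (diag_mx (\row_i a i)) (e3 R) (lift e k.+2 th) p =
  lift e k.+2 (Dr (Dr th)) p + e * ((k.+1).*2.+1%:R * lift e k.+1 (Dr th) p)
  + e ^+ 2 * (a 0 * lift e k (curv (e3 R 0) k (curv (e3 R 0) k.+1 th)) p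
            + a 1 * lift e k (curv (e3 R 1) k (curv (e3 R 1) k.+1 th)) p).
Proof.
move=> se ath; rewrite op2_diag (Dxx_lift _ 0 _ se ath) (Dxx_lift _ 1 _ se ath).
have alg (a0 a1 x0 x1 y0 y1 z0 z1 X Y : R) : a0 * x0 + a1 * x1 = X ->
    a0 * y0 + a1 * y1 = Y ->
    a0 * (x0 + e * y0 + e ^+ 2 * z0) + a1 * (x1 + e * y1 + e ^+ 2 * z1) =
    X + e * Y + e ^+ 2 * (a0 * z0 + a1 * z1) by move=> <- <-; ring.
apply: alg.
  rewrite -!lift_scale -lift_add; apply: lift_ext => q; rewrite !lead2E//.
  rewrite !mulrA -mulrDl -[RHS]mul1r -(sum_nn q.1.2) !mulrA//.
rewrite -!lift_scale -lift_add; apply: lift_ext => q.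
rewrite !curv_lead// !lead_curv//=.
have alg2 (a0 a1 n0 n1 m0 m1 D E K : R) : a0 * (n0 * n0) + a1 * (n1 * n1) = 1 ->
    a0 * (n0 * m0) + a1 * (n1 * m1) = 0 -> a0 * (m0 * m0) + a1 * (m1 * m1) = 1 ->
    a0 * (K * (n0 ^+ 2 * D) + m0 * (n0 * E + m0 * 1 * D) + n0 * (K * (n0 * D) + m0 * E))
    + a1 * (K * (n1 ^+ 2 * D) + m1 * (n1 * E + m1 * 1 * D) + n1 * (K * (n1 * D) + m1 * E))
    = (2 * K + 1) * D.
  move=> nn nm mm; transitivity (2 * K * (a0 * (n0 * n0) + a1 * (n1 * n1)) * D
    + (a0 * (m0 * m0) + a1 * (m1 * m1)) * D + 2 * E * (a0 * (n0 * m0) + a1 * (n1 * m1))).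
    ring.
  by rewrite nn nm mm; ring.
have -> : (k.+1).*2.+1%:R = 2 * k.+1%:R + 1 :> R by rewrite -natr1 -muln2 natrM mulrC.
exact: (alg2 _ _ _ _ _ _ _ _ _ (sum_nn q.1.2) (sum_nm q.1.2) (sum_mm q.1.2)).
Qed.

(** In the [E] term [d_t^2] acts as [Dr^2] to leading order, so the symbols of [E] and [F] multiply
    the same [Dr^4 th] and only their difference [kap] remains. The [9] is [2 * 4 + 1], from the
    exponent [4] of [e * rho], and comes with index [4]. *)
Lemma wave_expansion (E : 'M[R]_2) (F : 'I_2 -> 'I_2 -> 'I_2 -> 'I_2 -> R)
    (kap : R -> R) th : adm th ->
  (forall x, \sum_(i < 2) \sum_(j < 2) \sum_(k < 2) \sum_(l < 2)
      F i j k l * (n i x * n j x * n k x * n l x)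
    - \sum_(i < 2) \sum_(j < 2) E i j * (n i x * n j x) = kap x) ->
  smooth_on setT (fun q : R * R * R => kap q.1.2) ->
  exists2 h, rem 0 h & forall e, small e -> forall p,
    Dseq [:: et R; et R] (lift e 5 th) p
    - op2 (diag_mx (\row_i a i)) (e3 R) (lift e 5 th) p
    - e * op2 E (e3 R) (Dseq [:: et R; et R] (lift e 5 th)) p
    + e * op4 F (e3 R) (lift e 5 th) p
    = e * (lift e 5 (fun q => - 2 * Dr (Dt th) q + kap q.1.2 * Dr (Dr (Dr (Dr th))) q) p
       + lift e 4 (fun q => - 9 * Dr th q) p + e * h e p).
Proof.
move=> ath kapE Skap.
have att : adm (Dt (Dt th)) := adm_D (et R) (adm_D (et R) ath).
have arr : adm (Dr (Dr th)) := adm_D (e3 R 0) (adm_D (e3 R 0) ath).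
have E5 : expands 5 (fun e => lift e 5 th) th by exact: expands_lift.
have [_ [hF rF EF]] := expands_op4 F (expandsW E5).
have Ett : expands 3 (fun e => Dseq [:: et R; et R] (lift e 5 th)) (lead (et R) (lead (et R) th)).
  exact: (@expands_D2 3 _ _ _ _ isT E5).
rewrite lead_et// in Ett.
have [_ [hE rE EE]] := @expands_op2 0 _ _ E isT (expandsW Ett).
(* The second order term of [AD^2]: two powers of [e * rho] are lost. *)
pose X e p := a 0 * lift e 3 (curv (e3 R 0) 3 (curv (e3 R 0) 4 th)) p
            + a 1 * lift e 3 (curv (e3 R 1) 3 (curv (e3 R 1) 4 th)) p.
have rX : rem 0 X.
  by apply: rem_add; apply: rem_scale; apply: rem_lift => //; do 2 apply: adm_curv.
exists (fun e p => lift e 5 (Dt (Dt th)) p + (-1 * X e p + (-1 * hE e p + hF e p))).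
  apply: rem_add; first exact: rem_lift.
  by apply: rem_add; [exact: rem_scale|apply: rem_add => //; exact: rem_scale].
move=> e se p; rewrite (Dtt_lift 4 p se ath) (op2_lift 3 p se ath) (EF e se) (EE e se).
set lE := lift e 5 (fun q => \sum_(i < 2) \sum_(j < 2) _ * _) p.
set lF := lift e 5 (fun q => \sum_(i < 2) _) p.
have HL : lF - lE = lift e 5 (fun q => kap q.1.2 * Dr (Dr (Dr (Dr th))) q) p.
  rewrite -[- lE]mulN1r -lift_scale -lift_add; apply: lift_ext => q.
  rewrite -kapE mulN1r mulrBl; congr (_ - _).
    rewrite mulr_suml; apply: eq_bigr => i _; rewrite mulr_suml; apply: eq_bigr => j _.
    rewrite mulr_suml; apply: eq_bigr => k _; rewrite mulr_suml; apply: eq_bigr => l _.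
    by rewrite (lead4E i j k l q ath) (mulrA (F i j k l)).
  rewrite mulr_suml; apply: eq_bigr => i _; rewrite mulr_suml; apply: eq_bigr => j _.
  by rewrite (lead2E i j q arr) (mulrA (E i j)).
have HA : lift e 5 (fun q => - 2 * Dr (Dt th) q + kap q.1.2 * Dr (Dr (Dr (Dr th))) q) p
    = - 2 * lift e 5 (Dr (Dt th)) p + (lF - lE).
  exact: (etrans (lift_add e 5 (fun q => - 2 * Dr (Dt th) q) _ p)
    (f_equal2 +%R (lift_scale e 5 (- 2) (Dr (Dt th)) p) (esym HL))).
have alg (x y z u w hE' hF' lE' lF' A B : R) : A = - 2 * y + (lF' - lE') -> B = - 9 * u ->
  x - 2 * e * y + e ^+ 2 * z - (x + e * (9%:R * u) + e ^+ 2 * w) - e * (lE' + e * hE')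
   + e * (lF' + e * hF') = e * (A + B + e * (z + (-1 * w + (-1 * hE' + hF')))).
  by move=> -> ->; ring.
exact: (alg _ _ _ _ _ _ _ _ _ _ _ HA (lift_scale e 4 (- 9) (Dr th) p)).
Qed.

End Sector.

(** * Integrability *)

Section Integrability.
Context {R : realType}.
Local Notation leb := (@lebesgue_measure R).

Lemma Hm_bounded_sqr_integral m (M : R) (u : R * R -> R) : 0 <= M -> Hm_bounded m M u ->
  measurable_fun setT u /\ (\int[leb2 R]_x ((u x) ^+ 2)%:E <= (M ^+ 2)%:E)%E.
Proof.
move=> M0 [g [g0 gL _]]; have [uL uM] := gL [::] (leq0n _); rewrite g0 in uL uM.
split; first by have := uL; rewrite inE => /andP[]; rewrite inE.
have <- : (('N[leb2 R]_2%:E [EFin \o u]) `^ 2 = \int[leb2 R]_x ((u x) ^+ 2)%:E)%E.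
  rewrite poweR_Lnorm//; apply: eq_integral => x _ /=.
  by rewrite powR_mulrn// real_normK// num_real.
apply: (@le_trans _ _ (M%:E `^ 2)%E).
  by apply: gt0_ler_poweR => //; rewrite in_itv/= leey ?Lnorm_ge0 ?lee_fin ?M0.
by rewrite poweR_EFin powR_mulrn.
Qed.

Lemma measurable_pos_time : measurable [set p : R * R * R | 0 < p.2].
Proof.
rewrite (_ : [set p | _] = setT `*` `]0, +oo[%classic); first exact: measurableX.
by apply/seteqP; split=> p /=; rewrite in_itv/= andbT// => -[].
Qed.

(** Since [|w| <= 1 + w^2], the product is dominated on almost every time slice by
    [B * (\1_S + w^2)], whose integral is bounded uniformly in time; Tonelli's theorem over the
    bounded interval []0, tau[] concludes. *)
Lemma integrable_Linfty_Hm (tau X B : R) m (w g : R * R * R -> R) :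
  Linfty_Hm tau m w -> measurable_fun setT g ->
  (forall p, `|g p| <= B) ->
  (forall p, g p != 0 -> [/\ `|p.1.1| <= X, `|p.1.2| <= X & 0 < p.2 < tau]) ->
  (leb3 R).-integrable [set p | 0 < p.2] (fun p => (w p * g p)%:E).
Proof.
move=> [mw [M0 hM]] mg gB gsupp.
(* The given bound has no prescribed sign; squaring the norm estimate requires a nonnegative one. *)
have [M M_ge0 {}hM] : exists2 M, 0 <= M & {ae leb, forall t, 0 < t < tau ->
    Hm_bounded m M (fun x => w (x, t))}.
  exists `|M0| => //; case: hM => N [mN N0 NS]; exists N; split=> //.
  apply: subset_trans NS; apply: subsetC => t /= H /H [h [h0 hL hd]].
  exists h; split=> // s sm; have [? hLM] := hL s sm; split=> //.
  by rewrite (le_trans hLM)// lee_fin ler_norm.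
have B_ge0 : 0 <= B by apply: le_trans (gB 0).
(* [w] is measurable only on the time strip; the truncation is measurable everywhere and agrees with
   [w] where [g] does not vanish. *)
pose w' (p : R * R * R) := if 0 < p.2 < tau then w p else 0.
have mcond : measurable_fun setT (fun p : R * R * R => 0 < p.2 < tau).
  by apply: measurable_and; apply: measurable_fun_ltr.
have mw' : measurable_fun setT w'.
  apply: measurable_fun_if => //.
  by rewrite setTI (_ : _ @^-1` _ = [set p : R * R * R | 0 < p.2 < tau]).
have mf : measurable_fun setT (fun p => w' p * g p) by exact: measurable_funM.
have mD := measurable_pos_time.
apply: (@eq_integrable _ _ R (leb3 R) [set p | 0 < p.2] mD (fun p => (w' p * g p)%:E)).
  move=> p _ /=; rewrite /w'; case: ifPn => // np; have [->|/gsupp[_ _]] := eqVneq (g p) 0.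
    by rewrite !mulr0.
  by rewrite (negbTE np).
apply: (@integrableS _ _ R (leb3 R) setT _ _ measurableT mD) => //.
apply/integrableP; split; first exact/measurable_EFinP.
have mabs : measurable_fun setT (fun p : R * R * R => `|(w' p * g p)%:E|%E).
  by apply: measurableT_comp => //; exact/measurable_EFinP.
rewrite (tonelli3 mabs)//.
pose S : set (R * R) := `[- X, X]%classic `*` `[- X, X]%classic.
have mS : measurable S by exact: measurableX.
have Sfin : (leb2 R S < +oo)%E.
  rewrite product_measure1E; [|exact: measurable_itv|exact: measurable_itv].
  rewrite /= lebesgue_measure_itv /=; case: ifP => _; last by rewrite mule0 ltry.
  by rewrite -EFinB -EFinM ltry.
pose C : \bar R := (B%:E * leb2 R S + B%:E * (M ^+ 2)%:E)%E.
have C_ge0 : (0 <= C)%E.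
  by rewrite adde_ge0// mule_ge0// lee_fin// sqr_ge0.
have Cfin : (C < +oo)%E.
  rewrite /C -(EFinM B (M ^+ 2)) lte_add_pinfty ?ltry//.
  by apply: lte_mul_pinfty => //; rewrite lee_fin.
have mh : measurable_fun setT (fun s : R => \int[leb2 R]_x `|(w' (x, s) * g (x, s))%:E|)%E.
  exact: (@measurable_fun_fubini_tonelli_G _ _ (measurableTypeR R * measurableTypeR R)%type
    (measurableTypeR R) R (@plane_measure R) _ mabs (fun=> abse_ge0 _)).
apply: (@le_lt_trans _ _ (\int[leb]_s (if (0 < s < tau)%R then C else 0))%E).
  apply: ae_ge0_le_integral => //.
  - by move=> s _; apply: integral_ge0.
  - by move=> s _; case: ifP.
  - by apply: measurable_fun_if0 => //; apply: measurable_and; apply: measurable_fun_ltr.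
  case: hM => N [mN N0 NS]; exists N; split=> //.
  apply: subset_trans NS; apply: subsetC => s /= Hs _; case: ifPn => [st|nst]; last first.
    by rewrite integral0_eq// => x _; rewrite /w'/= (negbTE nst) mul0r normr0.
  have [mws ws2] := Hm_bounded_sqr_integral M_ge0 (Hs st).
  have mw2 : measurable_fun setT (fun x => (B * (w (x, s)) ^+ 2)%:E).
    by apply/measurable_EFinP; apply: measurable_funM => //; exact: measurable_funX.
  have mind : measurable_fun setT (fun x => (B * \1_S x)%:E).
    by apply/measurable_EFinP; apply: measurable_funM => //; exact: measurable_indic.
  apply: (@le_trans _ _ (\int[leb2 R]_x ((B * \1_S x)%:E + (B * (w (x, s)) ^+ 2)%:E))%E).
    apply: ge0_le_integral => //.
    - exact: (measurable_fun_pair1 s mabs).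
    - exact: emeasurable_funD.
    move=> x _; rewrite /w'/= st -EFinD lee_fin normrM -mulrDr mulrC.
    have [->|gx] := eqVneq (g (x, s)) 0.
      by rewrite normr0 mul0r mulr_ge0// addr_ge0// sqr_ge0.
    have [x1 x2 _] := gsupp _ gx; rewrite ler_pM// indicE mem_set/=; last first.
      by rewrite /S/= !in_itv/= -!ler_norml.
    have := sqr_ge0 (`|w (x, s)| - 1); rewrite sqrrB expr1n mulr1 real_normK ?num_real//.
    have := normr_ge0 (w (x, s)); set a := `|_|; set b := w _ ^+ 2; lra.
  rewrite ge0_integralD//; last 2 first.
  - by move=> x _; rewrite lee_fin mulr_ge0.
  - by move=> x _; rewrite lee_fin mulr_ge0// sqr_ge0.
  rewrite /C leeD//.
    under eq_integral do rewrite EFinM.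
    rewrite ge0_integralZl//; last by apply/measurable_EFinP; exact: measurable_indic.
    by rewrite integral_indic// setIT.
  under eq_integral do rewrite EFinM.
  rewrite ge0_integralZl//.
  - by apply: lee_wpmul2l => //; rewrite lee_fin.
  - by apply/measurable_EFinP; exact: measurable_funX.
  - by move=> x _; rewrite lee_fin sqr_ge0.
rewrite (_ : (fun s => _) = (cst C \_ `]0, tau[%classic)); last first.
  by apply/funext => s; rewrite patchE mem_setE in_itv.
rewrite -integral_mkcond integral_cst//= lebesgue_measure_itv/=.
case: ifP => _; last by rewrite mule0 ltry.
by rewrite -EFinB; apply: lte_mul_pinfty; rewrite ?ge0_fin_numE ?ltry.
Qed.

End Integrability.

(** * The limit of the wave equation in a sector *)

Section CompactSupport.
Context {R : realType}.
Implicit Types (p q : R * R * R) (g : R * R * R -> R).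

Lemma smooth_continuous (V : normedModType R) (h : V -> R) : smooth_on setT h -> continuous h.
Proof. by move=> S x; exact: (C_on_cont (S 0%N) I). Qed.

Lemma continuous_normf (T : topologicalType) (h : T -> R) : continuous h ->
  continuous (fun x => `|h x|).
Proof. by move=> ch x; apply: continuous_comp; [exact: ch|exact: norm_continuous]. Qed.

Lemma compact_ub (T : topologicalType) (K : set T) (h : T -> R) : compact K -> continuous h ->
  exists M, forall x, K x -> h x <= M.
Proof.
move=> cK ch; have [->|K0] := eqVneq K set0; first by exists 0.
have [x _ xM] := compact_EVT_max ((set0P _).1 K0) cK (continuous_subspaceT ch).
by exists (h x) => y Ky; apply: xM; rewrite inE.
Qed.

Definition cube (X : R) : set (R * R * R) :=
  [set p | [/\ `|p.1.1| <= X, `|p.1.2| <= X & `|p.2| <= X]].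

Lemma compact_cube X : compact (cube X).
Proof.
have -> : cube X = (`[- X, X]%classic `*` `[- X, X]%classic) `*` `[- X, X]%classic.
  by apply/seteqP; split=> p; rewrite /cube/= !in_itv/= -!ler_norml; [move=> []|move=> [[]]].
by apply: compact_setX; [apply: compact_setX|]; exact: segment_compact.
Qed.

Lemma closed_cube X : closed (cube X).
Proof. exact: (compact_closed (@norm_hausdorff _ _) (@compact_cube X)). Qed.

Lemma bounded_of_cube X g : continuous g -> (forall p, g p != 0 -> cube X p) ->
  exists B, forall p, `|g p| <= B.
Proof.
move=> cg gX; have [B gB] := compact_ub (@compact_cube X) (continuous_normf cg); exists (Num.max B 0) => p.
have [->|/gX Xp] := eqVneq (g p) 0; first by rewrite normr0 le_max lexx orbT.
by rewrite le_max gB.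
Qed.

Lemma test_fun_of_cube X (K Omega : set (R * R * R)) g : smooth_on setT g -> closed K ->
  K `<=` cube X -> K `<=` Omega -> (forall p, g p != 0 -> K p) -> test_fun Omega g.
Proof.
move=> Sg cK KX KO gK; have sK : supp g `<=` K by rewrite (closure_id K).1//; exact: closure_subset.
split=> //; last exact: subset_trans KO.
by apply: (subclosed_compact _ (@compact_cube X)); [exact: closed_closure|exact: subset_trans KX].
Qed.

Lemma test_fun_cubeP (Omega : set (R * R * R)) g : test_fun Omega g ->
  exists2 X, 0 <= X & forall p, g p != 0 -> cube X p.
Proof.
move=> [_ cS _].
have n1 := continuous_normf (smooth_continuous (@smooth_on_r R setT)).
have n2 := continuous_normf (smooth_continuous (@smooth_on_phi R setT)).
have n3 := continuous_normf (smooth_continuous (@smooth_on_t R setT)).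
have [X1 h1] := compact_ub cS n1; have [X2 h2] := compact_ub cS n2.
have [X3 h3] := compact_ub cS n3.
exists (`|X1| + `|X2| + `|X3|) => [|p gp]; first by rewrite !addr_ge0.
have Sp : supp g p by exact: subset_closure.
have := h1 _ Sp; have := h2 _ Sp; have := h3 _ Sp.
have := ler_norm X1; have := ler_norm X2; have := ler_norm X3.
have := normr_ge0 X1; have := normr_ge0 X2; have := normr_ge0 X3.
by move=> *; split; lra.
Qed.

Lemma test_fun_timeP (T : R) g : 0 < T -> test_fun [set p : R * R * R | 0 < p.2 < T] g ->
  exists t0 t1, [/\ 0 < t0, t1 < T & forall p, g p != 0 -> t0 <= p.2 <= t1].
Proof.
move=> T_gt0 [_ cS SO]; have ct : continuous (fun p : R * R * R => p.2).
  exact: smooth_continuous (@smooth_on_t R setT).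
have [S0|S0] := eqVneq (supp g) set0.
  exists (T / 2), (T / 2); split; [lra|lra|move=> p gp].
  by have : supp g p by [exact: subset_closure]; rewrite S0.
have [x /set_mem xS xm] := compact_EVT_min ((set0P _).1 S0) cS (continuous_subspaceT ct).
have [y /set_mem yS ym] := compact_EVT_max ((set0P _).1 S0) cS (continuous_subspaceT ct).
exists x.2, y.2; split.
- by have /andP[] := SO _ xS.
- by have /andP[] := SO _ yS.
move=> p gp; have /mem_set Sp : supp g p by exact: subset_closure.
by rewrite xm ?ym.
Qed.

(** Smoothness is asked of the product, so that [h] may have a pole off the support of [g], as
    inverse powers of time do. *)
Lemma test_funM (Omega : set (R * R * R)) (h g : R * R * R -> R) :
  smooth_on setT (fun p => h p * g p) -> test_fun Omega g -> test_fun Omega (fun p => h p * g p).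
Proof.
move=> Sh [Sg cS SO].
have sub : supp (fun p => h p * g p) `<=` supp g.
  by apply: closure_subset => p /=; apply: contra_neq => ->; rewrite mulr0.
split=> //; last exact: subset_trans SO.
exact: (subclosed_compact (@closed_closure _ _) cS sub).
Qed.

Lemma supp_D v g : supp ('D_v g) `<=` supp g.
Proof.
rewrite [X in _ `<=` X](closure_id (supp g)).1; last exact: closed_closure.
apply: closure_subset => p /=; apply: contra_neqP => np.
rewrite -(derive_cst (0 : R) p v); apply: near_eq_derive.
have oS : open (~` supp g) by apply: closed_openC; exact: closed_closure.
apply: (open_near oS np) => q nq; apply/eqP/negPn/negP => gq.
by apply: nq; exact: subset_closure.
Qed.

Lemma test_fun_D (Omega : set (R * R * R)) v g : test_fun Omega g -> test_fun Omega ('D_v g).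
Proof.
move=> [Sg cS SO]; have [_ _ SD] := (smooth_onP _ _).1 Sg.
split; [exact: SD| |exact: subset_trans (@supp_D v g) SO].
exact: (subclosed_compact (@closed_closure _ _) cS (@supp_D v g)).
Qed.

End CompactSupport.

Lemma liftE (R : realType) (b1 b2 c e : R) k th p : lift b1 b2 c e k th p =
  if 0 < sec_x b1 b2 c p then (e * rho b1 b2 p) ^+ k / (e * rho b1 b2 p) *
    th (rho b1 b2 p - p.2, ang b1 b2 c p, e * p.2) else 0.
Proof. by []. Qed.

(** * Limits of the pairings of the solution with lifted profiles *)

Section ScalingLimit.
Context {R : realType} (b1 b2 c : R) (b1_gt0 : 0 < b1) (b2_gt0 : 0 < b2).
Context (r0 t0 t1 : R) (t0_gt0 : (0 : R) < t0).
Local Notation lift := (lift b1 b2 c).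
Local Notation adm := (adm c r0 t0 t1).
Local Notation rem := (rem b1 b2 c r0 t0 t1).
Local Notation small := (small r0 t0).
Implicit Types (p q : R * R * R) (th : R * R * R -> R) (g : R -> R * R * R -> R).

Lemma rem_neq0 m g e p : small e -> rem m g -> g e p != 0 ->
  [/\ 0 < sec_x b1 b2 c p, t0 / e <= p.2 <= t1 / e & rho b1 b2 p <= t1 / e + r0].
Proof.
move=> se; elim=> [k th mk ath|g1 g2 _ IH1 _ IH2|x g1 _ IH|g1 _ IH|g1 g2 _ IH E].
- by case: se => e_gt0 e_small; exact: lift_neq0.
- by have [->|/IH1//] := eqVneq (g1 e p) 0; rewrite add0r.
- by have [->|/IH//] := eqVneq (g1 e p) 0; rewrite mulr0 eqxx.
- by have [->|/IH//] := eqVneq (g1 e p) 0; rewrite mulr0 eqxx.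
- by rewrite -E.
Qed.

Lemma rem_cube m g e : small e -> rem m g -> exists X, forall p, g e p != 0 -> cube X p.
Proof.
move=> se rg; exists ((b1 + b2) * `|t1 / e + r0| + `|t0 / e| + `|t1 / e|) => p gp.
have [_ /andP[s0 s1] rp] := rem_neq0 se rg gp.
have n0 := normr_ge0 (t0 / e); have n1 := normr_ge0 (t1 / e).
have n2 := normr_ge0 (t1 / e + r0).
have xr (x y b : R) : 0 < b -> Num.sqrt ((x / b) ^+ 2 + y ^+ 2) <= t1 / e + r0 ->
    `|x| <= b * `|t1 / e + r0|.
  move=> b0 xy; rewrite mulrC -ler_pdivrMr// -[X in _ / X](gtr0_norm b0) -normf_div.
  apply: (le_trans _ (ler_norm _)); apply: le_trans xy.
  by rewrite -sqrtr_sqr ler_wsqrtr// lerDl sqr_ge0.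
have x1 := xr _ _ _ b1_gt0 rp.
have x2 : `|p.1.2| <= b2 * `|t1 / e + r0|.
  by apply: (xr _ (p.1.1 / b1)) => //; rewrite addrC.
have m1 : 0 <= b1 * `|t1 / e + r0| by rewrite mulr_ge0// ltW.
have m2 : 0 <= b2 * `|t1 / e + r0| by rewrite mulr_ge0// ltW.
split; [lra|lra|]; rewrite ler_norml.
have := ler_norm (t1 / e); have := ler_norm (- (t0 / e)); rewrite normrN.
by move=> *; apply/andP; split; lra.
Qed.

Lemma rem_test_fun m g e : small e -> rem m g -> test_fun setT (g e).
Proof.
move=> se rg; have [X gX] := rem_cube se rg.
exact: (test_fun_of_cube (rem_smooth se rg) (@closed_cube _ X) (fun _ h => h) (fun _ _ => I) gX).
Qed.

Lemma adm_test_fun T th : t1 < T -> adm th -> test_fun [set p : R * R * R | 0 < p.2 < T] th.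
Proof.
move=> t1T [Sth th0]; have cK : closed [set q | box c r0 t0 t1 q].
  rewrite (_ : [set q | _] = ~` [set q | ~~ box c r0 t0 t1 q]).
    by apply: open_closedC; exact: open_not_box.
  by apply/seteqP; split=> q /=; [move=> -> /=|move=> /negP; rewrite negbK].
apply: (test_fun_of_cube (X := `|r0| + (3 / 8 * pi + `|c|) + `|t1|) Sth cK).
- move=> q /and4P[]; rewrite ler_norml [`|_ - c| <= _]ler_norml => /andP[a1 a2] /andP[a3 a4] a5 a6.
  have q2 : 0 <= q.2 := le_trans (ltW t0_gt0) a5.
  have := pi_gt0 R; have := normr_ge0 r0; have := normr_ge0 c; have := normr_ge0 t1.
  have := ler_norm r0; have := ler_norm c; have := ler_norm (- c); have := ler_norm t1.
  by rewrite normrN => *; split; rewrite ler_norml; apply/andP; split; lra.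
- by move=> q /and4P[_ _ a5 a6]; apply/andP; split; [exact: lt_le_trans a5|exact: le_lt_trans t1T].
- by move=> q; apply: contra_neqT => /th0.
Qed.

Context (w : R -> R * R * R -> R).
Hypothesis w_Linfty : forall eps T0 : R, 0 < eps -> 0 < T0 -> Linfty_Hm (T0 / eps ^+ 2) 2 (w eps).

(** This serves the linearity of the integral at each fixed [eps]; no bound uniform in [eps] is
    drawn from it. *)
Lemma rem_integrable m g eps : 0 < eps -> small (eps ^+ 2) -> rem m g ->
  (leb3 R).-integrable [set p | 0 < p.2] (fun p => (w eps p * g (eps ^+ 2) p)%:E).
Proof.
move=> eps_gt0 se rg; have [X gX] := rem_cube se rg.
have cg := smooth_continuous (rem_smooth se rg).
have [B gB] := bounded_of_cube cg gX.
have T1_gt0 : 0 < `|t1| + 1 by rewrite ltr_wpDl.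
apply: (integrable_Linfty_Hm (w_Linfty eps_gt0 T1_gt0) (continuous_measurable_fun3 cg) gB (X := X)).
move=> p gp; have [x1 x2 _] := gX p gp; split=> //.
have [_ /andP[s0 s1] _] := rem_neq0 se rg gp; case: se => e_gt0 _.
rewrite (lt_le_trans _ s0) ?divr_gt0//= (le_lt_trans s1)// ltr_pM2r ?invr_gt0//.
by have := ler_norm t1; lra.
Qed.

(** The factor [e^2] is the one that makes pairings converge: the Jacobian [b1 b2 rho / e] of the
    moving frame times the weight [1 / (e rho)] of a lift of index [0] is [b1 b2 / e^2]. *)
Definition scaled_pairing g eps : R :=
  (eps ^+ 2) ^+ 2 * \int[leb3 R]_(p in [set p | 0 < p.2]) (w eps p * g (eps ^+ 2) p).

Lemma near_small : \forall eps \near (0 : R)^'+, 0 < eps /\ small (eps ^+ 2).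
Proof.
have d_gt0 : 0 < t0 / (`|r0| + 1) by rewrite divr_gt0// ltr_wpDl.
near=> eps; have eps_gt0 : 0 < eps by [].
split=> //; split; first by rewrite exprn_gt0.
have e1 : eps < 1 by near: eps; exact: nbhs_right_lt.
have e2 : eps < t0 / (`|r0| + 1) by near: eps; exact: nbhs_right_lt.
apply: (@le_lt_trans _ _ (eps * `|r0|)).
  apply: (le_trans (ler_wpM2l _ (ler_norm r0))); first by rewrite sqr_ge0.
  by rewrite ler_wpM2r// expr2 ler_piMl// ltW.
apply: (@le_lt_trans _ _ (eps * (`|r0| + 1))); last by rewrite -ltr_pdivlMr// ltr_wpDl.
by apply: ler_wpM2l; [exact: ltW|rewrite lerDl].
Unshelve. all: by end_near. Qed.

Lemma pairing_add g1 g2 (l1 l2 : R) : rem 0 g1 -> rem 0 g2 ->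
  scaled_pairing g1 @ 0^'+ --> l1 -> scaled_pairing g2 @ 0^'+ --> l2 ->
  scaled_pairing (fun e p => g1 e p + g2 e p) @ 0^'+ --> l1 + l2.
Proof.
move=> rg1 rg2 h1 h2; apply: cvg_trans (cvgD h1 h2); apply: near_eq_cvg.
near=> eps; have [eps_gt0 se] : 0 < eps /\ small (eps ^+ 2) by near: eps; exact: near_small.
rewrite /scaled_pairing /= -mulrDr; congr (_ * _).
apply: (etrans (esym (@RintegralD _ _ R (leb3 R) _ _ _ measurable_pos_time
  (rem_integrable eps_gt0 se rg1) (rem_integrable eps_gt0 se rg2)))).
by apply: eq_Rintegral => p _; rewrite mulrDr.
Unshelve. all: by end_near. Qed.

(** The factor [x] depends on [eps] while [g] is indexed by [e = eps ^+ 2], hence the square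
    root. *)
Lemma pairing_mul (x : R -> R) (x0 : R) g (l : R) : rem 0 g -> x @ 0^'+ --> x0 ->
  scaled_pairing g @ 0^'+ --> l ->
  scaled_pairing (fun e p => x (Num.sqrt e) * g e p) @ 0^'+ --> x0 * l.
Proof.
move=> rg hx h; apply: cvg_trans (cvgM hx h); apply: near_eq_cvg.
near=> eps; have [eps_gt0 se] : 0 < eps /\ small (eps ^+ 2) by near: eps; exact: near_small.
rewrite /scaled_pairing /= mulrCA; congr (_ * _).
apply: (etrans (esym (@RintegralZl _ _ R (leb3 R) _ _ (x eps) measurable_pos_time
  (rem_integrable eps_gt0 se rg)))).
by apply: eq_Rintegral => p _; rewrite sqrtr_sqr gtr0_norm// mulrCA.
Unshelve. all: by end_near. Qed.

Lemma pairing_scale (x : R) g (l : R) : rem 0 g -> scaled_pairing g @ 0^'+ --> l ->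
  scaled_pairing (fun e p => x * g e p) @ 0^'+ --> x * l.
Proof. by move=> rg h; exact: (pairing_mul rg (cvg_cst x) h). Qed.

Lemma pairing_small g (l : R) : rem 0 g -> scaled_pairing g @ 0^'+ --> l ->
  scaled_pairing (fun e p => e * g e p) @ 0^'+ --> (0 : R).
Proof.
move=> rg h; have x0 : (fun eps : R => eps ^+ 2) @ 0^'+ --> (0 : R).
  have := @exprn_continuous R 2 0; rewrite /continuous_at expr0n => /cvg_at_right_filter; exact.
have := pairing_mul rg x0 h; rewrite mul0r; apply: cvg_trans; apply: near_eq_cvg.
near=> eps; have [eps_gt0 se] : 0 < eps /\ small (eps ^+ 2) by near: eps; exact: near_small.
rewrite /scaled_pairing; congr (_ * _); apply: eq_Rintegral => p _.
by rewrite sqrtr_sqr gtr0_norm.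
Unshelve. all: by end_near. Qed.

Lemma pairing_eq g1 g2 (l : R) : (forall e, small e -> g1 e =1 g2 e) ->
  scaled_pairing g1 @ 0^'+ --> l -> scaled_pairing g2 @ 0^'+ --> l.
Proof.
move=> E; apply: cvg_trans; apply: near_eq_cvg.
near=> eps; have [eps_gt0 se] : 0 < eps /\ small (eps ^+ 2) by near: eps; exact: near_small.
by rewrite /scaled_pairing; congr (_ * _); apply: eq_Rintegral => p _; rewrite E.
Unshelve. all: by end_near. Qed.

Context (a : 'I_2 -> R) (b1a : b1 = Num.sqrt (a 0)) (b2a : b2 = Num.sqrt (a 1)).
Context (T : R) (t1T : t1 < T) (cos_c : cos c != 0).

Let sec_chart (q : R * R * R) (e : R) : e != 0 ->
  sec_x b1 b2 c (moving_chart b1 b2 e q) = (q.1.1 + q.2 / e) * cos (q.1.2 - c).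
Proof.
by move=> e0; rewrite /sec_x /moving_chart/= cosB; field; rewrite e0 !gt_eqF.
Qed.

Let secy_chart (q : R * R * R) (e : R) : e != 0 ->
  sec_y b1 b2 c (moving_chart b1 b2 e q) = (q.1.1 + q.2 / e) * sin (q.1.2 - c).
Proof.
by move=> e0; rewrite /sec_y /moving_chart/= sinB; field; rewrite e0 !gt_eqF.
Qed.

Lemma rho_chart (q : R * R * R) (e : R) : 0 < q.1.1 + q.2 / e ->
  rho b1 b2 (moving_chart b1 b2 e q) = q.1.1 + q.2 / e.
Proof.
move=> s0; rewrite /rho /moving_chart/=.
set s := _ + _ in s0 *.
have -> : (b1 * s * cos q.1.2 / b1) ^+ 2 + (b2 * s * sin q.1.2 / b2) ^+ 2 = s ^+ 2.
  rewrite -[RHS]mulr1 -(cos2Dsin2 q.1.2); field.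
  by rewrite !gt_eqF.
by rewrite sqrtr_sqr gtr0_norm.
Qed.

Lemma ang_chart (q : R * R * R) (e : R) : 0 < e -> 0 < q.1.1 + q.2 / e -> `|q.1.2 - c| < pi / 2 ->
  ang b1 b2 c (moving_chart b1 b2 e q) = q.1.2.
Proof.
move=> e0 s0 qc; have e0' : e != 0 by rewrite gt_eqF.
rewrite /ang sec_chart// secy_chart//.
have c0 : 0 < cos (q.1.2 - c) by apply: cos_gt0_pihalf; rewrite -ltr_norml.
rewrite (_ : _ / _ = tan (q.1.2 - c)); last by rewrite -mulf_div divff ?gt_eqF// mul1r.
by rewrite tanK ?in_itv/= -?ltr_norml//; ring.
Qed.

(** An identity at each small [eps], with no error: in the moving frame the arguments of the lifted
    profile become [(r, phi, t)] themselves and the weight cancels the Jacobian. *)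
Lemma pairing_lift0 th eps : 0 < eps -> small (eps ^+ 2) -> adm th ->
  scaled_pairing (fun e => lift e 0 th) eps =
  b1 * b2 * \int[leb3 R]_(p in [set p | 0 < p.2 < T]) (Weps a eps (w eps) p * th p).
Proof.
move=> eps_gt0 se ath; have [e_gt0 e_small] := se; set e := eps ^+ 2 in se e_gt0 e_small *.
have r0l : rem 0 (fun e => lift e 0 th) by exact: rem_lift.
have b_gt0 : 0 < b1 * b2 by exact: mulr_gt0.
have [Sth th0] := ath.
(* [w eps] is measurable on bounded time strips only; the cutoff time lies strictly beyond [t1 / e],
   where the lift already vanishes. *)
pose G p : R := if 0 < p.2 < (`|t1| + 1) / e then e ^+ 2 / (b1 * b2) * (w eps p * lift e 0 th p) else 0.
have T1_gt0 : 0 < `|t1| + 1 by rewrite ltr_wpDl.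
have [mw _] := w_Linfty eps_gt0 T1_gt0.
have mcond : measurable_fun setT (fun p : R * R * R => 0 < p.2 < (`|t1| + 1) / e).
  by apply: measurable_and; apply: measurable_fun_ltr.
have mlift := continuous_measurable_fun3 (smooth_continuous (rem_smooth se r0l)).
have mG : measurable_fun setT G.
  apply: measurable_fun_if => //; rewrite setTI.
  rewrite (_ : _ @^-1` _ = [set p : R * R * R | 0 < p.2 < (`|t1| + 1) / e])//.
  apply: measurable_funM; first exact: measurable_cst.
  by apply: measurable_funM => //; exact: measurable_funTS.
have G0 p : p.1.1 / b1 * cos c + p.1.2 / b2 * sin c <= 0 -> G p = 0.
  by rewrite leNgt => /negbTE s0; rewrite /G liftE /sec_x s0 !mulr0 if_same.
have int := @RintegralZl _ _ R (leb3 R) _ _ (e ^+ 2 / (b1 * b2)) measurable_pos_time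
  (rem_integrable eps_gt0 se r0l).
rewrite /scaled_pairing -/e (_ : e ^+ 2 = b1 * b2 * (e ^+ 2 / (b1 * b2))); last first.
  by rewrite mulrC divfK// gt_eqF.
rewrite -mulrA -int; congr (_ * _).
rewrite Rintegral_mkcond [RHS]Rintegral_mkcond.
transitivity (\int[leb3 R]_p G p).
  apply: eq_Rintegral => p _; rewrite patchE /G; case: ifPn => [|].
    rewrite inE/= => p0; rewrite p0/=; case: ifPn => // np.
    have [->|] := eqVneq (lift e 0 th p) 0; first by rewrite !mulr0.
    move=> /(rem_neq0 se r0l)[_ /andP[_ s1] _]; case/negP: np.
    by rewrite (le_lt_trans s1)// ltr_pM2r ?invr_gt0//; have := ler_norm t1; lra.
  by rewrite notin_setE/= => /negP np; rewrite (negbTE np).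
rewrite (Rintegral_moving_chart b1_gt0 b2_gt0 cos_c e_gt0 mG G0).
apply: eq_Rintegral => q _; rewrite patchE.
(* If [th q = 0], both integrands vanish, in or out of the chart; otherwise [q] is in the box, which
   forces it into the chart and into the time interval. *)
have [q0|] := eqVneq (th q) 0.
  rewrite q0 mulr0 if_same; case: ifPn => // /andP[s0 qc].
  rewrite /G; case: ifP => _; rewrite ?mulr0// liftE; case: ifP => _; rewrite ?mulr0//.
  have -> : (rho b1 b2 (moving_chart b1 b2 e q) - (moving_chart b1 b2 e q).2,
    ang b1 b2 c (moving_chart b1 b2 e q), e * (moving_chart b1 b2 e q).2) = q.
    rewrite rho_chart// ang_chart//= addrK mulrC divfK ?gt_eqF//.
    by rewrite -!surjective_pairing.
  by rewrite q0 !mulr0.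
move=> qn; have /and4P[r1 p1 s1 s2] : box c r0 t0 t1 q.
  by apply: contraNT qn => /th0 ->.
have q2 : 0 < q.2 := lt_le_trans t0_gt0 s1.
have qT : q.2 < T := le_lt_trans s2 t1T.
have s0 : 0 < q.1.1 + q.2 / e.
  have : r0 < q.2 / e by rewrite ltr_pdivlMr// mulrC (lt_le_trans e_small).
  by move: r1; rewrite ler_norml => /andP[? ?]; lra.
have qc : `|q.1.2 - c| < pi / 2 by have := pi_gt0 R; lra.
rewrite s0 qc mem_set/= ?q2//.
have c0 : 0 < cos (q.1.2 - c) by apply: cos_gt0_pihalf; rewrite -ltr_norml.
have m2 : 0 < (moving_chart b1 b2 e q).2 < (`|t1| + 1) / e.
  rewrite /moving_chart/= divr_gt0//= ltr_pM2r ?invr_gt0// (le_lt_trans s2)//.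
  by have := ler_norm t1; lra.
rewrite /G liftE m2 sec_chart ?gt_eqF// (mulr_gt0 s0 c0) rho_chart// ang_chart// /=.
rewrite addrK (mulrC e (_ / e)) divfK ?gt_eqF// expr0.
rewrite -!surjective_pairing.
rewrite /Weps -/e; have -> : - (q.2 / e) < q.1.1 by lra.
rewrite /moving_chart /elliptic -b1a -b2a ![b1 * (_ + _)]mulrC ![b2 * (_ + _)]mulrC.
set s := q.1.1 + _ in s0 *.
by field; rewrite !gt_eqF.
Qed.

Context (W : (R * R * R -> R) -> R).
Hypothesis W_cvg : forall psi, test_fun [set p : R * R * R | 0 < p.2 < T] psi ->
  (fun eps => \int[leb3 R]_(p in [set p | 0 < p.2 < T]) (Weps a eps (w eps) p * psi p))
    @ 0^'+ --> W psi.

(** By [lift_shift] each power of [e * rho] is a factor [t] up to a term with a factor [e], whose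
    pairing converges by induction and is therefore negligible. *)
Lemma pairing_lift k th : adm th -> scaled_pairing (fun e => lift e k th) @ 0^'+ -->
  b1 * b2 * W (fun q => q.2 ^+ k * th q).
Proof.
elim: k th => [|k IH] th ath.
  rewrite (_ : (fun q => _) = th); last by apply/funext => q; rewrite expr0 mul1r.
  apply: cvg_trans (cvgM (cvg_cst (b1 * b2)) (W_cvg (adm_test_fun t1T ath))); apply: near_eq_cvg; near=> eps.
  have [eps_gt0 se] : 0 < eps /\ small (eps ^+ 2) by near: eps; exact: near_small.
  by rewrite pairing_lift0.
have at' : adm (fun q => q.2 * th q) := adm_mul (@smooth_on_t R setT) ath.
have ar : adm (fun q => q.1.1 * th q) := adm_mul (@smooth_on_r R setT) ath.
have R1 : rem 0 (fun e => lift e k (fun q => q.2 * th q)) by exact: rem_lift.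
have R2 : rem 0 (fun e => lift e k (fun q => q.1.1 * th q)) by exact: rem_lift.
have := pairing_add R1 (rem_mul R2) (IH _ at') (pairing_small R2 (IH _ ar)).
rewrite addr0 (_ : (fun q : R * R * R => q.2 ^+ k * (q.2 * th q)) = fun q => q.2 ^+ k.+1 * th q).
  by apply: pairing_eq => e se p; rewrite lift_shift.
by apply/funext => q; rewrite exprSr mulrA.
Unshelve. all: by end_near. Qed.

(** The value of the limit is irrelevant: remainders enter the equation with one more factor [e],
    and a convergent pairing times [e] tends to [0]. *)
Lemma rem_cvg g : rem 0 g -> exists l : R, scaled_pairing g @ 0^'+ --> l.
Proof.
elim=> [k th _ ath|g1 g2 r1 [l1 h1] r2 [l2 h2]|x g1 r1 [l h]|g1 r1 [l h]|g1 g2 _ [l h] E].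
- by exists (b1 * b2 * W (fun q => q.2 ^+ k * th q)); exact: pairing_lift.
- by exists (l1 + l2); exact: pairing_add.
- by exists (x * l); exact: pairing_scale.
- by exists 0; exact: pairing_small h.
- by exists l; exact: pairing_eq h.
Qed.

Context (A E : 'M[R]_2) (F : 'I_2 -> 'I_2 -> 'I_2 -> 'I_2 -> R) (f : R * R -> R) (kap : R -> R).
Hypothesis A_diag : A = diag_mx (\row_i a i).
Hypothesis a_gt0 : forall i, 0 < a i.
Hypothesis w_sol : forall eps, 0 < eps -> wave_solution A E F f eps (w eps).
Hypothesis kapE : forall x,
  \sum_(i < 2) \sum_(j < 2) \sum_(k < 2) \sum_(l < 2)
      F i j k l * (nvec b1 b2 (e3 R i) x * nvec b1 b2 (e3 R j) x
                   * nvec b1 b2 (e3 R k) x * nvec b1 b2 (e3 R l) x)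
    - \sum_(i < 2) \sum_(j < 2) E i j * (nvec b1 b2 (e3 R i) x * nvec b1 b2 (e3 R j) x)
  = kap x.
Hypothesis kap_smooth : smooth_on setT (fun q : R * R * R => kap q.1.2).

Let Dr th : R * R * R -> R := 'D_(e3 R 0) th.

(** The boundary terms vanish because the lifted test functions are supported
    in [t0 / e <= t]. *)
Lemma local_limit_equation th : adm th ->
  W (fun q => q.2 ^+ 5 * (- 2 * Dr ('D_(et R) th) q + kap q.1.2 * Dr (Dr (Dr (Dr th))) q))
  + W (fun q => q.2 ^+ 4 * (- 9 * Dr th q)) = 0.
Proof.
move=> ath.
have b1s : b1 ^+ 2 = a 0 by rewrite b1a sqr_sqrtr// ltW.
have b2s : b2 ^+ 2 = a 1 by rewrite b2a sqr_sqrtr// ltW.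
have [h rh expansion] := wave_expansion b1_gt0 b2_gt0 b1s b2s ath kapE kap_smooth.
set th1 : R * R * R -> R := fun q => - 2 * _ + _ in expansion.
set th2 : R * R * R -> R := fun q => - 9 * _ in expansion.
have ar : adm (Dr th) := adm_D (e3 R 0) ath.
have a2 : adm th2 := adm_scale (- 9) ar.
have a1 : adm th1.
  apply: adm_add; first exact: adm_scale (adm_D (e3 R 0) (adm_D (et R) ath)).
  exact: adm_mul kap_smooth (adm_D (e3 R 0) (adm_D (e3 R 0) (adm_D (e3 R 0) ar))).
pose H e p := lift e 5 th1 p + lift e 4 th2 p + e * h e p.
have R1 : rem 0 (fun e => lift e 5 th1) by exact: rem_lift.
have R2 : rem 0 (fun e => lift e 4 th2) by exact: rem_lift.
have rH : rem 0 H := rem_add (rem_add R1 R2) (rem_mul rh).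
have [l hl] := rem_cvg rh.
have Hlim := pairing_add (rem_add R1 R2) (rem_mul rh)
  (pairing_add R1 R2 (@pairing_lift 5 th1 a1) (@pairing_lift 4 th2 a2)) (pairing_small rh hl).
have H0 : scaled_pairing H @ 0^'+ --> (0 : R).
  have c0 : (fun=> (0 : R)) @ (0 : R)^'+ --> (0 : R) by exact: cvg_cst.
  apply: cvg_trans c0; apply: near_eq_cvg; near=> eps.
  have [eps_gt0 se] : 0 < eps /\ small (eps ^+ 2) by near: eps; exact: near_small.
  have e_gt0 : 0 < eps ^+ 2 by case: se.
  have r5 : rem 5 (fun e => lift e 5 th) by exact: rem_lift.
  have [_ /(_ _ (rem_test_fun se r5))] := w_sol eps_gt0.
  have at0 m g x : rem m g -> g (eps ^+ 2) (x, 0) = 0.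
    move=> rg; apply/eqP; apply: contraT => /(rem_neq0 se rg)[_ /andP[/= + _] _].
    by rewrite leNgt divr_gt0.
  have r4 := rem_D b1_gt0 b2_gt0 (et R) r5.
  rewrite [X in _ + X = _](_ : _ = 0) ?addr0; last first.
    rewrite /Rintegral integral0_eq// => x _; congr (_%:E).
    rewrite (at0 _ _ _ r4) [op2 _ _ _ _]big1 ?mulr0 ?subrr ?mulr0// => i _.
    rewrite big1// => j _; have r2 := rem_D b1_gt0 b2_gt0 (e3 R i) (rem_D b1_gt0 b2_gt0 (e3 R j) r4).
    by rewrite /= (at0 _ _ _ r2) mulr0.
  (* By [wave_expansion] the equation tested with the lift is [e] times the integral of [w eps * H],
     so that integral is zero. *)
  move=> sol; rewrite /scaled_pairing/= (_ : \int[_]_(_ in _) _ = 0) ?mulr0//.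
  apply: (mulfI (lt0r_neq0 e_gt0)); rewrite mulr0; apply: etrans sol.
  apply: (etrans (esym (@RintegralZl _ _ R (leb3 R) _ _ (eps ^+ 2) measurable_pos_time
    (rem_integrable eps_gt0 se rH)))).
  by apply: eq_Rintegral => p _; rewrite A_diag expansion// mulrCA.
have HE := cvg_unique (@norm_hausdorff _ _) Hlim H0.
have {}HE : b1 * b2 * W (fun q => q.2 ^+ 5 * th1 q) + b1 * b2 * W (fun q => q.2 ^+ 4 * th2 q)
    + 0 = 0 :> R by apply: HE; exact: fmap_proper_filter.
move/eqP: HE; rewrite addr0 -mulrDr.
by rewrite mulf_eq0 mulf_eq0 (gt_eqF b1_gt0) (gt_eqF b2_gt0) => /eqP.
Unshelve. all: by end_near. Qed.

End ScalingLimit.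

(** * The dispersion coefficient *)

Section Dispersion.
Context {R : realType}.

Lemma derive_linear_pow (V : normedModType R) (l : V -> R) (d : R) k v :
  (forall (s : R) (x y : V), l (s *: x + y) = s * l x + l y) ->
  'D_v (fun x => d * l x ^+ k.+1) = (fun x => d * k.+1%:R * l v * l x ^+ k).
Proof.
move=> ll; apply/funext => x.
have H := is_deriveZ d (is_deriveX k.+1 (derivable_linear x v ll)).
rewrite (_ : (fun x => _) = d \*: (l ^+ k.+1)).
  by case: H => _ ->; rewrite /GRing.scale/=; ring.
by apply/funext => y; rewrite /= fctE.
Qed.

(** On [l^4] with [l = n . x], a fourth order operator gives [24] times its symbol at [n], while
    [AD^2 l^4 = 12 l^2] because [n] is a unit vector for [A], so that [ED^2 AD^2] gives [24] times
    the symbol of [E]. The decomposition then reads [F n^4 - E n^2 = C n^4]; the [6] in [kappa]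
    counts the index words with each index twice. *)
Lemma dispersion_coefficient (a alpha : 'I_2 -> R) (beta : R) (A E : 'M[R]_2)
    (C F : 'I_2 -> 'I_2 -> 'I_2 -> 'I_2 -> R) (b1 b2 x : R) :
  0 < b1 -> 0 < b2 -> b1 ^+ 2 = a 0 -> b2 ^+ 2 = a 1 ->
  even_form A C a alpha beta -> decomposes A C E F ->
  \sum_(i < 2) \sum_(j < 2) \sum_(k < 2) \sum_(l < 2)
      F i j k l * (nvec b1 b2 (e3 R i) x * nvec b1 b2 (e3 R j) x
                   * nvec b1 b2 (e3 R k) x * nvec b1 b2 (e3 R l) x)
    - \sum_(i < 2) \sum_(j < 2) E i j * (nvec b1 b2 (e3 R i) x * nvec b1 b2 (e3 R j) x)
  = kappa a alpha beta x.
Proof.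
move=> b1_gt0 b2_gt0 b1a b2a [Aa Cii Cij C0] dec.
set n := fun i => nvec b1 b2 (e3 R i) x.
have n0 : n 0 = cos x / b1 by rewrite /n /nvec /e3 /e2/= mulr1 mulr0 addr0.
have n1 : n 1 = sin x / b2 by rewrite /n /nvec /e3 /e2/= mulr1 mulr0 add0r.
pose l (y : R * R) := n 0 * y.1 + n 1 * y.2.
have ll (s : R) (y z : R * R) : l (s *: y + z) = s * l y + l z.
  by rewrite /l/= /GRing.scale/=; ring.
have lc : continuous l.
  by move=> y; apply: cvgD; apply: cvgMr; [exact: cvg_fst|exact: cvg_snd].
have le i : l (e2 R i) = n i.
  by rewrite /l /e2; case: i => -[|[|//]] i2 /=; rewrite ?mulr1 ?mulr0 ?addr0 ?add0r; congr n; exact: val_inj.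
have D i d k := @derive_linear_pow _ l d k (e2 R i) ll.
have D0 i d k y : 'D_(e2 R i) (fun x => d * l x ^+ k.+1) y = d * k.+1%:R * l (e2 R i) * l y ^+ k.
  by rewrite -[LHS]/(('D_(e2 R i) (fun x => d * l x ^+ k.+1)) y) D.
have lE k : (fun y => l y ^+ k) = (fun y => 1 * l y ^+ k).
  by apply/funext => y; rewrite mul1r.
have Su : smooth_on setT (fun y => l y ^+ 4).
  exact: (@smooth_onX _ _ setT _ 4 openT (@smooth_on_linear _ _ setT _ lc ll)).
have := dec _ Su 0.
have S : a 0 * n 0 ^+ 2 + a 1 * n 1 ^+ 2 = 1.
  by rewrite -b1a -b2a n0 n1 -(cos2Dsin2 x); field; rewrite !gt_eqF.
have D4 i j k m : Dseq [:: e2 R i; e2 R j; e2 R k; e2 R m] (fun y => l y ^+ 4) 0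
    = 24 * (n i * n j * n k * n m).
  by rewrite /= lE (D m 1 3%N) (D k _ 2%N) (D j _ 1%N) (D0 i _ 0%N) !le expr0; ring.
have op4E (K : 'I_2 -> 'I_2 -> 'I_2 -> 'I_2 -> R) : op4 K (e2 R) (fun y => l y ^+ 4) 0 =
    24 * \sum_(i < 2) \sum_(j < 2) \sum_(k < 2) \sum_(m < 2) K i j k m * (n i * n j * n k * n m).
  rewrite /op4; do 4 (rewrite mulr_sumr; apply: eq_bigr => ? _).
  by rewrite D4 mulrCA.
have op2E : op2 A (e2 R) (fun y => l y ^+ 4) = fun y => 12 * l y ^+ 2.
  apply/funext => y; rewrite Aa op2_diag /= lE !(D _ 1 3%N) !(D0 _ _ 2%N) !le.
  transitivity ((a 0 * n 0 ^+ 2 + a 1 * n 1 ^+ 2) * (12 * l y ^+ 2)); last by rewrite S mul1r.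
  ring.
have op2E' : op2 E (e2 R) (fun y => 12 * l y ^+ 2) 0 =
    24 * \sum_(i < 2) \sum_(j < 2) E i j * (n i * n j).
  rewrite /op2; do 2 (rewrite mulr_sumr; apply: eq_bigr => ? _).
  by rewrite /= (D _ _ 1%N) (D0 _ _ 0%N) !le expr0; ring.
rewrite op2E !op4E op2E'.
set SC := \sum_(i < 2) _; set SE := \sum_(i < 2) _; set SF := \sum_(i < 2) _.
move=> eqs; have -> : SF - SE = SC by lra.
rewrite /SC !sum_ord2.
have [c1 c2 c3] := Cij 0 1 isT; have [c4 c5 c6] := Cij 1 0 isT.
rewrite !Cii c1 c2 c3 c4 c5 c6.
rewrite !C0 // !mul0r !add0r !addr0 /kappa n0 n1 -b1a -b2a; field.
by rewrite !gt_eqF.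
Qed.

Lemma smooth_kappa (a alpha : 'I_2 -> R) beta :
  smooth_on setT (fun q : R * R * R => kappa a alpha beta q.1.2).
Proof.
have Sphi := @smooth_on_phi R setT.
have Sc k d : smooth_on setT (fun q : R * R * R => cos q.1.2 ^+ k / d) :=
  smooth_onM openT (smooth_onX k openT (smooth_on_comp1 openT smooth1_cos (fun _ _ => I) Sphi))
    (@smooth_on_cst _ _ setT d^-1).
have Ss k d : smooth_on setT (fun q : R * R * R => sin q.1.2 ^+ k / d) :=
  smooth_onM openT (smooth_onX k openT (smooth_on_comp1 openT smooth1_sin (fun _ _ => I) Sphi))
    (@smooth_on_cst _ _ setT d^-1).
exact: (smooth_onD openT (smooth_onD openT
  (smooth_onM openT (smooth_onZ (6 * beta) openT (Sc 2%N (a 0))) (Ss 2%N (a 1)))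
  (smooth_onZ (alpha 0) openT (Sc 4%N (a 0 ^+ 2))))
  (smooth_onZ (alpha 1) openT (Ss 4%N (a 1 ^+ 2)))).
Qed.

Lemma even_form_gt0 (A : 'M[R]_2) C (a alpha : 'I_2 -> R) beta i :
  even_form A C a alpha beta -> posdef A -> 0 < a i.
Proof.
move=> [-> _ _ _] [_ /(_ (fun j => (j == i)%:R))].
rewrite (bigD1 i)//= (bigD1 i)//= !mxE !eqxx !mulr1 mulr1n !big1 ?addr0.
- by apply; exists i; rewrite eqxx oner_neq0.
- by move=> j /negbTE ij; rewrite big1// => k _; rewrite ij mulr0 mul0r.
- by move=> j /negbTE ij; rewrite ij mulr0.
Qed.

End Dispersion.

(** * The limit equation *)

Section Partition.
Context {R : realType}.

(** The factor leaves each difference quotient, as it is constant along [v]; this covers singular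
    factors such as [(2 * q.2)^-1]. *)
Lemma derive_constant_factor (V : normedModType R) (h g : V -> R) v x :
  (forall (s : R) y, h (s *: v + y) = h y) -> derivable g x v ->
  'D_v (fun y => h y * g y) x = h x * 'D_v g x.
Proof.
move=> hv dg; apply: cvg_lim; first exact: norm_hausdorff.
have H : (fun s : R => h x * (s^-1 *: (g (s *: v + x) - g x))) @ 0^' --> h x * 'D_v g x.
  by apply: cvgMr; exact: dg.
apply: cvg_trans H; apply: near_eq_cvg; near=> s.
by rewrite /= hv -mulrBr /GRing.scale/= mulrCA.
Unshelve. all: by end_near. Qed.

(** The open sets [0 < t] and [t < t0] cover space-time: the power is smooth on the first, the
    product vanishes on the second. *)
Lemma smooth_time_pole (g : R * R * R -> R) (t0 : R) k : smooth_on setT g -> 0 < t0 ->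
  (forall q : R * R * R, g q != 0 -> t0 <= q.2) -> smooth_on setT (fun q : R * R * R => q.2 ^- k * g q).
Proof.
move=> Sg t0_gt0 gt.
have St U : smooth_on U (fun q : R * R * R => q.2) := @smooth_on_t R U.
have ct := smooth_continuous (St setT).
have oP : open [set q : R * R * R | 0 < q.2].
  by apply: (@open_comp _ _ (fun q : R * R * R => q.2) [set x | 0 < x]); [move=> p _; exact: ct|exact: open_gt].
have oN : open [set q : R * R * R | q.2 < t0].
  by apply: (@open_comp _ _ (fun q : R * R * R => q.2) [set x | x < t0]); [move=> p _; exact: ct|exact: open_lt].
have cover : setT `<=` [set q : R * R * R | 0 < q.2] `|` [set q | q.2 < t0].
  by move=> q _ /=; have [q0|q0] := ltP 0 q.2; [left|right; exact: le_lt_trans t0_gt0].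
apply: (smooth_onSubset cover); apply: smooth_onU.
  apply: (smooth_onM oP _ (smooth_onSubset (@subsetT _ _) Sg)).
  apply: (smooth_on_comp1 oP smooth1_inv _ (smooth_onX k oP (St _))) => q /= q0.
  by rewrite expf_neq0// gt_eqF.
have Z : smooth_on [set q : R * R * R | q.2 < t0] (fun=> 0 : R) := smooth_on_cst 0.
apply: (smooth_on_eq oN _ Z) => q /= qt; have [->|/gt] := eqVneq (g q) 0; first by rewrite mulr0.
by rewrite leNgt qt.
Qed.

Definition ramp (c x : R) : R := smooth_step ((x - (c - 3 / 8 * pi)) / (pi / 4)).

Lemma ramp_eq0 c x : x <= c - 3 / 8 * pi -> ramp c x = 0.
Proof.
move=> xc; apply: smooth_step_eq0; have := pi_gt0 R => pi0.
by rewrite pmulr_lle0 ?invr_gt0 ?divr_gt0// subr_le0.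
Qed.

Lemma ramp_eq1 c x : c - pi / 8 <= x -> ramp c x = 1.
Proof.
move=> xc; apply: smooth_step_eq1; have := pi_gt0 R => pi0.
by rewrite ler_pdivlMr ?divr_gt0// mul1r; lra.
Qed.

(** A difference of consecutive ramps, so that the sum over centres spaced by [pi / 2] telescopes to
    [1]. A ramp rises between [c - 3 / 8 * pi] and [c - pi / 8]. *)
Definition arc (c x : R) : R := ramp c x - ramp (c + pi / 2) x.

Lemma arc_neq0 c x : arc c x != 0 -> `|x - c| <= 3 / 8 * pi.
Proof.
have pi0 := pi_gt0 R.
move=> h; rewrite ler_norml; apply/andP; split; rewrite leNgt; apply/negP => xc; move/eqP: h; apply.
  by rewrite /arc !ramp_eq0 ?subrr//; lra.
by rewrite /arc !ramp_eq1 ?subrr//; lra.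
Qed.

Lemma smooth_arc c : smooth_on setT (fun q : R * R * R => arc c q.1.2).
Proof.
have S d : smooth_on setT (fun q : R * R * R => ramp d q.1.2).
  apply: smooth_on_step.
  exact: (smooth_onM openT (smooth_onB openT (@smooth_on_phi R setT) (smooth_on_cst _)) (smooth_on_cst _)).
exact: (smooth_onB openT (S c) (S (c + pi / 2))).
Qed.

(** Odd multiples of [pi / 4], where the cosine does not vanish, as the change of variables
    requires; the offset [N] spreads them over both half-lines. *)
Definition arc_center (N j : nat) : R := pi / 4 + (j%:R - N%:R) * (pi / 2).

Lemma sin_natmul_pi n : sin (n%:R * pi) = 0 :> R.
Proof.
elim: n => [|n IH]; first by rewrite mul0r sin0.
by rewrite -natr1 mulrDl mul1r sinD IH sinpi mul0r mulr0 addr0.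
Qed.

Lemma cos_arc_center N j : cos (arc_center N j) != 0.
Proof.
apply: contra_eqT (_ : cos (arc_center N j *+ 2) = 0) => [/negPn/eqP c0|].
  by rewrite cos_mulr2n c0 expr0n mul0rn sub0r oppr_eq0 oner_eq0.
rewrite (_ : _ *+ 2 = j%:R * pi + pi / 2 - N%:R * pi); last by rewrite /arc_center; field.
by rewrite cosB cosD cos_pihalf sin_pihalf !sin_natmul_pi !(mulr0, mul0r) subrr mul0r add0r.
Qed.

Lemma sum_arc N x : `|x| + 1 <= N%:R -> \sum_(j < N + N) arc (arc_center N j) x = 1.
Proof.
move=> xN; have [/andP[_ pi4] _] := pihalf_02_cos_pihalf R; have pi2 := pi_ge2 R.
(* This says [N <= N * pi / 2]; the [+ 1] in the hypothesis absorbs the shift by [pi / 8], so at [x]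
   the first ramp is already [1] and the last one still [0]. *)
have Npi : 0 <= N%:R * (pi - 2 : R) by rewrite mulr_ge0// subr_ge0.
have x1 := ler_norm x; have x2 := ler_norm (- x); rewrite normrN in x2.
transitivity (ramp (arc_center N 0) x - ramp (arc_center N (N + N)) x); last first.
  by rewrite ramp_eq1 ?ramp_eq0 ?subr0// /arc_center ?natrD; lra.
move: (N + N)%N => M.
rewrite -(big_mkord xpredT (fun j => arc (arc_center N j) x)).
elim: M => [|M IH]; first by rewrite big_nil subrr.
rewrite big_nat_recr//= IH /arc (_ : arc_center N M + _ = arc_center N M.+1); first by ring.
by rewrite /arc_center -natr1; field.
Qed.

End Partition.

Lemma test_fun_lin (R : realType) (Omega : set (R * R * R)) (c : R) (g h : R * R * R -> R) :
  test_fun Omega g -> test_fun Omega h -> test_fun Omega (fun q => c * g q + h q).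
Proof.
move=> [S1 c1 s1] [S2 c2 s2].
have SU : supp (fun q : R * R * R => c * g q + h q) `<=` supp g `|` supp h.
  rewrite /supp -closureU; apply: closure_subset => q /=.
  have [->|g0 _] := eqVneq (g q) 0; last by left.
  by rewrite mulr0 add0r; right.
split.
- exact: (smooth_onD openT (smooth_onZ c openT S1) S2).
- exact: (subclosed_compact (@closed_closure _ _) (compactU c1 c2) SU).
- by apply: (subset_trans SU) => q [/s1|/s2].
Qed.

(** * The transposed equation and its localisation in the angle *)

Section Limit.
Context {R : realType} (A E : 'M[R]_2) (C F : 'I_2 -> 'I_2 -> 'I_2 -> 'I_2 -> R).
Context (f : R * R -> R) (T : R) (a alpha : 'I_2 -> R) (beta : R).
Hypothesis T_gt0 : 0 < T.
Hypothesis A_posdef : posdef A.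
Hypothesis dec : decomposes A C E F.
Hypothesis even : even_form A C a alpha beta.
Context (w : R -> R * R * R -> R) (W : (R * R * R -> R) -> R).
Hypothesis w_sol : forall eps, 0 < eps -> wave_solution A E F f eps (w eps).
Let Omega : set (R * R * R) := [set p | 0 < p.2 < T].
Hypothesis W_lin : forall (c : R) phi psi, test_fun Omega phi -> test_fun Omega psi ->
  W (fun p => c * phi p + psi p) = c * W phi + W psi.
Hypothesis W_cvg : forall psi, test_fun Omega psi ->
  (fun eps => \int[leb3 R]_(p in Omega) (Weps a eps (w eps) p * psi p)) @ 0^'+ --> W psi.
Local Notation kap := (kappa a alpha beta).
Implicit Types (psi g h : R * R * R -> R).

Let Dr g : R * R * R -> R := 'D_(e3 R 0) g.

(** The transpose of the equation applied to [psi], including the [d_r] hidden in [U = d_r W]: hence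
    one more [Dr] in every term. *)
Definition cKdV_adjoint psi q : R :=
  Dr ('D_(et R) psi) q - (2 * q.2)^-1 * Dr psi q
  - 2^-1 * (kap q.1.2 * Dr (Dr (Dr (Dr psi))) q).

Let Dr_factor h g q : (forall (s r : R) (phi t : R), h (s + r, phi, t) = h (r, phi, t)) ->
  smooth_on setT g -> Dr (fun q => h q * g q) q = h q * Dr g q.
Proof.
move=> hr Sg; apply: derive_constant_factor; last exact: smooth_derivable.
move=> s [[r phi] t].
have -> : s *: e3 R 0 + (r, phi, t) = (s * 1 + r, s * 0 + phi, s * 0 + t) by [].
by rewrite mulr0 !add0r hr.
Qed.

Let Dr_smooth g : smooth_on setT g -> smooth_on setT (Dr g).
Proof. by move=> S; have [_ _ SD] := (smooth_onP _ _).1 S; exact: SD. Qed.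

Let Dr_test g : test_fun Omega g -> test_fun Omega (Dr g).
Proof. exact: test_fun_D. Qed.

Let Dr4_factor h g : (forall (s r : R) (phi t : R), h (s + r, phi, t) = h (r, phi, t)) ->
  smooth_on setT g ->
  Dr (Dr (Dr (Dr (fun q : R * R * R => h q * g q)))) = fun q => h q * Dr (Dr (Dr (Dr g))) q.
Proof.
move=> hr Sg.
have step g' : smooth_on setT g' -> Dr (fun q => h q * g' q) = fun q => h q * Dr g' q.
  by move=> Sg'; apply/funext => q; exact: Dr_factor.
rewrite (step _ Sg) (step _ (Dr_smooth Sg)) (step _ (Dr_smooth (Dr_smooth Sg))).
by rewrite (step _ (Dr_smooth (Dr_smooth (Dr_smooth Sg)))).
Qed.

Let time_factor_test g : test_fun Omega g -> test_fun Omega (fun q => (2 * q.2)^-1 * g q).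
Proof.
move=> tg; have [t0 [t1 [t0_gt0 _ gt]]] := test_fun_timeP T_gt0 tg; have [Sg _ _] := tg.
apply: (test_funM _ tg).
rewrite (_ : (fun q => _) = fun q => 2^-1 * (q.2 ^- 1 * g q)).
  apply: (smooth_onZ _ openT); apply: (smooth_time_pole 1 Sg t0_gt0) => q /gt /andP[]//.
by apply/funext => q; rewrite expr1 invfM mulrA.
Qed.

Let kap_test g : test_fun Omega g -> test_fun Omega (fun q => kap q.1.2 * g q).
Proof.
move=> tg; have [Sg _ _] := tg; apply: (test_funM _ tg).
exact: (smooth_onM openT (smooth_kappa _ _ _) Sg).
Qed.

Lemma cKdV_adjoint_pairing psi : test_fun Omega psi ->
  W (cKdV_adjoint psi) =
  dist_D (et R) (dist_D (e3 R 0) W) psi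
    + dist_mul (fun p => (2 * p.2)^-1) (dist_D (e3 R 0) W) psi
    - 2^-1 * dist_mul (fun p => kap p.1.2)
               (dist_D (e3 R 0) (dist_D (e3 R 0) (dist_D (e3 R 0) (dist_D (e3 R 0) W)))) psi.
Proof.
move=> tp; have [Sp _ _] := tp.
have trt : test_fun Omega (Dr ('D_(et R) psi)) by apply: Dr_test; exact: test_fun_D.
have tm := time_factor_test (Dr_test tp).
have tk := kap_test (Dr_test (Dr_test (Dr_test (Dr_test tp)))).
have alg (x y z : R) : x - y - 2^-1 * z = - 2^-1 * z + (- 1 * y + x) by ring.
have -> : cKdV_adjoint psi = fun q => - 2^-1 * (kap q.1.2 * Dr (Dr (Dr (Dr psi))) q)
    + (- 1 * ((2 * q.2)^-1 * Dr psi q) + Dr ('D_(et R) psi) q).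
  by apply/funext => q; exact: alg.
have S2 := test_fun_lin (- 1) tm trt.
set z := fun q => _ + _ in S2 *.
have Ez : W z = - 1 * W (fun q => (2 * q.2)^-1 * Dr psi q) + W (Dr ('D_(et R) psi)).
  exact: (W_lin (- 1) tm trt).
apply: (etrans (W_lin (- 2^-1) tk S2)); rewrite {}Ez {S2}/dist_D /dist_mul.
have Ex : W ('D_(e3 R 0) ('D_(e3 R 0) ('D_(e3 R 0) ('D_(e3 R 0) (fun q => kap q.1.2 * psi q)))))
    = W (fun q => kap q.1.2 * Dr (Dr (Dr (Dr psi))) q).
  congr W; exact: (@Dr4_factor (fun q : R * R * R => kap q.1.2) psi (fun _ _ _ _ => erefl) Sp).
have Ey : W ('D_(e3 R 0) (fun q : R * R * R => (2 * q.2)^-1 * psi q))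
    = W (fun q => (2 * q.2)^-1 * Dr psi q).
  congr W; apply/funext => q.
  exact: (@Dr_factor (fun q : R * R * R => (2 * q.2)^-1) psi q (fun _ _ _ _ => erefl) Sp).
have alg' (x y u X Y : R) : X = x -> Y = y ->
    - 2^-1 * x + (- 1 * y + u) = - - u + - Y - 2^-1 * (- - - - X).
  by move=> -> ->; ring.
exact: (alg' _ _ _ _ _ Ex Ey).
Qed.

(** Since [chi] depends on the angle alone, it commutes with [Dr] and the time derivative and can be
    put into the profile. With [chi psi = - 2 t^5 th], the time derivative contributes
    [- 10 t^4 Dr th] and the damping term [+ t^4 Dr th]; the sum [- 9] is the radial coefficient of
    [local_limit_equation]. *)
Lemma adjoint_local psi (c : R) (chi : R -> R) : test_fun Omega psi -> cos c != 0 ->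
  smooth_on setT (fun q : R * R * R => chi q.1.2) ->
  (forall x, chi x != 0 -> `|x - c| <= 3 / 8 * pi) ->
  test_fun Omega (fun q => chi q.1.2 * cKdV_adjoint psi q) /\
  W (fun q => chi q.1.2 * cKdV_adjoint psi q) = 0.
Proof.
move=> tp cos_c Schi chic; have [Sp _ _] := tp.
have [t0 [t1 [t0_gt0 t1T pt]]] := test_fun_timeP T_gt0 tp.
have [X X_ge0 pX] := test_fun_cubeP tp.
have tge q : psi q != 0 -> t0 <= q.2 by move=> /pt /andP[].
pose th q : R := - 2^-1 * (chi q.1.2 * (q.2 ^- 5 * psi q)).
have ath : adm c X t0 t1 th.
  split=> [|q].
    exact: (smooth_onZ _ openT (smooth_onM openT Schi (smooth_time_pole 5 Sp t0_gt0 tge))).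
  move=> nq; apply/eqP; apply: contraNT nq; rewrite /th => thq.
  have cq : chi q.1.2 != 0 by apply: contraNneq thq => ->; rewrite mul0r mulr0.
  have pq : psi q != 0 by apply: contraNneq thq => ->; rewrite !mulr0.
  by have [x1 _ _] := pX _ pq; rewrite /box x1 chic// pt.
have a_gt0 i : 0 < a i := even_form_gt0 i even A_posdef.
have b_gt0 i : 0 < Num.sqrt (a i) by rewrite sqrtr_gt0.
have bs i : Num.sqrt (a i) ^+ 2 = a i by rewrite sqr_sqrtr// ltW.
have [Aa _ _ _] := even.
have w_Linfty eps T0 : 0 < eps -> 0 < T0 -> Linfty_Hm (T0 / eps ^+ 2) 2 (w eps).
  by move=> e0 T00; have [/(_ _ T00)[]] := w_sol e0.
have := local_limit_equation (b_gt0 0) (b_gt0 1) t0_gt0 w_Linfty erefl erefl t1T cos_c W_cvg Aa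
  a_gt0 w_sol (fun x => dispersion_coefficient x (b_gt0 0) (b_gt0 1) (bs 0) (bs 1) even dec)
  (smooth_kappa _ _ _) ath.
have [Sth _] := ath.
have ar := adm_D (e3 R 0) ath.
have a4 : adm c X t0 t1 (fun q => q.2 ^+ 4 * (- 9 * Dr th q)).
  apply: (adm_mul (smooth_onX 4 openT (@smooth_on_t R setT))); exact: (adm_scale (- 9) ar).
have a5 : adm c X t0 t1 (fun q => q.2 ^+ 5 *
    (- 2 * Dr ('D_(et R) th) q + kap q.1.2 * Dr (Dr (Dr (Dr th))) q)).
  apply: (adm_mul (smooth_onX 5 openT (@smooth_on_t R setT))).
  apply: (adm_add (adm_scale (- 2) (adm_D (e3 R 0) (adm_D (et R) ath)))).
  exact: (adm_mul (smooth_kappa a alpha beta)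
    (adm_D (e3 R 0) (adm_D (e3 R 0) (adm_D (e3 R 0) ar)))).
have chipsi : (fun q => chi q.1.2 * psi q) = fun q => - 2 * q.2 ^+ 5 * th q.
  apply/funext => q; rewrite /th; have [->|/tge tq] := eqVneq (psi q) 0; first by rewrite !mulr0.
  have q0 : q.2 != 0 by rewrite gt_eqF// (lt_le_trans t0_gt0).
  by field.
have cf (s r phi t : R) : (fun q : R * R * R => chi q.1.2) (s + r, phi, t)
  = (fun q : R * R * R => chi q.1.2) (r, phi, t) by [].
have tf (s r phi t : R) : (fun q : R * R * R => - 2 * q.2 ^+ 5) (s + r, phi, t)
  = (fun q : R * R * R => - 2 * q.2 ^+ 5) (r, phi, t) by [].
have Dr1 q : chi q.1.2 * Dr psi q = - 2 * q.2 ^+ 5 * Dr th q.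
  rewrite -(@Dr_factor (fun q : R * R * R => chi q.1.2) psi q cf Sp) chipsi.
  exact: (@Dr_factor (fun q : R * R * R => - 2 * q.2 ^+ 5) th q tf Sth).
have Dr4 q : chi q.1.2 * Dr (Dr (Dr (Dr psi))) q = - 2 * q.2 ^+ 5 * Dr (Dr (Dr (Dr th))) q.
  have K1 := @Dr4_factor (fun q : R * R * R => chi q.1.2) psi cf Sp.
  have K2 := @Dr4_factor (fun q : R * R * R => - 2 * q.2 ^+ 5) th tf Sth.
  have K0 := congr1 (fun g => Dr (Dr (Dr (Dr g)))) chipsi.
  exact: (congr1 (@^~ q) (etrans (esym K1) (etrans K0 K2))).
have [_ _ SD] := (smooth_onP _ _).1 Sp.
have [_ _ SDth] := (smooth_onP _ _).1 Sth.
have Dt1 : (fun q => chi q.1.2 * 'D_(et R) psi q)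
    = fun q => - 2 * q.2 ^+ 5 * 'D_(et R) th q + - 10 * q.2 ^+ 4 * th q.
  apply/funext => q.
  have <- : 'D_(et R) (fun q => chi q.1.2 * psi q) q = chi q.1.2 * 'D_(et R) psi q.
    apply: derive_constant_factor; last exact: smooth_derivable.
    move=> s [[r phi] t].
    have -> : s *: et R + (r, phi, t) = (s * 0 + r, s * 0 + phi, s * 1 + t) by [].
    by rewrite mulr0 !add0r.
  rewrite chipsi.
  have Lt : forall (s : R) (x y : R * R * R), (s *: x + y).2 = s * x.2 + y.2 by [].
  have H := is_deriveM (is_deriveZ (- 2) (is_deriveX 5 (derivable_linear q (et R) Lt)))
    (derivableP (@smooth_derivable _ _ q (et R) Sth)).
  have [_ D] := H; rewrite /= in D.
  by rewrite -[LHS]/('D_(et R) (((- 2) \*: ((fun q : R * R * R => q.2) ^+ 5)) * th) q) D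
    exprfctE /GRing.scale/=; ring.
have DrDt q : chi q.1.2 * Dr ('D_(et R) psi) q
    = - 2 * q.2 ^+ 5 * Dr ('D_(et R) th) q + - 10 * q.2 ^+ 4 * Dr th q.
  rewrite -(@Dr_factor (fun q : R * R * R => chi q.1.2) ('D_(et R) psi) q cf (SD _)) Dt1.
  have S5 : smooth_on setT (fun q : R * R * R => - 2 * q.2 ^+ 5 * 'D_(et R) th q).
    exact: (smooth_onM openT (smooth_onZ (- 2) openT (smooth_onX 5 openT (@smooth_on_t R setT))) (SDth _)).
  have S4 : smooth_on setT (fun q : R * R * R => - 10 * q.2 ^+ 4 * th q).
    exact: (smooth_onM openT (smooth_onZ (- 10) openT (smooth_onX 4 openT (@smooth_on_t R setT))) Sth).
  exact: (etrans (deriveD (@smooth_derivable _ _ q (e3 R 0) S5) (@smooth_derivable _ _ q (e3 R 0) S4))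
    (f_equal2 +%R (@Dr_factor (fun q : R * R * R => - 2 * q.2 ^+ 5) _ q tf (SDth _))
      (@Dr_factor (fun q : R * R * R => - 10 * q.2 ^+ 4) _ q (fun _ _ _ _ => erefl) Sth))).
have E0 : (fun q : R * R * R => chi q.1.2 * cKdV_adjoint psi q) = fun q : R * R * R =>
   1 * (q.2 ^+ 5 * (- 2 * Dr ('D_(et R) th) q + kap q.1.2 * Dr (Dr (Dr (Dr th))) q))
   + q.2 ^+ 4 * (- 9 * Dr th q).
  have alg (x u v y z k t D1 D4 DT : R) : x * u = - 2 * t ^+ 5 * DT + - 10 * t ^+ 4 * D1 ->
     x * v = - 2 * t ^+ 5 * D1 -> x * z = - 2 * t ^+ 5 * D4 ->
     x * (u - (2 * t)^-1 * v - 2^-1 * (k * z)) =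
     1 * (t ^+ 5 * (- 2 * DT + k * D4)) + t ^+ 4 * (- 9 * D1).
    move=> e1 e2 e3; rewrite !mulrBr e1 (mulrCA x) e2 (mulrCA x) (mulrCA x) e3.
    (* At [t = 0] the inverse takes its default value [0] and both sides vanish. *)
    have [->|t0n] := eqVneq t 0; first by rewrite mulr0 invr0; ring.
    by field.
  by apply/funext => q; exact: (alg _ _ _ 0 _ _ _ _ _ _ (DrDt q) (Dr1 q) (Dr4 q)).
move=> loc; rewrite E0; split.
  exact: (test_fun_lin 1 (adm_test_fun t0_gt0 t1T a5) (adm_test_fun t0_gt0 t1T a4)).
by apply: (etrans (W_lin 1 (adm_test_fun t0_gt0 t1T a5) (adm_test_fun t0_gt0 t1T a4))); rewrite mul1r.
Qed.

Lemma cKdV_adjoint_supp psi q : cKdV_adjoint psi q != 0 -> supp psi q.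
Proof.
move=> Qq; have Dsupp v g : 'D_v g q != 0 -> supp g q.
  by move=> Dq; apply: (@supp_D _ v g); exact: subset_closure.
have Ds v g : supp ('D_v g) q -> supp g q by exact: supp_D.
have [/eqP r0|/Dsupp//] := boolP ('D_(e3 R 0) psi q == 0).
have [/eqP rt0|/Dsupp/Ds//] := boolP ('D_(e3 R 0) ('D_(et R) psi) q == 0).
have [/eqP r40|/Dsupp/Ds/Ds/Ds//] :=
  boolP ('D_(e3 R 0) ('D_(e3 R 0) ('D_(e3 R 0) ('D_(e3 R 0) psi))) q == 0).
by move/eqP: Qq; rewrite /cKdV_adjoint /Dr rt0 r0 r40 !mulr0 !subr0.
Qed.

Lemma cKdV_limit : linearized_cKdV T kap (dist_D (e3 R 0) W).
Proof.
move=> psi tp; rewrite -cKdV_adjoint_pairing//.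
have [X X_ge0 pX] := test_fun_cubeP tp.
(* The angles in the support of [psi] are bounded by [X], so finitely many arcs sum to [1] there and
   finite additivity of [W] suffices. They multiply [cKdV_adjoint psi], which is supported in the
   support of [psi]. *)
have [N XN] : exists N : nat, X + 1 <= N%:R.
  by exists (Num.truncn (X + 1)).+1; apply/ltW; rewrite truncnS_gt.
pose g j q := arc (arc_center N j) q.1.2 * cKdV_adjoint psi q.
have loc j := adjoint_local tp (cos_arc_center N j) (smooth_arc _) (@arc_neq0 _ _).
have t0 : test_fun Omega (fun=> 0).
  have := test_fun_lin (- 1) (loc 0%N).1 (loc 0%N).1.
  rewrite (_ : (fun q : R * R * R => _) = fun=> 0)//.
  by apply/funext => q; rewrite mulN1r addNr.
have W0 : W (fun=> 0) = 0.
  have Z : (fun=> 0) = (fun p : R * R * R => - 1 * 0 + 0 : R).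
    by apply/funext => q; rewrite mulr0 addr0.
  by rewrite [X in W X]Z (W_lin (- 1) t0 t0) mulN1r addNr.
have sumM M : test_fun Omega (fun q => \sum_(0 <= j < M) g j q) /\
    W (fun q => \sum_(0 <= j < M) g j q) = 0.
  elim: M => [|M [IHt IHW]].
    rewrite (_ : (fun q : R * R * R => _) = fun=> 0)//.
    by apply/funext => q; rewrite big_nil.
  rewrite (_ : (fun q : R * R * R => _) = fun q => 1 * (\sum_(0 <= j < M) g j q) + g M q).
    have [tM WM] := loc M; split; first exact: test_fun_lin.
    by apply: (etrans (W_lin 1 IHt tM)); rewrite IHW WM mulr0 addr0.
  by apply/funext => q; rewrite big_nat_recr//= mul1r.
rewrite -[RHS](sumM (N + N)%N).2; congr W; apply/funext => q.
rewrite big_mkord -mulr_suml.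
have [->|] := eqVneq (cKdV_adjoint psi q) 0; first by rewrite mulr0.
move=> /cKdV_adjoint_supp sq; rewrite sum_arc ?mul1r//.
have [_ xq _] : cube X q.
  by move: sq; rewrite (closure_id (cube X)).1; [apply: closure_subset|exact: closed_cube].
by rewrite (le_trans _ XN)// lerD2r.
Qed.

End Limit.

(** * Reflection symmetry of the Bloch problem *)

Section Reflection.
Context {R : realType} (sg : 'I_2 -> R) (sg2 : forall i, sg i * sg i = 1).
Implicit Types (x y k : R * R).

Definition reflect_plane x : R * R := (sg 0 * x.1, sg 1 * x.2).
Local Notation S := reflect_plane.

Lemma reflect_planeK x : S (S x) = x.
Proof. by rewrite /S /= !mulrA !sg2 !mul1r -surjective_pairing. Qed.

Lemma sign_eq i : sg i = 1 \/ sg i = - 1.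
Proof.
have := sg2 i; rewrite -expr2 => /eqP; rewrite -subr_eq0 -[X in _ - X](expr1n _ 2) subr_sqr mulf_eq0.
by rewrite subr_eq0 addr_eq0 => /orP[/eqP|/eqP]; [left|right].
Qed.

Lemma reflect_plane_linear (s : R) x y : S (s *: x + y) = s *: S x + S y.
Proof. by congr pair; rewrite /= /GRing.scale/=; ring. Qed.

Lemma continuous_reflect_plane : continuous S.
Proof.
move=> x; apply: (@cvg_pair _ _ _ _ (nbhs (S x).1) (nbhs (S x).2)).
  by apply: cvgMr; exact: cvg_fst.
by apply: cvgMr; exact: cvg_snd.
Qed.

Lemma measurable_reflect_plane : measurable_fun setT S.
Proof.
by apply: measurable_fun_pair; apply: measurable_funM.
Qed.

Lemma ge0_integral_reflect (g : R * R -> \bar R) :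
  measurable_fun setT g -> (forall x, 0 <= g x)%E ->
  (\int[leb2 R]_y g (S y) = \int[leb2 R]_x g x)%E.
Proof.
move=> mg g0; have n1 i : `|sg i| = 1 by case: (sign_eq i) => ->; rewrite ?normrN normr1.
have nz i : sg i != 0 by rewrite -normr_gt0 n1.
have := @ge0_integral_linear2 _ g (sg 0) 0 0 (sg 1) (nz 0) _ mg g0.
rewrite mul0r subr0 mulf_neq0// normrM !n1 mulr1 invr1 mul1e => /(_ isT) <-.
by apply: eq_integral => y _; rewrite /S !mul0r addr0 add0r.
Qed.

Lemma Rintegral_reflect (g : R * R -> R) : measurable_fun setT g ->
  \int[leb2 R]_y g (S y) = \int[leb2 R]_x g x.
Proof.
move=> /measurable_EFinP mg; rewrite /Rintegral integralE [in RHS]integralE; congr (fine (_ - _)).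
  rewrite -(ge0_integral_reflect (measurable_funepos mg) (fun=> funepos_ge0 _ _)).
  by apply: eq_integral => x _; rewrite !funeposE.
rewrite -(ge0_integral_reflect (measurable_funeneg mg) (fun=> funeneg_ge0 _ _)).
by apply: eq_integral => x _; rewrite !funenegE.
Qed.

Lemma difference_reflect (f : R * R -> R) v x :
  (fun h : R => h^-1 *: (((fun y => f (S y)) \o shift x) (h *: v) - f (S x)))
  = (fun h : R => h^-1 *: ((f \o shift (S x)) (h *: S v) - f (S x))).
Proof. by apply/funext => h /=; rewrite reflect_plane_linear. Qed.

Lemma derive_reflect (f : R * R -> R) v x : 'D_v (fun y => f (S y)) x = 'D_(S v) f (S x).
Proof.
by rewrite /derive difference_reflect.
Qed.

Lemma derivable_reflect (f : R * R -> R) v x : derivable f (S x) (S v) ->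
  derivable (fun y => f (S y)) x v.
Proof.
by rewrite /derivable difference_reflect.
Qed.

Lemma Dseq_reflect (f : R * R -> R) s x :
  Dseq s (fun y => f (S y)) x = Dseq (map S s) f (S x).
Proof.
elim: s x => //= v s IH x; rewrite -derive_reflect.
by congr derive; apply/funext => y; exact: IH.
Qed.

Lemma smooth_on_reflect (f : R * R -> R) : smooth_on setT f -> smooth_on setT (fun x => f (S x)).
Proof.
move=> Sf n s sn x _; have [c d] := Sf n (map S s) ltac:(by rewrite size_map) (S x) I.
have E : Dseq s (fun y => f (S y)) = fun y => Dseq (map S s) f (S y).
  by apply/funext => y; exact: Dseq_reflect.
rewrite E; split; first by apply: (@continuous_comp _ _ _ S (Dseq (map S s) f) x); [exact: continuous_reflect_plane|].
by move=> sn' v; apply: derivable_reflect; apply: d; rewrite size_map.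
Qed.

Lemma test_fun_reflect (f : R * R -> R) : test_fun setT f -> test_fun setT (fun x => f (S x)).
Proof.
move=> [Sf cf _]; split=> //; first exact: smooth_on_reflect.
have cSf := continuous_compact (continuous_subspaceT continuous_reflect_plane) cf.
apply: (subclosed_compact (@closed_closure _ _) cSf).
have clS : closed (S @` supp f) := compact_closed (@norm_hausdorff _ _) cSf.
rewrite [X in _ `<=` X](closure_id _).1//; apply: closure_subset => x /= fx.
by exists (S x); [exact: subset_closure|exact: reflect_planeK].
Qed.

Lemma reflect_e2 i : S (e2 R i) = sg i *: e2 R i.
Proof.
by case: i => -[|[|//]] i2; congr pair; rewrite /= /GRing.scale/= ?mulr1 ?mulr0//;
  congr sg; exact: val_inj.
Qed.

Lemma coord_reflect k i : Defs.coord (S k) i = sg i * Defs.coord k i.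
Proof. by case: i => -[|[|//]] i2; rewrite /Defs.coord/=; congr (sg _ * _); exact: val_inj. Qed.

Lemma derive_reflect_e2 (f : R * R -> R) i x : smooth_on setT f ->
  'D_(e2 R i) f (S x) = sg i * 'D_(e2 R i) (fun y => f (S y)) x.
Proof.
move=> Sf; have [_ d _] := (smooth_onP _ _).1 Sf.
rewrite derive_reflect reflect_e2.
by case: (deriveZv (sg i) (d (S x) (e2 R i) I)) => _ ->; rewrite mulrA sg2 mul1r.
Qed.


Lemma open_measurable_plane (U : set (R * R)) : open U ->
  (measurable : set (set (measurableTypeR R * measurableTypeR R))) U.
Proof.
move=> oU; have [B [mB HB]] := measurable_base_prod (@measurable_base_R R) (@measurable_base_R R).
have -> : U = \bigcup_(n in [set n | B n `<=` U]) B n.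
  apply/seteqP; split=> [x Ux|x [n BU Bx]]; last exact: BU.
  have [n [Bx BU]] := HB x U (open_nbhs_nbhs (conj oU Ux)).
  by exists n.
by apply: bigcup_measurable => n _; exact: mB.
Qed.

Lemma L2_loc_reflect (u : R * R -> R) : L2_loc u -> L2_loc (fun x => u (S x)).
Proof.
move=> [mu Lu]; have muS : measurable_fun setT (fun x => u (S x)).
  exact: (measurableT_comp mu measurable_reflect_plane).
split=> // K cK.
have cSK := continuous_compact (continuous_subspaceT continuous_reflect_plane) cK.
apply: le_lt_trans (Lu _ cSK).
have mC (K' : set (R * R)) : compact K' ->
    (measurable : set (set (measurableTypeR R * measurableTypeR R))) K'.
  move=> cK'; rewrite -[K']setCK; apply: measurableC; apply: open_measurable_plane.
  by apply: closed_openC; exact: (compact_closed (@norm_hausdorff _ _) cK').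
pose g x : \bar R := (((fun x => ((u x) ^+ 2)%:E) \_ (S @` K)) x)%E.
have mg : measurable_fun setT g.
  apply/(measurable_restrictT _ (mC _ cSK)); apply: measurable_funTS.
  by apply/measurable_EFinP; exact: measurable_funX.
have g0 x : (0 <= g x)%E by rewrite /g patchE; case: ifP => // _; rewrite lee_fin sqr_ge0.
rewrite integral_mkcond [leRHS]integral_mkcond -[leRHS](ge0_integral_reflect mg g0).
rewrite le_eqVlt; apply/orP; left; apply/eqP; apply: eq_integral => x _.
rewrite /g !patchE; congr (if _ then _ else _).
apply/idP/idP; rewrite !inE; first by exists x.
by move=> [y Ky E]; rewrite -(reflect_planeK x) -E reflect_planeK.
Qed.

Lemma L2_loc_sign i (u : R * R -> R) : L2_loc u -> L2_loc (fun x => sg i * u x).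
Proof.
move=> [mu Lu]; split; first exact: measurable_funM.
by under eq_fun do rewrite exprMn expr2 sg2 mul1r.
Qed.

Lemma test_fun_scale (c : R) (f : R * R -> R) : test_fun setT f ->
  test_fun setT (fun x => c * f x).
Proof.
move=> [Sf cf _]; split=> //; first exact: (smooth_onZ c openT Sf).
apply: (subclosed_compact (@closed_closure _ _) cf); apply: closure_subset => x /=.
by apply: contra_neq => ->; rewrite mulr0.
Qed.

Lemma smooth_measurable (f : R * R -> R) : smooth_on setT f -> measurable_fun setT f.
Proof. by move=> Sf; apply: continuous_measurable_fun2 => x; exact: (C_on_cont (Sf 0%N) I). Qed.

(** The reflection is moved onto the test function; the chain rule there produces the sign
    [sg i]. *)
Lemma weak_partial_reflect i (u v : R * R -> R) :
  measurable_fun setT u -> measurable_fun setT v -> weak_partial i u v ->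
  weak_partial i (fun x => u (S x)) (fun x => sg i * v (S x)).
Proof.
move=> mu mv uv phi tphi; have tS := test_fun_reflect tphi; have [Sphi _ _] := tphi.
have [SphiS _ _] := tS.
have dS := (smooth_onP _ _).1 SphiS; have dphi := (smooth_onP _ _).1 Sphi.
have muS : measurable_fun setT (fun x => u (S x)) := measurableT_comp mu measurable_reflect_plane.
have mvS : measurable_fun setT (fun x => v (S x)) := measurableT_comp mv measurable_reflect_plane.
have mphi := smooth_measurable Sphi.
have mDphi : measurable_fun setT ('D_(e2 R i) phi).
  by apply: smooth_measurable; case: dphi => _ _; exact.
rewrite -(Rintegral_reflect (measurable_funM (measurable_funM (measurable_cst (sg i)) mvS) mphi)).
rewrite -(Rintegral_reflect (measurable_funM muS mDphi)).
transitivity (\int[leb2 R]_x (u x * 'D_(e2 R i) (fun y => sg i * phi (S y)) x)).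
  apply: eq_Rintegral => x _; rewrite /= reflect_planeK derive_reflect_e2//; congr (_ * _).
  case: dS => _ /(_ x (e2 R i) I) d _.
  by rewrite -[RHS]/('D_(e2 R i) (sg i \*: (fun y => phi (S y))) x) deriveZ.
rewrite (uv _ (test_fun_scale (sg i) tS)); congr (- _).
by apply: eq_Rintegral => x _; rewrite /= reflect_planeK mulrCA mulrA.
Qed.

Lemma Y_periodic_reflect (X : Type) (h : R * R -> X) : Y_periodic h -> Y_periodic (fun y => h (S y)).
Proof.
move=> hp; have p i (y1 y2 : R) : h (y1 + sg i * (2 * pi), y2) = h (y1, y2).
  case: (sign_eq i) => ->; first by rewrite mul1r; have [] := hp y1 y2.
  by have [<- _] := hp (y1 + - 1 * (2 * pi)) y2; congr (h (_, _)); ring.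
have q i (y1 y2 : R) : h (y1, y2 + sg i * (2 * pi)) = h (y1, y2).
  case: (sign_eq i) => ->; first by rewrite mul1r; have [] := hp y1 y2.
  by have [_ <-] := hp y1 (y2 + - 1 * (2 * pi)); congr (h (_, _)); ring.
by move=> y1 y2; rewrite /S /= !(mulrDr (sg _) _ (2 * pi)) p q.
Qed.

(** Null sets are preserved because the integral of an indicator function is reflection
    invariant. *)
Lemma ae_reflect (P : R * R -> Prop) : {ae leb2 R, forall y, P (S y)} -> {ae leb2 R, forall y, P y}.
Proof.
move=> [N [mN N0 NS]].
have mSN : (measurable : set (set (measurableTypeR R * measurableTypeR R))) (S @^-1` N).
  by rewrite -[X in measurable X]setTI; exact: measurable_reflect_plane.
exists (S @^-1` N); split=> //.
  have I1 := @integral_indic _ _ R (leb2 R) setT measurableT N mN.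
  have I2 := @integral_indic _ _ R (leb2 R) setT measurableT _ mSN.
  have mind : measurable_fun setT (fun x => (\1_N x)%:E : \bar R).
    by apply/measurable_EFinP; exact: measurable_indic.
  rewrite setIT in I1; rewrite setIT in I2; rewrite -[LHS]I2 -[RHS]N0 -[RHS]I1.
  by rewrite -(ge0_integral_reflect mind).
by move=> y /= nP; apply: NS => /= PS; apply: nP; rewrite -(reflect_planeK y).
Qed.

Definition measurable_complex (h : R * R -> R[i]) :=
  measurable_fun setT (fun y => complex.Re (h y)) /\
  measurable_fun setT (fun y => complex.Im (h y)).

Lemma measurable_complexD h1 h2 : measurable_complex h1 -> measurable_complex h2 ->
  measurable_complex (fun y => h1 y + h2 y).
Proof.
move=> [r1 i1] [r2 i2]; split.
  rewrite (_ : (fun y => _) = fun y => complex.Re (h1 y) + complex.Re (h2 y)).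
    exact: measurable_funD.
  by apply/funext => y; case: (h1 y) (h2 y) => [? ?] [? ?].
rewrite (_ : (fun y => _) = fun y => complex.Im (h1 y) + complex.Im (h2 y)).
  exact: measurable_funD.
by apply/funext => y; case: (h1 y) (h2 y) => [? ?] [? ?].
Qed.

Lemma measurable_complexM h1 h2 : measurable_complex h1 -> measurable_complex h2 ->
  measurable_complex (fun y => h1 y * h2 y).
Proof.
move=> [r1 i1] [r2 i2]; split.
  rewrite (_ : (fun y => _) = fun y => complex.Re (h1 y) * complex.Re (h2 y)
      - complex.Im (h1 y) * complex.Im (h2 y)).
    by apply: measurable_funB; exact: measurable_funM.
  by apply/funext => y; case: (h1 y) (h2 y) => [? ?] [? ?].
rewrite (_ : (fun y => _) = fun y => complex.Re (h1 y) * complex.Im (h2 y)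
    + complex.Im (h1 y) * complex.Re (h2 y)).
  by apply: measurable_funD; exact: measurable_funM.
by apply/funext => y; case: (h1 y) (h2 y) => [? ?] [? ?].
Qed.

Lemma measurable_complex_cst z : measurable_complex (fun=> z).
Proof. by split; exact: measurable_cst. Qed.

Lemma measurable_complex_real (u : R * R -> R) : measurable_fun setT u ->
  measurable_complex (fun y => (u y)%:C%C).
Proof. by move=> mu; split=> //; exact: measurable_cst. Qed.

Lemma measurable_complex_sum (h : 'I_2 -> R * R -> R[i]) : (forall i, measurable_complex (h i)) ->
  measurable_complex (fun y => \sum_(i < 2) h i y).
Proof.
move=> mh; rewrite (_ : (fun y => _) = fun y => h 0 y + h 1 y); first exact: measurable_complexD.
by apply/funext => y; rewrite big_ord_recl big_ord1; congr (_ + h _ y); exact: val_inj.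
Qed.

Lemma Cintegral_reflect h : measurable_complex h -> Cintegral (fun y => h (S y)) = Cintegral h.
Proof.
by move=> [mr mi]; rewrite /Cintegral (Rintegral_reflect mr) (Rintegral_reflect mi).
Qed.

(** The eigenfunction is reflected and its weak gradient acquires the sign [sg j], as does the
    quasimomentum. The entry [a i j] then appears with the sign [sg i * sg j], which is [1] on the
    diagonal; off the diagonal the entries vanish by assumption. *)
Lemma Bloch_eigenvalue_reflect (a : R * R -> 'M[R]_2) k mu :
  (forall i j, measurable_fun setT (fun y => a y i j)) -> (forall y, a (S y) = a y) ->
  (forall y, is_diag_mx (a y)) -> Bloch_eigenvalue a k mu -> Bloch_eigenvalue a (S k) mu.
Proof.
move=> ma aS adiag [psi [g [psip psi0 [Lr Li] gw eqn]]].
have mpsi : measurable_complex psi by split; [case: Lr|case: Li].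
have mg j : measurable_complex (g j) by case: (gw j) => -[? _] [? _].
exists (fun y => psi (S y)), (fun j y => (sg j)%:C%C * g j (S y)); split.
- exact: Y_periodic_reflect.
- by move=> h; apply: psi0; exact: (@ae_reflect (fun y => psi y = 0)).
- by split; [exact: (L2_loc_reflect Lr)|exact: (L2_loc_reflect Li)].
- move=> j; have [Lgr Lgi wr wi] := gw j.
  have rE : (fun y => complex.Re ((sg j)%:C%C * g j (S y))) = fun y => sg j * complex.Re (g j (S y)).
    by apply/funext => y; case: (g j (S y)) => u v /=; rewrite mul0r subr0.
  have iE : (fun y => complex.Im ((sg j)%:C%C * g j (S y))) = fun y => sg j * complex.Im (g j (S y)).
    by apply/funext => y; case: (g j (S y)) => u v /=; rewrite mul0r addr0.
  rewrite rE iE; split.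
  + exact: L2_loc_sign (L2_loc_reflect Lgr).
  + exact: L2_loc_sign (L2_loc_reflect Lgi).
  + by apply: (weak_partial_reflect _ _ wr); [case: Lr|case: Lgr].
  + by apply: (weak_partial_reflect _ _ wi); [case: Li|case: Lgi].
move=> phi tphi; have tS := test_fun_reflect tphi; have [Sphi _ _] := tphi.
have [SphiS _ _] := tS.
have mphiS : measurable_complex (fun y => (phi (S y))%:C%C).
  by apply: measurable_complex_real; exact: smooth_measurable.
rewrite -[in RHS](_ : Cintegral (fun y => psi y * (phi (S y))%:C%C)
    = Cintegral (fun y => psi (S y) * (phi y)%:C%C)); last first.
  rewrite -(Cintegral_reflect (measurable_complexM mpsi mphiS)); congr Cintegral.
  by apply/funext => y; rewrite reflect_planeK.
rewrite -eqn//; set H := (X in _ = Cintegral X).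
have mH : measurable_complex H.
  apply: measurable_complex_sum => i; apply: measurable_complex_sum => j.
  have mDphi : measurable_complex (fun y => ('D_(e2 R i) (fun y => phi (S y)) y)%:C%C).
    apply: measurable_complex_real; apply: smooth_measurable.
    by have [_ _] := (smooth_onP _ _).1 SphiS; exact.
  apply: measurable_complexM.
    apply: measurable_complexM; first exact: measurable_complex_real.
    apply: (measurable_complexD (mg j)).
    exact: (measurable_complexM (measurable_complex_cst _) mpsi).
  rewrite (_ : (fun y => _) = fun y => ('D_(e2 R i) (fun y => phi (S y)) y)%:C%C
    + (- ('i%C * (Defs.coord k i)%:C%C)) * (phi (S y))%:C%C).
    apply: (measurable_complexD mDphi).
    exact: (measurable_complexM (measurable_complex_cst _) mphiS).
  by apply/funext => y; rewrite mulNr.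
rewrite -(Cintegral_reflect mH); congr Cintegral; apply/funext => y; rewrite /H.
apply: eq_bigr => i _; apply: eq_bigr => j _.
have [<-|ij] := eqVneq i j; last first.
  have /is_diag_mxP/(_ i j ij) aij := adiag y.
  by rewrite aS aij !mul0r.
rewrite aS reflect_planeK !coord_reflect.
have DE : 'D_(e2 R i) phi y = sg i * 'D_(e2 R i) (fun y => phi (S y)) (S y).
  by rewrite -[in LHS](reflect_planeK y) derive_reflect_e2.
rewrite DE !rmorphM/=.
have s1 : (sg i)%:C%C * (sg i)%:C%C = 1 :> R[i] by rewrite -rmorphM sg2.
have alg (s a' g' I0 k' p D f : R[i]) : s * s = 1 ->
  a' * (s * g' + I0 * (s * k') * p) * (s * D - I0 * (s * k') * f) =
  a' * (g' + I0 * k' * p) * (D - I0 * k' * f).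
  move=> ss; transitivity ((s * s) * (a' * (g' + I0 * k' * p) * (D - I0 * k' * f))); first ring.
  by rewrite ss mul1r.
exact: alg.
Qed.

End Reflection.

(** * Parity of the lowest Bloch eigenvalue and the form of [A] and [C] *)

Section EvenForm.
Context {R : realType}.

Lemma Dseq_map_scale (V : normedModType R) (I : Type) (U : set V) (f : V -> R) (c : I -> R)
    (e : I -> V) (s : seq I) x : open U -> smooth_on U f -> U x ->
  Dseq [seq c i *: e i | i <- s] f x = (\prod_(i <- s) c i) * Dseq (map e s) f x.
Proof.
move=> oU Sf; elim: s x => [|i s IH] x Ux; first by rewrite big_nil mul1r.
rewrite big_cons /=.
have [_ d _] := (smooth_onP _ _).1 (smooth_on_Dseq (map e s) Sf).
have E : \near x, Dseq [seq c i *: e i | i <- s] f x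
    = (\prod_(i <- s) c i) * Dseq (map e s) f x by exact: (open_near oU Ux).
set K := \prod_(i <- s) c i in E *; set g := Dseq (map e s) f in d E *.
transitivity ('D_(c i *: e i) (K \*: g) x); first exact: near_eq_derive.
have dK : derivable (K \*: g) x (e i) by apply: derivableZ; exact: d.
have [_ ->] := deriveZv (c i) dK.
by rewrite deriveZ ?mulrA//; exact: d.
Qed.

Lemma Dseq_swap (V : normedModType R) (U : set V) (f : V -> R) s1 s2 u v x :
  open U -> smooth_on U f -> U x ->
  Dseq (s1 ++ u :: v :: s2) f x = Dseq (s1 ++ v :: u :: s2) f x.
Proof.
move=> oU Sf Ux; rewrite !Dseq_cat; apply: (Dseq_eq s1 oU _ Ux) => y Uy /=.
exact: (Schwarz v u oU (smooth_on_Dseq s2 Sf) Uy).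
Qed.

Context (aY : R * R -> 'M[R]_2) (mu0 : R * R -> R) (U : set (R * R)).
Hypothesis aY_medium : medium aY.
Hypothesis aY_even : evenly_symmetric aY.
Hypothesis aY_diag : forall y, is_diag_mx (aY y).
Hypothesis mu0E : forall k : R * R, - 2^-1 < k.1 < 2^-1 -> - 2^-1 < k.2 < 2^-1 ->
  smallest_Bloch_eigenvalue aY k (mu0 k).
Hypothesis U0 : open_nbhs (0 : R * R) U.
Hypothesis mu0_smooth : smooth_on U mu0.

Definition flip (i j : 'I_2) : R := if i == j then - 1 else 1.

Lemma flipM i j : flip i j * flip i j = 1.
Proof. by rewrite /flip; case: eqP; rewrite ?mulN1r ?opprK ?mul1r. Qed.

(** Reflection carries the minimal eigenvalue at [k] to an eigenvalue at the reflected
    quasimomentum, which gives one inequality; the reflection is an involution, which gives the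
    other. *)
Lemma mu0_reflect i k : - 2^-1 < k.1 < 2^-1 -> - 2^-1 < k.2 < 2^-1 ->
  mu0 (reflect_plane (flip i) k) = mu0 k.
Proof.
have sgn j (x : R) : - 2^-1 < x < 2^-1 -> - 2^-1 < flip i j * x < 2^-1.
  by move=> /andP[x1 x2]; rewrite /flip; case: eqP => _; rewrite ?mul1r ?mulN1r; apply/andP; split; lra.
have le (k' : R * R) : - 2^-1 < k'.1 < 2^-1 -> - 2^-1 < k'.2 < 2^-1 ->
    mu0 (reflect_plane (flip i) k') <= mu0 k'.
  move=> k1 k2; have [Bk _] := mu0E k1 k2.
  have [_] := @mu0E (reflect_plane (flip i) k') (sgn 0 k'.1 k1) (sgn 1 k'.2 k2); apply.
  apply: Bloch_eigenvalue_reflect => //; first exact: flipM.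
    have [Ca _ _ _] := aY_medium.
    by move=> j l; apply: continuous_measurable_fun2 => x; exact: (C_on_cont (Ca j l) I).
  move=> [y1 y2]; rewrite /reflect_plane /flip; have [e1 _] := aY_even y1 y2.
  have [_ e2] := aY_even y1 y2; case: (i) => -[|[|//]] i2 /=.
    by rewrite mulN1r mul1r.
  by rewrite mulN1r mul1r.
move=> k1 k2; apply/eqP; rewrite eq_le le//=.
by rewrite -[X in mu0 X <= _](reflect_planeK (flipM i) k) le//; exact: sgn.
Qed.

(** Differentiating the evenness in the [i]-th coordinate, valid on the open square [Q], multiplies
    the derivative at the fixed point [0] by [- 1] to the number of occurrences of [i]; for an odd
    number it equals its own opposite. *)
Lemma Dseq_mu0_odd (s : seq 'I_2) i : odd (count_mem i s) -> Dseq (map (@e2 R) s) mu0 0 = 0.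
Proof.
move=> os; have [oU Ux] := U0.
pose Q : set (R * R) := `]- 2^-1, 2^-1[%classic `*` `]- 2^-1, 2^-1[%classic.
have oQ : open Q.
  have oI : open (`]- 2^-1, 2^-1[%classic : set R) by exact: interval_open.
  exact: (openI (open_comp (fun x _ => cvg_fst) oI) (open_comp (fun x _ => cvg_snd) oI)).
have Q0 : Q 0 by split; rewrite /= in_itv/= ltrNl oppr0 andbb invr_gt0.
have E : forall x, Q x -> mu0 (reflect_plane (flip i) x) = mu0 x.
  by move=> x [/=]; rewrite !in_itv/=; exact: mu0_reflect.
have := Dseq_eq (map (@e2 R) s) oQ E Q0.
rewrite Dseq_reflect -map_comp.
rewrite (_ : reflect_plane (flip i) 0 = 0); last by rewrite /reflect_plane /= !mulr0.
rewrite (eq_map (g := fun j => flip i j *: e2 R j)); last by move=> j; exact: reflect_e2.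
rewrite (Dseq_map_scale (flip i) _ s oU mu0_smooth Ux).
rewrite (_ : \prod_(j <- s) flip i j = - 1); last first.
  transitivity ((-1) ^+ count_mem i s : R); last by rewrite -signr_odd os expr1.
  elim: s {os} => [|j s IH]; first by rewrite big_nil.
  rewrite big_cons IH /flip eq_sym /= exprD; congr (_ * _).
  by case: eqP.
by move=> h; lra.
Qed.

Lemma even_form_exists : exists (a alpha : 'I_2 -> R) (beta : R),
  even_form (effA mu0) (effC mu0) a alpha beta.
Proof.
have [oU Ux] := U0.
exists (fun i => effA mu0 i i), (fun i => effC mu0 i i i i), (effC mu0 0 0 1 1); split.
- apply/matrixP => i j; rewrite !mxE; have [->|ij] := eqVneq i j; first by rewrite mulr1n.
  by rewrite (@Dseq_mu0_odd [:: i; j] i) ?mulr0//= eqxx eq_sym (negbTE ij).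
- by [].
- have sw12 a b c d : effC mu0 a b c d = effC mu0 a c b d.
    by rewrite /effC (Dseq_swap [:: e2 R a] [:: e2 R d] _ _ oU mu0_smooth Ux).
  have sw01 a b c d : effC mu0 a b c d = effC mu0 b a c d.
    by rewrite /effC (Dseq_swap [::] [:: e2 R c; e2 R d] _ _ oU mu0_smooth Ux).
  have sw23 a b c d : effC mu0 a b c d = effC mu0 a b d c.
    by rewrite /effC (Dseq_swap [:: e2 R a; e2 R b] [::] _ _ oU mu0_smooth Ux).
  have main i j : i != j -> effC mu0 i i j j = effC mu0 0 0 1 1.
    have [-> /negbTE j0|i0] := eqVneq i 0.
      by rewrite (_ : j = 1)//; apply: val_inj; case: j j0 => -[|[|]].
    move=> ij; rewrite (_ : i = 1); last by apply: val_inj; case: i i0 {ij} => -[|[|]].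
    rewrite (_ : j = 0); last first.
      by apply: val_inj; move: i0 ij; case: i => -[|[|//]] ? //; case: j => -[|[|]].
    by rewrite sw12 sw01 sw23 sw12.
  by move=> i j ij; split; [rewrite sw12|rewrite sw23 sw12|]; exact: main.
move=> l m n q h; rewrite /effC.
(* With two letters, a word of length four that fits none of the three pairings contains [0] exactly
   once or three times. *)
rewrite (_ : Dseq _ _ _ = 0) ?mulr0//; apply: (@Dseq_mu0_odd [:: l; m; n; q] 0).
by move: h; case: l => -[|[|//]] ?; case: m => -[|[|//]] ?; case: n => -[|[|//]] ?; case: q => -[|[|//]] ?.
Qed.

End EvenForm.

Theorem proposition3p1 (R : realType) (aY : R * R -> 'M[R]_2)
    (mu0 : R * R -> R) (E : 'M[R]_2)
    (F : 'I_2 -> 'I_2 -> 'I_2 -> 'I_2 -> R) (f : R * R -> R) (T : R)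
    (h_medium : medium aY)
    (h_even : evenly_symmetric aY)
    (h_mu0 : forall k : R * R, - 2^-1 < k.1 < 2^-1 -> - 2^-1 < k.2 < 2^-1 ->
       smallest_Bloch_eigenvalue aY k (mu0 k))
    (h_mu0_smooth : exists2 U : set (R * R), open_nbhs (0 : R * R) U & smooth_on U mu0)
    (h_A : posdef (effA mu0))
    (h_E : symm_psd2 E)
    (h_F : symm_psd4 F)
    (h_EF : decomposes (effA mu0) (effC mu0) E F)
    (h_f1 : f \in Lfun (leb2 R) 1%:E)
    (h_f2 : f \in Lfun (leb2 R) 2%:E)
    (h_fourier : compact (supp (fourier f)))
    (h_T : 0 < T) :
  ((forall y, is_diag_mx (aY y)) ->
     exists (a alpha : 'I_2 -> R) (beta : R),
       even_form (effA mu0) (effC mu0) a alpha beta) /\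
  (forall (a alpha : 'I_2 -> R) (beta : R),
     even_form (effA mu0) (effC mu0) a alpha beta ->
   forall w : R -> R * R * R -> R,
     (forall eps, 0 < eps -> wave_solution (effA mu0) E F f eps (w eps)) ->
   forall W : (R * R * R -> R) -> R,
     is_distribution [set p : R * R * R | 0 < p.2 < T] W ->
     (forall psi, test_fun [set p : R * R * R | 0 < p.2 < T] psi ->
        (fun eps => \int[leb3 R]_(p in [set p | 0 < p.2 < T])
                      (Weps a eps (w eps) p * psi p)) @ 0^'+ --> W psi) ->
     linearized_cKdV T (kappa a alpha beta) (dist_D (e3 R 0) W)).
Proof.
split.
  move=> diag; have [U U0 SU] := h_mu0_smooth.
  exact: even_form_exists h_medium h_even diag h_mu0 U0 SU.
move=> a alpha beta even w w_sol W [W_lin _] W_cvg.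
exact: (cKdV_limit h_T h_A h_EF even w_sol W_lin W_cvg).
Qed.
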